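(* Let $Q,\rho,m,Z,G_1,\delta,\omega,\rho_\omega,D_\omega,Z_\omega$ and, for $\tau\in\mathbb T$ with $\omega\in\Omega_{\rho,\tau}$, $Z_{\omega,\tau},H,\mathcal E$ be as in the context. Let $A,B\in\mathbb C[Y]$ with $\deg A<\deg B$, $B(0)=1$ and all roots of $B$ in $\rho\overline{\mathbb D}$; put $P(X,Y)=\frac{A(Y)}{B(Y)}+\frac{B'(Y)}{B(Y)}X$ and $N=G_1-P$. Let $d\in\mathbb N^*$ and let $s_1,\dots,s_d$ be holomorphic functions on $Z_\omega$. Then $(s_1,\dots,s_d)$ is a solution of the system $$-s_d\frac{\partial N}{\partial x}+\frac{\partial s_d}{\partial y}=0,\qquad -s_k\frac{\partial N}{\partial x}+\frac{\partial s_k}{\partial y}=\frac{\partial s_{k+1}}{\partial x},\quad 1\le k\le d-1,$$ if and only if there exist holomorphic functions $\mu_1,\dots,\mu_d$ on $D_\omega$ such that for every $\tau\in\mathbb T$ (with $\omega\in\Omega_{\rho,\tau}$) the following system holds on $Z_{\omega,\tau}$: $$(1\otimes B)\,s_k=\left(\mathcal E^0(\mu_k\otimes1)+\cdots+\mathcal E^{d-k}(\mu_d\otimes1)\right)e^H,\qquad d\ge k\ge1.$$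
   Context: Nodal surfaces. A Riemann surface with boundary is a connected complex $1$-manifold $S$ that is a dense open subset of an oriented real two-dimensional manifold with boundary $\overline S$, with $bS=\overline S\setminus S$. A nodal Riemann surface with boundary is $Q=(\overline S/\mathcal R)\setminus\pi(bS)$, where $S$ is a Riemann surface with boundary, $\mathcal R$ is an equivalence relation identifying finitely many points of $\overline S$ but never two distinct points of $bS$, and $\pi$ is the projection; $bQ=\pi(bS)$, and $\operatorname{Reg}Q$ is the set of points of $Q$ with exactly one preimage under $\pi$. Setting for $Q$. $Q$ is a nodal Riemann surface with boundary embedded in $\mathbb{CP}_2$ (homogeneous coordinates $w=(w_0:w_1:w_2)$), a relatively compact domain of an open nodal Riemann surface of $\mathbb{CP}_2$; $\partial Q$ is $bQ$ with the boundary orientation. Assume $bQ\subset\{w_0w_1w_2\ne0\}$, $Q$ meets $\{w_0=0\}$ transversally in a set $Q_\infty\subset\operatorname{Reg}Q$, and $(0:1:0)\notin Q_\infty$. $\mathbb D$ is the open unit disc and $\mathbb T$ the unit circle of $\mathbb C$. Put $\rho=\max_{w\in bQ}|w_2/w_1|$, $m(y)=\min_{w\in bQ}|y\frac{w_1}{w_0}+\frac{w_2}{w_0}|$ for $|y|>\rho$, $Z=\{(x,y)\in\mathbb C^2;\ |y|>\rho,\ |x|<m(y)\}$, $$G_1(x,y)=\frac1{2\pi i}\int_{\partial Q}\frac{w_1}{w_0}\,\frac{d\left(x+y\frac{w_1}{w_0}+\frac{w_2}{w_0}\right)}{x+y\frac{w_1}{w_0}+\frac{w_2}{w_0}}\quad\text{on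 }Z,\qquad \delta=\frac1{2\pi i}\int_{\partial Q}\frac{d(w_1/w_0)}{w_1/w_0}\in\mathbb Z.$$ On $Z$ one has $G_1(x,y)=\sum_{m\ge1}G_{1,m}(x)y^{-m}$ with polynomials $G_{1,m}$, and $G_{1,1}(x)=G_{1,1}(0)-\delta x$. Operators. For $r\ge0$ and $\tau\in\mathbb T$ put $\Omega_{r,\tau}=\mathbb C\setminus(r\overline{\mathbb D}\cup\mathbb R_+\tau)$. Fix $\omega\in\Omega_{\rho,\tau}$. The operator $\mathcal P_{r,\tau,\omega}$ associates to a holomorphic function on $\Omega_{r,\tau}$ its primitive that vanishes at $\omega$; it is applied to functions of $(x,y)$ with respect to $y$, $x$ being a parameter. Put $J=\mathcal P_{0,\tau,\omega}(1/y)$. Fix $\rho_\omega\in\,]\rho,+\infty[$ such that $m(y)\ge m(\omega)=m_\omega$ whenever $|y|\ge\rho_\omega$. Put $D_\omega=\{|x|<\frac12m_\omega\}$, $Z_\omega=D_\omega\times(\mathbb C\setminus\rho_\omega\overline{\mathbb D})$, and let $Z_{\omega,\tau}$ be $Z_\omega$ with the points $(x,y)$, $y\in\mathbb R_+\tau$, removed. Put $$H(x,y)=-\delta J(y)-\sum_{m\ge1}\frac{G_{1,m+1}'(x)}{m}\,\frac1{y^{m}}$$ and define, on holomorphic functions $f$ on $Z_{\omega,\tau}$, $\mathcal Df=e^{-H}\frac{\partial}{\partial x}(e^Hf)=\frac{\partial f}{\partial x}+\frac{\partial H}{\partial x}f$ and $\mathcal E=\mathcal P_{\rho_\omega,\tau,\omega}\circ\mathcal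 D$; $\mathcal E^j$ is the $j$-th iterate, $\mathcal E^0$ the identity. Notation: $(a\otimes b)(x,y)=a(x)b(y)$.
   Formalization: The formal statement requires |ω| > ρ_ω, so that the primitive vanishing at ω on Ω_{ρ_ω,τ} is defined, and replaces ''m(y) ≥ m(ω) whenever |y| ≥ ρ_ω'', which is then contradictory, by m(y) ≥ m(ω)/2. *)

(* Defs.v *)
From HB Require Import structures.
From mathcomp Require Import all_boot all_order all_algebra.
From mathcomp Require Import complex.
From mathcomp Require Import all_classical all_reals all_analysis.

Set Implicit Arguments.
Unset Strict Implicit.
Unset Printing Implicit Defensive.

Import Order.TTheory GRing.Theory Num.Theory numFieldNormedType.Exports.
Local Open Scope classical_set_scope.
Local Open Scope ring_scope.
Local Open Scope complex_scope.

(* MathComp-Analysis attaches the norm topology to [numFieldType], not to the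
   bare type [R[i]].  Over [cplx R], [derivable] and [differentiable] mean
   complex differentiability. *)
Definition cplx (R : realType) : numClosedFieldType := R[i].

Definition cabs (R : realType) (z : cplx R) : R := ComplexField.Normc.normc z.

Definition cexp (R : realType) (z : cplx R) : cplx R :=
  (expR (complex.Re z))%:C *
  (cos (complex.Im z) +i* sin (complex.Im z)).

Definition two_pi_i (R : realType) : cplx R := 0 +i* (2 * pi).

Definition holomorphic_on (R : realType) (V : normedModType (cplx R))
  (U : set V) (f : V -> cplx R) : Prop := forall p, U p -> differentiable f p.

Definition rderive (R : realType) (g : R -> cplx R) (t : R) : cplx R :=
  'D_1 (fun s => complex.Re (g s)) t +i* 'D_1 (fun s => complex.Im (g s)) t.

Definition C1_at (R : realType) (g : R -> cplx R) (t : R) : Prop :=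
  (\forall s \near t, derivable (fun s => complex.Re (g s)) s 1 /\
                      derivable (fun s => complex.Im (g s)) s 1) /\
  {for t, continuous (rderive g)}.

Definition integral01 (R : realType) (g : R -> cplx R) : cplx R :=
  (\int[lebesgue_measure]_(t in `[0, 1]) complex.Re (g t)) +i*
  (\int[lebesgue_measure]_(t in `[0, 1]) complex.Im (g t)).

(** * Riemann surfaces *)

(* A homeomorphism [chart_map] of an open set [chart_dom] onto an open subset of
   the complex plane, with inverse [chart_inv]; values outside are irrelevant. *)
Record chart (R : realType) (M : topologicalType) := Chart {
  chart_dom : set M;
  chart_map :> M -> cplx R;
  chart_inv : cplx R -> M;
  chart_dom_open : open chart_dom;
  chart_im_open : open (chart_map @` chart_dom);
  chartK : forall p, chart_dom p -> chart_inv (chart_map p) = p;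
  chart_continuous : forall p, chart_dom p -> {for p, continuous chart_map};
  chart_inv_continuous : forall z, (chart_map @` chart_dom) z ->
    {for z, continuous chart_inv} }.

Record riemann_surface (R : realType) := RiemannSurface {
  rs_carrier :> topologicalType;
  rs_atlas : set (chart R rs_carrier);
  rs_hausdorff : hausdorff_space rs_carrier;
  rs_connected : connected [set: rs_carrier];
  rs_cover : forall p, exists2 a, rs_atlas a & chart_dom a p;
  rs_compatible : forall a b, rs_atlas a -> rs_atlas b ->
    forall p, chart_dom a p -> chart_dom b p ->
    derivable (fun z => b (chart_inv a z)) (a p) 1 }.

Definition chart_at (R : realType) (M : riemann_surface R) (p : M)
  (a : chart R M) : Prop := rs_atlas a /\ chart_dom a p.

(* Derivative of [f] at [p], read in the chart [a]. *)
Definition chart_derive (R : realType) (M : riemann_surface R)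
  (a : chart R M) (f : M -> cplx R) (p : M) : cplx R :=
  'D_1 (fun z => f (chart_inv a z)) (a p).

(** * Nodal curves of the projective plane *)

(* A point of CP_2 is given by homogeneous coordinates, i.e. a nonzero vector
   [u : 'rV_3] up to a nonzero scalar; [proj_eq] is equality in CP_2. *)
Definition proj_eq (R : realType) (u v : 'rV[cplx R]_3) : Prop :=
  exists2 c : cplx R, c != 0 & v = c *: u.

(* The rational function w_i / w_j along a map into CP_2. *)
Definition aff (R : realType) (M : Type) (w : M -> 'rV[cplx R]_3)
  (i j : 'I_3) (p : M) : cplx R := w p 0 i / w p 0 j.

(* An open nodal Riemann surface embedded in CP_2, given by its normalisation
   [nc_surf] and the map [nc_pt] into CP_2.  [nc_pt] is an arbitrary pointwise
   choice of homogeneous coordinates, so that only its ratios are regular.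
   The identifications are those of [proj_eq]: [nc_nodes] says that they concern
   finitely many points, [nc_embedded] that the injection of the quotient into
   CP_2 is a homeomorphism onto its image (the open sets of CP_2 being the open
   cones of C^3). *)
Record nodal_curve (R : realType) := NodalCurve {
  nc_surf :> riemann_surface R;
  nc_noncompact : ~ compact [set: nc_surf];
  nc_pt : nc_surf -> 'rV[cplx R]_3;
  nc_pt_neq0 : forall p, nc_pt p != 0;
  nc_chart_open : forall j, open [set p | nc_pt p 0 j != 0];
  nc_holomorphic : forall i j p a, nc_pt p 0 j != 0 -> chart_at p a ->
    derivable (fun z => aff nc_pt i j (chart_inv a z)) (a p) 1;
  nc_immersion : forall p a, chart_at p a ->
    exists i j, nc_pt p 0 j != 0 /\ chart_derive a (aff nc_pt i j) p != 0;
  nc_nodes : finite_set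
    [set p | exists2 q, q <> p & proj_eq (nc_pt q) (nc_pt p)];
  nc_embedded : forall U : set nc_surf, open U ->
    (forall p q, U p -> proj_eq (nc_pt p) (nc_pt q) -> U q) ->
    exists V : set 'rV[cplx R]_3,
      [/\ open V,
          (forall (c : cplx R) u, c != 0 -> V u -> V (c *: u)) &
          U = nc_pt @^-1` V] }.

Definition bdry (T : topologicalType) (S : set T) : set T := closure S `\` S.

(* The points of the closure of [S] whose image belongs to
   Q = pi(closure S) \ pi(bS). *)
Definition over_Q (R : realType) (X : nodal_curve R) (S : set X) : set X :=
  [set p | closure S p /\
           forall b, bdry S b -> ~ proj_eq (nc_pt b) (nc_pt p)].

(* A nodal Riemann surface with boundary Q, relatively compact domain of the
   nodal curve [nd_X].  Here S is the normalisation of Q.  Its boundary bS is a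
   finite disjoint union of regular C^1 Jordan curves, parametrised by the
   1-periodic maps [nd_gam i]; [nd_left] says that along bS the set S lies on
   the left and only there, so that closure S is a C^1 surface with boundary bS
   and the parametrisation is positive for the boundary orientation.
   [nd_Q_open]: Q is open in the quotient space defined by [nd_X]. *)
Record nodal_domain (R : realType) := NodalDomain {
  nd_X : nodal_curve R;
  nd_S : set nd_X;
  nd_open : open nd_S;
  nd_nonempty : nd_S !=set0;
  nd_connected : connected nd_S;
  nd_compact : compact (closure nd_S);
  nd_nb : nat;
  nd_gam : 'I_nd_nb -> R -> nd_X;
  nd_continuous : forall i, continuous (nd_gam i);
  nd_periodic : forall i t, nd_gam i (t + 1) = nd_gam i t;
  nd_jordan : forall i j s t, nd_gam i s = nd_gam j t ->
    i = j /\ exists n : int, s = t + n%:~R;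
  nd_bdry : bdry nd_S = [set p | exists i t, p = nd_gam i t];
  nd_C1 : forall i t a, chart_at (nd_gam i t) a ->
    C1_at (fun s => a (nd_gam i s)) t /\
    rderive (fun s => a (nd_gam i s)) t != 0;
  nd_left : forall i t a, chart_at (nd_gam i t) a ->
    let z := a (nd_gam i t) in
    let n := 'i * rderive (fun s => a (nd_gam i s)) t in
    \forall e \near 0^'+,
      nd_S (chart_inv a (z + e%:C * n)) /\
      ~ closure nd_S (chart_inv a (z - e%:C * n));
  nd_bdry_inj : forall p q, bdry nd_S p -> bdry nd_S q ->
    proj_eq (nc_pt p) (nc_pt q) -> p = q;
  nd_Q_open :
    open [set p : nd_X | exists2 q, over_Q nd_S q & proj_eq (nc_pt q) (nc_pt p)] }.

Section Setting.
Variables (R : realType) (Q : nodal_domain R).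
Local Notation C := (cplx R).
Local Notation X := (nd_X Q).
Local Notation S := (@nd_S R Q).
Local Notation gam := (@nd_gam R Q).
Local Notation w := (@nc_pt R X).

(* bQ avoids the coordinate axes; at the points of Q on {w_0 = 0}, there is only
   one preimage, the intersection is transverse, and the point is not (0:1:0).
   Transversality to {w_0 = 0} at p, where w_j <> 0, means that the derivative
   of the local equation w_0 / w_j does not vanish at p. *)
Definition general_position : Prop :=
  (forall p j, bdry S p -> w p 0 j != 0) /\
  (forall p, over_Q S p -> w p 0 0 = 0 ->
     [/\ forall q, closure S q -> proj_eq (w q) (w p) -> q = p,
         forall a j, chart_at p a -> w p 0 j != 0 ->
           chart_derive a (aff w 0 j) p != 0 &
         ~ proj_eq (w p) (delta_mx 0 1)]).

(* The integral of the 1-form g dh over the oriented boundary of Q. *)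
Definition bdry_integral (g h : X -> C) : C :=
  \sum_(i < nd_nb Q)
    integral01 (fun t => g (gam i t) * rderive (fun s => h (gam i s)) t).

Local Notation w1 := (aff w 1 0).
Local Notation w2 := (aff w 2 0).

Definition rho : R := sup [set cabs (aff w 2 1 p) | p in bdry S].

Definition mmin (y : C) : R := inf [set cabs (y * w1 p + w2 p) | p in bdry S].

Definition lform (x y : C) (p : X) : C := x + y * w1 p + w2 p.

Definition G1 (p : C * C) : C :=
  (two_pi_i R)^-1 *
  bdry_integral (fun q => w1 q / lform p.1 p.2 q) (lform p.1 p.2).

Definition delta : C :=
  (two_pi_i R)^-1 * bdry_integral (fun q => (w1 q)^-1) w1.

(* The polynomials G_{1,m}, m >= 1, are the coefficients of the expansion of
   G_1(x, .) at y = infinity; for each x, the set Z contains (x, y) as soon as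
   |y| is large enough. *)
Definition G1_coefficients (g : nat -> {poly C}) : Prop :=
  forall x : C, exists r : R, forall y : C, r < cabs y ->
    (fun n => \sum_(1 <= m < n) (g m).[x] * y ^- m) @ \oo --> G1 (x, y).

End Setting.

Section Operators.
Variable R : realType.
Local Notation C := (cplx R).

Definition ray (tau : C) : set C :=
  [set y | exists2 t : R, 0 <= t & y = t%:C * tau].

Definition Omega (r : R) (tau : C) : set C :=
  [set y | r < cabs y /\ ~ ray tau y].

(* The domain [Omega r tau] being connected, the primitive is unique there; its
   values elsewhere are irrelevant. *)
Definition primitive (r : R) (tau omega : C) (f : C -> C) : C -> C :=
  xget (fun=> 0) [set F : C -> C |
    F omega = 0 /\ forall y, Omega r tau y -> is_derive y 1 F (f y)].

Definition primitive_y (r : R) (tau omega : C) (f : C * C -> C) : C * C -> C :=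
  fun p => primitive r tau omega (fun y => f (p.1, y)) p.2.

Definition Dx (f : C * C -> C) (p : C * C) : C := 'D_(1, 0) f p.
Definition Dy (f : C * C -> C) (p : C * C) : C := 'D_(0, 1) f p.

Definition tensor (a b : C -> C) (p : C * C) : C := a p.1 * b p.2.

Variables (Q : nodal_domain R) (g : nat -> {poly C}) (omega : C) (rho_w : R).

(* Well-posedness of the primitive vanishing at omega on Omega(rho_w, tau)
   requires rho_w < |omega|.  Together with this, the bound m(y) >= m(omega) for
   all |y| >= rho_w could never hold: if b in bQ realises m(omega), moving y from
   omega towards -(w_2/w_1)(b), a point of modulus <= rho, decreases m.  The
   bound m(y) >= m(omega) / 2, implied by it, is what gives the inclusion of
   [Z_omega] in Z, and is satisfiable. *)
Definition admissible_radius : Prop :=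
  [/\ rho Q < rho_w, rho_w < cabs omega &
      forall y : C, rho_w <= cabs y -> mmin Q omega / 2 <= mmin Q y].

Definition D_omega : set C := [set x | cabs x < mmin Q omega / 2].

Definition Z_omega : set (C * C) :=
  [set p | D_omega p.1 /\ rho_w < cabs p.2].

Definition Z_omega_tau (tau : C) : set (C * C) :=
  [set p | Z_omega p /\ ~ ray tau p.2].

Definition J (tau : C) : C -> C := primitive 0 tau omega (fun y => y^-1).

Definition H (tau : C) (p : C * C) : C :=
  - delta Q * J tau p.2
  - limn (fun n => \sum_(1 <= m < n) (g m.+1)^`().[p.1] / m%:R * p.2 ^- m).

Definition Dop (tau : C) (f : C * C -> C) (p : C * C) : C :=
  Dx f p + Dx (H tau) p * f p.

Definition Eop (tau : C) (f : C * C -> C) : C * C -> C :=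
  primitive_y rho_w tau omega (Dop tau f).

Definition Pfun (A B : {poly C}) (p : C * C) : C :=
  A.[p.2] / B.[p.2] + B^`().[p.2] / B.[p.2] * p.1.

Definition Nfun (A B : {poly C}) (p : C * C) : C := G1 Q p - Pfun A B p.

End Operators.

(* Main.v *)
Require Import Defs.
From HB Require Import structures.
From mathcomp Require Import all_boot all_order all_algebra.
From mathcomp Require Import complex.
From mathcomp Require Import all_classical all_reals all_analysis.
From mathcomp Require Import ring lra.
Import Order.TTheory GRing.Theory Num.Theory numFieldNormedType.Exports.
Local Open Scope classical_set_scope.
Local Open Scope ring_scope.

(* Expanding the kernel of [G1] in powers of [a / y], where [a] is the zero in [y]
   of [x + y w_1 + w_2], of modulus at most [rho_w] when [x] is in [D_omega], gives
   [G1 = sum_m G_{1,m} y^-m] on [Z_omega] together with geometric bounds on the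
   coefficients and [G_{1,1}' = - delta]; hence [dH/dy = dG1/dx].  Put
   [sigma_k = B s_k exp (- H)].  As [dN/dx = dH/dy - B'/B], the system becomes
   [d sigma_d / dy = 0] and [d sigma_k / dy = D sigma_(k+1)].  The functions
   [T_k = sum_j E^j (mu_(k+j) (x) 1)] satisfy these equations and
   [T_k (x, omega) = mu_k x], so that [sigma_k = T_k] follows by descending
   induction on [k] from the choice [mu_k = sigma_k (., omega)].

   That the iterates of [E] are well defined and differentiable rests on the
   elementary theory of holomorphic functions: Goursat's theorem gives primitives
   on star-shaped domains, these give the Cauchy estimate, and the latter gives
   the holomorphy of derivatives and of locally uniform limits.  The slit exterior
   domain where [E] integrates becomes star-shaped after [y |-> 1 / y]. *)

Local Open Scope complex_scope.
Set Implicit Arguments.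
Unset Strict Implicit.
Unset Printing Implicit Defensive.

(** * Moduli and derivatives in one complex variable *)

(** The right-hand condition quantifies over all slits, while the system mentions none. In one
    direction the [mu k] must therefore not depend on the slit: as [J] vanishes at [omega], the
    value [H (x, omega)] reduces to a series free of [tau]. In the other direction the system is a
    pointwise identity, so for each point of [Z_omega] it is enough to find one slit that misses
    both this point and [omega].

    The operator [E] mixes a derivative in [x] with a primitive in [y], hence acts on a class of
    functions that must be stable under both. Separate holomorphy with a local bound is such a
    class: the bound makes the Cauchy estimate in one variable uniform in the other, and with this
    uniformity [Dx] passes through limits and through primitives in [y]. No double integral enters.

    For integrals over [[0, 1]], linearity, bounds and additivity are all derived from the existence
    of an antiderivative and a mean value inequality. *)

Section Modulus.
Variable R : realType.
Local Notation C := (cplx R).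
Implicit Types (z w : C) (r : R).

Lemma normE z : `|z| = (cabs z)%:C. Proof. by []. Qed.
Lemma cabs_ge0 z : 0 <= cabs z.
Proof. by rewrite -(lecR 0 (cabs z)) -normE normr_ge0. Qed.
Lemma cabs0 : cabs (0 : C) = 0. Proof. exact: ComplexField.Normc.normc0. Qed.
Lemma cabs1 : cabs (1 : C) = 1. Proof. exact: ComplexField.Normc.normc1. Qed.
Lemma cabsD z w : cabs (z + w) <= cabs z + cabs w.
Proof. exact: le_normcD. Qed.
Lemma cabsN z : cabs (- z) = cabs z. Proof. exact: normcN. Qed.
Lemma cabsB z w : cabs (z - w) <= cabs z + cabs w.
Proof. by rewrite -(cabsN w) cabsD. Qed.
Lemma cabsBC z w : cabs (z - w) = cabs (w - z).
Proof. by rewrite -cabsN opprB. Qed.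
Lemma cabsM z w : cabs (z * w) = cabs z * cabs w.
Proof. exact: ComplexField.Normc.normcM. Qed.
Lemma cabsV z : cabs z^-1 = (cabs z)^-1.
Proof. exact: ComplexField.Normc.normcV. Qed.
Lemma cabsX z n : cabs (z ^+ n) = cabs z ^+ n.
Proof. by elim: n => [|n IH]; rewrite ?expr0 ?cabs1// !exprS cabsM IH. Qed.
Lemma cabs_eq0 z : (cabs z == 0) = (z == 0).
Proof. by rewrite -(inj_eq (@complexI R)) -normE normr_eq0. Qed.
Lemma cabs_gt0 z : (0 < cabs z) = (z != 0).
Proof. by rewrite lt_def cabs_ge0 andbT cabs_eq0. Qed.
Lemma cabsr r : cabs r%:C = `|r|.
Proof. by rewrite /cabs /= expr0n /= addr0 sqrtr_sqr. Qed.
Lemma cabs_dist z w : cabs z - cabs w <= cabs (z - w).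
Proof. by rewrite lerBlDr (le_trans _ (cabsD _ _)) // subrK. Qed.
Lemma cabs_tri z w u : cabs (z - u) <= cabs (z - w) + cabs (w - u).
Proof. by rewrite (le_trans _ (cabsD _ _)) // addrA subrK. Qed.
Lemma cabs_sum (I : Type) (s : seq I) (P : pred I) (F : I -> C) :
  cabs (\sum_(i <- s | P i) F i) <= \sum_(i <- s | P i) cabs (F i).
Proof.
elim/big_ind2 : _ => [|x1 x2 y1 y2 h1 h2|//]; first by rewrite cabs0.
by rewrite (le_trans (cabsD _ _)) // lerD.
Qed.
Lemma Re_le_cabs z : `|complex.Re z| <= cabs z.
Proof. by rewrite -lecR -normE normc_ge_Re. Qed.
Lemma Im_le_cabs z : `|complex.Im z| <= cabs z.
Proof.
have := Re_le_cabs (z * 'i); rewrite cabsM.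
by rewrite ReiNIm normrN /(cabs 'i) /= expr0n expr1n /= add0r sqrtr1 mulr1.
Qed.
Lemma cabs_le z : cabs z <= `|complex.Re z| + `|complex.Im z|.
Proof.
rewrite {1}[z]complexE (le_trans (cabsD _ _)) // cabsM !cabsr lerD2l.
by rewrite /(cabs 'i) /= expr0n expr1n /= add0r sqrtr1 mul1r.
Qed.
Lemma cReD z w : complex.Re (z + w) = complex.Re z + complex.Re w.
Proof. by case: z w => [? ?] []. Qed.
Lemma cImD z w : complex.Im (z + w) = complex.Im z + complex.Im w.
Proof. by case: z w => [? ?] []. Qed.
Lemma cReB z w : complex.Re (z - w) = complex.Re z - complex.Re w.
Proof. by case: z w => [? ?] []. Qed.
Lemma cImB z w : complex.Im (z - w) = complex.Im z - complex.Im w.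
Proof. by case: z w => [? ?] []. Qed.
Lemma cReM z w : complex.Re (z * w) = complex.Re z * complex.Re w - complex.Im z * complex.Im w.
Proof. by case: z w => [? ?] []. Qed.
Lemma cImM z w : complex.Im (z * w) = complex.Re z * complex.Im w + complex.Im z * complex.Re w.
Proof. by case: z w => [? ?] []. Qed.

Lemma rcD r r' : (r + r')%:C = r%:C + r'%:C :> C.
Proof. exact: (rmorphD (real_complex R)). Qed.
Lemma rcB r r' : (r - r')%:C = r%:C - r'%:C :> C.
Proof. exact: (rmorphB (real_complex R)). Qed.
Lemma rcM r r' : (r * r')%:C = r%:C * r'%:C :> C.
Proof. exact: (rmorphM (real_complex R)). Qed.
Lemma rcV r : (r^-1)%:C = (r%:C)^-1 :> C.
Proof. exact: (fmorphV (real_complex R)). Qed.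

(* The norm of [C] takes its values in [C]; these translate its topology to [cabs]. *)
Lemma nbhs_cabs (z : C) (A : set C) :
  nbhs z A <-> exists2 d : R, 0 < d & forall w, cabs (w - z) < d -> A w.
Proof.
split.
  move=> /nbhs_ballP[e /= e0 eA].
  have he : e = (complex.Re e)%:C by rewrite RRe_real // gtr0_real.
  exists (complex.Re e); first by rewrite -ltcR -he.
  by move=> w hw; apply: eA; rewrite /ball /= normE he ltcR cabsBC.
move=> [d d0 dA]; apply/nbhs_ballP; exists d%:C; first by rewrite /= ltcR.
by move=> w; rewrite /ball /= normE ltcR cabsBC; apply: dA.
Qed.

Lemma continuous_cabs (T : topologicalType) (f : T -> C) (x : T) :
  {for x, continuous f} <->
  forall e : R, 0 < e -> \forall y \near x, cabs (f y - f x) < e.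
Proof.
split.
  move=> fx e e0; suff /fx : nbhs (f x) [set w | cabs (w - f x) < e] by [].
  by apply/nbhs_cabs; exists e.
move=> H A /nbhs_cabs[d d0 dA].
by have := H _ d0; apply: filterS => y; exact: dA.
Qed.

Lemma cvg_cabs (T : Type) (F : set_system T) (FF : Filter F) (f : T -> C) (l : C) :
  f @ F --> l <-> forall e : R, 0 < e -> \forall y \near F, cabs (f y - l) < e.
Proof.
split.
  move=> fx e e0; suff /fx : nbhs (l) [set w | cabs (w - l) < e] by [].
  by apply/nbhs_cabs; exists e.
move=> H A /nbhs_cabs[d d0 dA].
by have := H _ d0; apply: filterS => y; exact: dA.
Qed.

(** The derivative as a linear approximation with its value as an argument: there is no quotient and
    no exclusion of [w = z], and the estimates take place in [R]. *)
Definition cder (f : C -> C) (z L : C) := forall e : R, 0 < e ->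
  exists2 d : R, 0 < d & forall w, cabs (w - z) < d ->
    cabs (f w - f z - L * (w - z)) <= e * cabs (w - z).

Lemma cderP f z L : cder f z L <-> is_derive z 1 f L.
Proof.
have key : cder f z L <-> (fun h : C => h^-1 *: (f (h *: 1 + z) - f z)) @ 0^' --> L.
  split.
    move=> H; apply/cvg_cabs => e e0.
    have e20 : 0 < e / 2 by rewrite divr_gt0.
    have [d d0 dH] := H _ e20.
    apply/nbhs_cabs; exists d => // h; rewrite subr0 => hd h0.
    have := dH (h + z); rewrite addrK => /(_ hd) hh.
    rewrite [h *: 1]mulr1 -(ltr_pM2r (x := cabs h)) ?cabs_gt0 // -cabsM mulrBl.
    rewrite [_ *: _]mulrC mulfVK //.
    apply: (le_lt_trans hh); rewrite ltr_pM2r ?cabs_gt0 //; lra.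
  move=> /cvg_cabs H e e0.
  have [d d0 dH] := (nbhs_cabs _ _).1 (H _ e0).
  exists d => // w wz; case: (eqVneq w z) => [->|wnz].
    by rewrite !subrr mulr0 subrr cabs0 mulr0.
  have := dH (w - z); rewrite subr0 => /(_ wz).
  rewrite subr_eq0 => /(_ wnz); rewrite [_ *: 1]mulr1 subrK => hh.
  have wz0 : w - z != 0 by rewrite subr_eq0.
  rewrite -[X in cabs (X - _)](mulfVK wz0) -mulrBl cabsM ler_pM2r ?cabs_gt0 //.
  by apply/ltW; rewrite mulrC.
rewrite key; split => [h|h].
  split; first by apply/cvg_ex; exists L.
  by rewrite /derive; apply: cvg_lim.
by case: h => dv <-; move/cvg_ex: dv => [l hl]; rewrite /derive (cvg_lim _ hl).
Qed.

End Modulus.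

Section ComplexDerivative.
Variable R : realType.
Local Notation C := (cplx R).
Implicit Types (f g : C -> C) (z L : C).

Lemma cder_ext f g z L : (\forall w \near z, f w = g w) -> cder f z L -> cder g z L.
Proof.
move=> fg /cderP h; apply/cderP; exact: near_eq_is_derive h.
Qed.
Lemma cder_unique f z L L' : cder f z L -> cder f z L' -> L = L'.
Proof. by move=> /cderP[_ <-] /cderP[_ <-]. Qed.
Lemma cder_cst (a : C) z : cder (fun=> a) z 0.
Proof. by apply/cderP; exact: is_derive_cst. Qed.
Lemma cder_id z : cder id z 1.
Proof. by apply/cderP; exact: is_derive_id. Qed.
Lemma cderD f g z L L' : cder f z L -> cder g z L' ->
  cder (fun w => f w + g w) z (L + L').
Proof. by move=> /cderP ? /cderP ?; apply/cderP; exact: is_deriveD. Qed.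
Lemma cderN f z L : cder f z L -> cder (fun w => - f w) z (- L).
Proof. by move=> /cderP ?; apply/cderP; exact: is_deriveN. Qed.
Lemma cderB f g z L L' : cder f z L -> cder g z L' ->
  cder (fun w => f w - g w) z (L - L').
Proof. by move=> /cderP ? /cderP ?; apply/cderP; exact: is_deriveB. Qed.
Lemma cderM f g z L L' : cder f z L -> cder g z L' ->
  cder (fun w => f w * g w) z (L * g z + f z * L').
Proof.
move=> /cderP ? /cderP ?; apply/cderP; apply: is_derive_eq (is_deriveM _ _) _.
by rewrite addrC -[_ *: L]/(_ * L) -[_ *: L']/(_ * L') (mulrC (g z)).
Qed.
Lemma cderZ (a : C) f z L : cder f z L -> cder (fun w => a * f w) z (a * L).
Proof.
move=> h; have := cderM (cder_cst a z) h; by rewrite mul0r add0r.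
Qed.
Lemma cder_sum (I : Type) (s : seq I) (P : pred I) (F : I -> C -> C) (L : I -> C) z :
  (forall i, P i -> cder (F i) z (L i)) ->
  cder (fun w => \sum_(i <- s | P i) F i w) z (\sum_(i <- s | P i) L i).
Proof.
move=> H; elim: s => [|i s IH].
  rewrite big_nil (_ : (fun _ => _) = fun=> 0) ?funeqE; first exact: cder_cst.
  by move=> w; rewrite big_nil.
rewrite big_cons; under eq_fun do rewrite big_cons.
by case: ifP => // Pi; apply: cderD => //; exact: H.
Qed.

Lemma cder_sum_nat (m n : nat) (F : nat -> C -> C) (L : nat -> C) z :
  (forall j, (m <= j < n)%N -> cder (F j) z (L j)) ->
  cder (fun w => \sum_(m <= j < n) F j w) z (\sum_(m <= j < n) L j).
Proof. by move=> h; rewrite big_nat; under eq_fun do rewrite big_nat; exact: cder_sum. Qed.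

Lemma cder_locally f z L : cder f z L ->
  exists2 d : R, 0 < d & forall w, cabs (w - z) < d ->
    cabs (f w - f z) <= (cabs L + 1) * cabs (w - z).
Proof.
move=> /(_ 1 ltr01)[d d0 H]; exists d => // w /H hw.
have -> : f w - f z = (f w - f z - L * (w - z)) + L * (w - z) by rewrite subrK.
by apply: (le_trans (cabsD _ _)); rewrite cabsM; lra.
Qed.

Lemma cder_cont f z L : cder f z L -> {for z, continuous f}.
Proof.
move=> /cder_locally[d d0 H]; apply/continuous_cabs => e e0; apply/nbhs_cabs.
have L0 : 0 < cabs L + 1 by rewrite ltr_wpDl // cabs_ge0.
exists (Order.min d (e / (cabs L + 1))); first by rewrite lt_min d0 divr_gt0.
move=> w; rewrite lt_min => /andP[/H hw h2]; apply: (le_lt_trans hw).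
by rewrite mulrC -ltr_pdivlMr.
Qed.

Lemma cder_comp f g z L M : cder f (g z) L -> cder g z M ->
  cder (fun w => f (g w)) z (L * M).
Proof.
move=> Hf Hg e e0.
have [d1 d10 G1] := cder_locally Hg.
have L0 : 0 < cabs L + 1 by rewrite ltr_wpDl // cabs_ge0.
have M0 : 0 < cabs M + 1 by rewrite ltr_wpDl // cabs_ge0.
(* [e1] and [e2] give each of the two error terms the share [e / 2]; the [+ 1] keeps the
   denominators positive when [L] or [M] is 0. *)
have e1 : 0 < e / 2 / (cabs M + 1) by rewrite !divr_gt0.
have e2 : 0 < e / 2 / (cabs L + 1) by rewrite !divr_gt0.
have [d2 d20 F2] := Hf _ e1.
have [d3 d30 G3] := Hg _ e2.
exists (Order.min d1 (Order.min d3 (d2 / (cabs M + 1)))).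
  by rewrite !lt_min d10 d30 divr_gt0.
move=> w; rewrite !lt_min ltr_pdivlMr // => /and3P[/G1 h1 /G3 h3 h2].
have /F2 h4 : cabs (g w - g z) < d2 by rewrite (le_lt_trans h1) // mulrC.
have -> : f (g w) - f (g z) - L * M * (w - z) =
  (f (g w) - f (g z) - L * (g w - g z)) + L * (g w - g z - M * (w - z)) by ring.
apply: (le_trans (cabsD _ _)); rewrite cabsM.
have h5 : cabs (f (g w) - f (g z) - L * (g w - g z)) <= e / 2 * cabs (w - z).
  apply: (le_trans h4); apply: (le_trans (ler_wpM2l (ltW e1) h1)).
  by rewrite mulrA divfK // gt_eqF.
have h6 : cabs L * cabs (g w - g z - M * (w - z)) <= e / 2 * cabs (w - z).
  apply: (@le_trans _ _ ((cabs L + 1) * (e / 2 / (cabs L + 1) * cabs (w - z)))).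
    by apply: ler_pM => //; rewrite ?cabs_ge0 // lerDl.
  by rewrite mulrA [_ * (e / 2 / _)]mulrC divfK // gt_eqF.
lra.
Qed.

Lemma cderV f z L : f z != 0 -> cder f z L ->
  cder (fun w => (f w)^-1) z (- L / f z ^+ 2).
Proof.
move=> fz /cderP[df <-]; apply/cderP; split; first exact: derivableV.
rewrite deriveV //; by rewrite -[_ *: _]/(_ * _) !mulNr mulrC.
Qed.
Lemma cder_horner (p : {poly C}) z : cder (horner p) z p^`().[z].
Proof.
elim/poly_ind: p => [|p c IH].
  rewrite deriv0 horner0; apply: cder_ext (cder_cst 0 z).
  by near=> w; rewrite horner0.
have := cderD (cderM IH (cder_id z)) (cder_cst c z).
rewrite derivD derivM derivX derivC addr0 addr0 mulr1 !hornerE.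
by apply: cder_ext; near=> w; rewrite !hornerE.
Unshelve. all: by end_near. Qed.
Lemma cderX n z : cder (fun w => w ^+ n) z (n%:R * z ^+ n.-1).
Proof.
have := cder_horner 'X^n z; rewrite derivXn hornerMn hornerXn mulr_natl.
by apply: cder_ext; near=> w; rewrite hornerXn.
Unshelve. all: by end_near. Qed.
Lemma cderXV n z : z != 0 -> cder (fun w => w ^- n) z (- n%:R * z ^- n.+1).
Proof.
move=> z0; have := cderV (f := fun w => w ^+ n) (expf_neq0 n z0) (cderX n z); congr cder.
case: n => [|n]; first by rewrite !mul0r !oppr0 !mul0r.
rewrite mulNr mulNr; congr (- _); rewrite -mulrA; congr (_ * _).
apply: (mulfI (expf_neq0 n.+2 z0)); rewrite divff ?expf_neq0 //.
by rewrite mulrA -exprD -exprM addSnnS muln2 -addnn divff // expf_neq0.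
Qed.
End ComplexDerivative.

(** * Derivatives of complex-valued functions of a real variable *)

Section RealDerivative.
Variable R : realType.
Local Notation C := (cplx R).

Lemma is_derive_epsP (f : R -> R) (t l : R) : is_derive t 1 f l <->
  forall e, 0 < e -> exists2 d, 0 < d & forall s, `|s - t| < d ->
    `|f s - f t - l * (s - t)| <= e * `|s - t|.
Proof.
have key : (forall e, 0 < e -> exists2 d, 0 < d & forall s, `|s - t| < d ->
    `|f s - f t - l * (s - t)| <= e * `|s - t|) <->
    (fun h : R => h^-1 *: (f (h *: 1 + t) - f t)) @ 0^' --> l.
  split.
    move=> H; apply/cvgrPdist_lt => e e0.
    have e20 : 0 < e / 2 by rewrite divr_gt0.
    have [d d0 dH] := H _ e20.
    apply/nbhs_ballP; exists d => // h; rewrite /ball /= sub0r normrN => hd h0.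
    have := dH (h + t); rewrite addrK => /(_ hd) hh.
    rewrite [h *: 1]mulr1 -(ltr_pM2r (x := `|h|)) ?normr_gt0 // -normrM mulrBl distrC.
    rewrite [_ *: _]mulrC mulfVK //.
    apply: (le_lt_trans hh); rewrite ltr_pM2r ?normr_gt0 //; lra.
  move=> /cvgrPdist_lt H e e0.
  have [d d0 dH] := (nbhs_ballP _ _).1 (H _ e0).
  exists d => // s st; case: (eqVneq s t) => [->|snt].
    by rewrite !subrr mulr0 subrr normr0 mulr0.
  have := dH (s - t); rewrite /ball /= sub0r normrN => /(_ st).
  rewrite subr_eq0 => /(_ snt); rewrite [_ *: 1]mulr1 subrK => hh.
  have st0 : s - t != 0 by rewrite subr_eq0.
  rewrite -[X in `|X - _|](mulfVK st0) -mulrBl normrM ler_pM2r ?normr_gt0 //.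
  by apply/ltW; rewrite mulrC distrC.
rewrite key; split => h.
  by case: h => dv <-; move/cvg_ex: dv => [m hm]; rewrite /derive (cvg_lim _ hm).
by apply: DeriveDef; [exact: (cvgP l)|exact: cvg_lim].
Qed.

Definition rder (p : R -> C) (t : R) (L : C) := forall e : R, 0 < e ->
  exists2 d : R, 0 < d & forall s, `|s - t| < d ->
    cabs (p s - p t - L * (s - t)%:C) <= e * `|s - t|.

Lemma rderP p t L : rder p t L <->
  is_derive t 1 (fun s => complex.Re (p s)) (complex.Re L) /\
  is_derive t 1 (fun s => complex.Im (p s)) (complex.Im L).
Proof.
have reE s : complex.Re (p s - p t - L * (s - t)%:C) =
  complex.Re (p s) - complex.Re (p t) - complex.Re L * (s - t).
  by rewrite !cReB cReM /= mulr0 subr0.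
have imE s : complex.Im (p s - p t - L * (s - t)%:C) =
  complex.Im (p s) - complex.Im (p t) - complex.Im L * (s - t).
  by rewrite !cImB cImM /= mulr0 add0r.
rewrite !is_derive_epsP; split => [H|[H1 H2] e e0].
  by split=> e e0; have [d d0 hd] := H _ e0; exists d => // s /hd hs;
    apply: le_trans hs; rewrite -?reE -?imE ?Re_le_cabs ?Im_le_cabs.
have e20 : 0 < e / 2 by rewrite divr_gt0.
have [d1 d10 h1] := H1 _ e20; have [d2 d20 h2] := H2 _ e20.
exists (Order.min d1 d2); first by rewrite lt_min d10.
move=> s; rewrite lt_min => /andP[/h1 {}h1 /h2 {}h2].
apply: (le_trans (cabs_le _)); rewrite reE imE; lra.
Qed.

Lemma rder_rderive p t L : rder p t L -> rderive p t = L.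
Proof. by move=> /rderP[[_ h1] [_ h2]]; rewrite /rderive h1 h2; case: L {h1 h2}. Qed.

Lemma rderiveP (p : R -> C) (t : R) : derivable (fun s => complex.Re (p s)) t 1 ->
  derivable (fun s => complex.Im (p s)) t 1 -> rder p t (rderive p t).
Proof. by move=> h1 h2; apply/rderP; split; apply/derivableP. Qed.

Lemma rder_ext p q t L : (\forall s \near t, p s = q s) -> rder p t L -> rder q t L.
Proof.
move=> pq /rderP[h1 h2]; apply/rderP; split.
- apply: near_eq_is_derive h1.
  by apply: filterS pq => s ->.
- apply: near_eq_is_derive h2.
  by apply: filterS pq => s ->.
Qed.

Lemma rder_locally p t L : rder p t L ->
  exists2 d : R, 0 < d & forall s, `|s - t| < d ->
    cabs (p s - p t) <= (cabs L + 1) * `|s - t|.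
Proof.
move=> /(_ 1 ltr01)[d d0 H]; exists d => // w /H hw.
rewrite -[p w - p t](subrK (L * (w - t)%:C)).
by apply: (le_trans (cabsD _ _)); rewrite cabsM cabsr; lra.
Qed.

Lemma rder_comp (f : C -> C) p t L M : cder f (p t) L -> rder p t M ->
  rder (fun s => f (p s)) t (L * M).
Proof.
move=> Hf Hg e e0.
have [d1 d10 G1] := rder_locally Hg.
have L0 : 0 < cabs L + 1 by rewrite ltr_wpDl // cabs_ge0.
have M0 : 0 < cabs M + 1 by rewrite ltr_wpDl // cabs_ge0.
have e1 : 0 < e / 2 / (cabs M + 1) by rewrite !divr_gt0.
have e2 : 0 < e / 2 / (cabs L + 1) by rewrite !divr_gt0.
have [d2 d20 F2] := Hf _ e1.
have [d3 d30 G3] := Hg _ e2.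
exists (Order.min d1 (Order.min d3 (d2 / (cabs M + 1)))).
  by rewrite !lt_min d10 d30 divr_gt0.
move=> w; rewrite !lt_min ltr_pdivlMr // => /and3P[/G1 h1 /G3 h3 h2].
have /F2 h4 : cabs (p w - p t) < d2 by rewrite (le_lt_trans h1) // mulrC.
have -> : f (p w) - f (p t) - L * M * (w - t)%:C =
  (f (p w) - f (p t) - L * (p w - p t)) + L * (p w - p t - M * (w - t)%:C) by ring.
apply: (le_trans (cabsD _ _)); rewrite cabsM.
have h5 : cabs (f (p w) - f (p t) - L * (p w - p t)) <= e / 2 * `|w - t|.
  apply: (le_trans h4); apply: (le_trans (ler_wpM2l (ltW e1) h1)).
  by rewrite mulrA divfK // gt_eqF.
have h6 : cabs L * cabs (p w - p t - M * (w - t)%:C) <= e / 2 * `|w - t|.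
  apply: (@le_trans _ _ ((cabs L + 1) * (e / 2 / (cabs L + 1) * `|w - t|))).
    by apply: ler_pM => //; rewrite ?cabs_ge0 // lerDl.
  by rewrite mulrA [_ * (e / 2 / _)]mulrC divfK // gt_eqF.
lra.
Qed.

Lemma rder_line (a v : C) t : rder (fun s => a + s%:C * v) t v.
Proof.
move=> e e0; exists 1 => // s _.
rewrite [X in cabs X](_ : _ = 0); first by rewrite cabs0 mulr_ge0 // ltW.
by rewrite rcB; ring.
Qed.

(** The mean value theorem fails for complex values. It is applied to the real part of [c * p],
    where [c] is the conjugate of [p b - p a]: the increment of this function is the square of
    [cabs (p b - p a)], and its derivative is at most [cabs c * M]. *)
Lemma rder_mvt (p : R -> C) (a b M : R) : a <= b ->
  (forall t, a <= t <= b -> exists2 L, rder p t L & cabs L <= M) ->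
  cabs (p b - p a) <= M * (b - a).
Proof.
move=> ab H.
pose c := (p b - p a)^*%C : C.
have hd t : a <= t <= b -> exists2 l,
    is_derive t 1 (fun s => complex.Re (c * p s)) l & `|l| <= cabs c * M.
  move=> /H[L hL LM]; exists (complex.Re (c * L)).
    have cid := cderZ c (cder_id (p t)); rewrite mulr1 in cid.
    by have /rderP[] := rder_comp cid hL.
  by rewrite (le_trans (Re_le_cabs _)) // cabsM ler_wpM2l // cabs_ge0.
pose df t := 'D_1 (fun s => complex.Re (c * p s)) t.
have [t t0 tE] : exists2 t, t \in `[a, b]%R & complex.Re (c * p b) - complex.Re (c * p a) = df t * (b - a).
  apply: (@MVT_segment _ (fun s => complex.Re (c * p s)) df) => //.
    move=> x; rewrite in_itv /= => /andP[ax xb].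
    have [|l hl _] := hd x; first by rewrite !ltW.
    by case: (hl) => hl1 hl2; rewrite /df hl2.
  apply: derivable_within_continuous => x; rewrite in_itv /= => hx.
  by have [l [? _] _] := hd _ hx.
have tab : a <= t <= b by move: t0; rewrite in_itv.
have [l [_ hl] lM] := hd t tab.
have ccE (z : C) : complex.Re (z^*%C * z) = cabs z * cabs z.
  case: z => x y; rewrite cReM /cabs /= mulNr opprK.
  by rewrite -[RHS]expr2 sqr_sqrtr ?addr_ge0 ?sqr_ge0 // !expr2.
have cE : cabs c = cabs (p b - p a).
  by apply: (@complexI R); rewrite -!normE normcJ.
case: (eqVneq (cabs (p b - p a)) 0) => [->|n0].
  have [L _ LM] := H a (introT andP (conj (lexx a) ab)).
  by rewrite mulr_ge0 ?subr_ge0 // (le_trans (cabs_ge0 _) LM).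
have p0 : 0 < cabs (p b - p a) by rewrite lt_def n0 cabs_ge0.
rewrite -(ler_pM2l p0) -ccE -/c mulrBr cReB tE mulrA -[X in X * M]cE.
apply: ler_wpM2r; first by rewrite subr_ge0.
by rewrite /df hl (le_trans (ler_norm _)).
Qed.

Lemma cder_mvt (f : C -> C) (a b : C) (M : R) :
  (forall t : R, 0 <= t <= 1 -> exists2 L, cder f (a + t%:C * (b - a)) L & cabs L <= M) ->
  cabs (f b - f a) <= M * cabs (b - a).
Proof.
move=> H.
have h t : 0 <= t <= 1 -> exists2 L,
    rder (fun s => f (a + s%:C * (b - a))) t L & cabs L <= M * cabs (b - a).
  move=> /H[L h1 h2]; exists (L * (b - a)).
    exact: (rder_comp (p := fun s => a + s%:C * (b - a)) h1 (rder_line _ _ _)).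
  by rewrite cabsM ler_wpM2r // cabs_ge0.
have := rder_mvt ler01 h.
have -> : a + 1%:C * (b - a) = b by rewrite [X in _ + X]mul1r addrC subrK.
have -> : a + 0%:C * (b - a) = a by rewrite [X in _ + X]mul0r addr0.
by rewrite subr0 mulr1.
Qed.
End RealDerivative.

(** * Integrals over segments and Goursat's theorem *)

Section Integral01.
Variable R : realType.
Local Notation C := (cplx R).
Implicit Types (p q : R -> C).

Lemma rderD p q t L M : rder p t L -> rder q t M -> rder (fun s => p s + q s) t (L + M).
Proof.
move=> /rderP[? ?] /rderP[? ?]; apply/rderP; rewrite cReD cImD.
split.
  under eq_fun do rewrite cReD; exact: is_deriveD.
under eq_fun do rewrite cImD; exact: is_deriveD.
Qed.

Lemma rderZ (a : C) p t L : rder p t L -> rder (fun s => a * p s) t (a * L).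
Proof.
move=> h; have cid := cderZ a (cder_id (p t)); rewrite mulr1 in cid.
exact: rder_comp cid h.
Qed.

Lemma rder_affine p (a b t : R) L : rder p (a + b * t) L ->
  rder (fun s => p (a + b * s)) t (b%:C * L).
Proof.
move=> H e e0; have b0 : 0 < `|b| + 1 by rewrite ltr_wpDl.
have [d d0 h] := H _ (divr_gt0 e0 b0).
exists (d / (`|b| + 1)); first by rewrite divr_gt0.
move=> s; rewrite ltr_pdivlMr // => st.
have E : a + b * s - (a + b * t) = b * (s - t) by ring.
have := h (a + b * s); rewrite E normrM => hh.
have /hh {}hh : `|b| * `|s - t| < d.
  by apply: le_lt_trans st; rewrite mulrC ler_wpM2l // lerDl.
rewrite [X in cabs X](_ : _ = p (a + b * s) - p (a + b * t) - L * (b * (s - t))%:C).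
  apply: (le_trans hh).
  have -> : e / (`|b| + 1) * (`|b| * `|s - t|) = e * `|s - t| * (`|b| / (`|b| + 1)).
    by ring.
  apply: ler_piMr; first by rewrite mulr_ge0 // ltW.
  by rewrite ler_pdivrMr // mul1r lerDl.
by rewrite rcM; ring.
Qed.

Lemma continuous_Re p : continuous p -> continuous (fun t => complex.Re (p t)).
Proof.
move=> cp t; apply/cvgrPdist_lt => e e0.
have /continuous_cabs/(_ e e0) := cp t; apply: filterS => s.
by rewrite distrC -cReB; apply: le_lt_trans; exact: Re_le_cabs.
Qed.
Lemma continuous_Im p : continuous p -> continuous (fun t => complex.Im (p t)).
Proof.
move=> cp t; apply/cvgrPdist_lt => e e0.
have /continuous_cabs/(_ e e0) := cp t; apply: filterS => s.
by rewrite distrC -cImB; apply: le_lt_trans; exact: Im_le_cabs.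
Qed.

Lemma real_antiderivative (f : R -> R) (a : R) : continuous f ->
  exists F : R -> R, forall t : R, a < t -> is_derive t 1 F (f t).
Proof.
move=> cf.
have fi b : lebesgue_measure.-integrable `[a, b] (EFin \o f).
  apply: continuous_compact_integrable; first exact: segment_compact.
  exact: continuous_subspaceT.
have h t (at0 : a < t) :
    let F x := (\int[lebesgue_measure]_(t in [set` `[a, x]]) (f t))%R in
    derivable F t 1 /\ (F^`())%classic t = f t.
  have t2 : t < t + 1 by rewrite ltrDl.
  exact: continuous_FTC1_closed t2 (fi _) at0 (cf t).
eexists => t /h[h1 h2]; apply: (DeriveDef h1).
by rewrite -h2; apply/esym/derive1E.
Qed.

Lemma antiderivative p : continuous p ->
  exists P : R -> C, forall t : R, 0 <= t -> rder P t (p t).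
Proof.
move=> cp.
(* Integrating from -1 makes every [t >= 0] interior, so that the derivative is two-sided at 0 as
   well. *)
have [F hF] := real_antiderivative (-1) (continuous_Re cp).
have [G hG] := real_antiderivative (-1) (continuous_Im cp).
exists (fun t => F t +i* G t) => t t0; apply/rderP => /=.
by split; [apply: hF|apply: hG]; rewrite (lt_le_trans _ t0).
Qed.

Lemma real_FTC2 (f F : R -> R) : continuous f ->
  (forall t : R, 0 <= t <= 1 -> is_derive t 1 F (f t)) ->
  (\int[lebesgue_measure]_(t in `[0, 1]) f t = F 1 - F 0)%R.
Proof.
move=> cf dF; rewrite /Rintegral.
rewrite (@continuous_FTC2 _ f F 0 1) //; first exact: continuous_subspaceT.
  have cF t : 0 <= t <= 1 -> {for t, continuous F}.
    by move=> /dF[h _]; apply/differentiable_continuous/derivable1_diffP.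
  split.
  - move=> t; rewrite in_itv /= => /andP[t0 t1].
    by have [] := dF t; rewrite ?ltW.
  - by apply: cvg_at_right_filter; apply: cF; rewrite lexx ler01.
  - by apply: cvg_at_left_filter; apply: cF; rewrite lexx ler01.
move=> t; rewrite in_itv /= => /andP[t0 t1].
by rewrite derive1E; have [] := dF t; rewrite ?ltW.
Qed.

Lemma integral01_FTC p P : continuous p ->
  (forall t : R, 0 <= t <= 1 -> rder P t (p t)) -> integral01 p = P 1 - P 0.
Proof.
move=> cp dP; rewrite /integral01.
have dR (t : R) h := ((rderP _ _ _).1 (dP t h)).1.
have dI (t : R) h := ((rderP _ _ _).1 (dP t h)).2.
rewrite (real_FTC2 (continuous_Re cp) dR) (real_FTC2 (continuous_Im cp) dI).
by rewrite -cReB -cImB; case: (P 1 - P 0).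
Qed.

Lemma integral01_ext p q : (forall t : R, 0 <= t <= 1 -> p t = q t) ->
  integral01 p = integral01 q.
Proof.
move=> pq; rewrite /integral01; congr (_ +i* _); apply: eq_Rintegral => t;
  by rewrite inE /= in_itv /= => /pq ->.
Qed.

(** An antiderivative turns the integral into an increment, which [rder_mvt] bounds; the integral of
    the modulus does not appear. *)
Lemma integral01_bound p M : continuous p ->
  (forall t : R, 0 <= t <= 1 -> cabs (p t) <= M) -> cabs (integral01 p) <= M.
Proof.
move=> cp pM; have [P hP] := antiderivative cp.
rewrite (integral01_FTC cp (P := P)); last by move=> t /andP[t0 _]; exact: hP.
rewrite -[M]mulr1 -[X in M * X]subr0; apply: rder_mvt => // t t01.
by exists (p t); [apply: hP; case/andP: t01|exact: pM].
Qed.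

Lemma integral01_cst (c : C) : integral01 (fun=> c) = c.
Proof.
rewrite (integral01_FTC (P := fun t => 0 + t%:C * c)).
- by rewrite !add0r -[RHS]subr0; congr (_ - _); rewrite ?[LHS]mul1r ?[LHS]mul0r.
- by move=> t; exact: cvg_cst.
- by move=> t _; exact: rder_line.
Qed.

Lemma continuousCD p q : continuous p -> continuous q ->
  continuous (fun t => p t + q t).
Proof. by move=> cf cg t; apply: cvgD; [exact: cf|exact: cg]. Qed.
Lemma continuousCM p q : continuous p -> continuous q ->
  continuous (fun t => p t * q t).
Proof. by move=> cf cg t; apply: cvgM; [exact: cf|exact: cg]. Qed.
Lemma continuousC_cst (a : C) : continuous (fun _ : R => a).
Proof. by move=> t; exact: cvg_cst. Qed.
Lemma continuousCX p n : continuous p -> continuous (fun t => p t ^+ n).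
Proof.
move=> cf; elim: n => [|n IH]; first by move=> t; exact: cvg_cst.
by under eq_fun do rewrite exprS; exact: (continuousCM cf IH).
Qed.

(** Linearity is read off antiderivatives, with continuity as the only side condition. *)
Lemma integral01D p q : continuous p -> continuous q ->
  integral01 (fun t => p t + q t) = integral01 p + integral01 q.
Proof.
move=> cp cq; have [P hP] := antiderivative cp; have [Q hQ] := antiderivative cq.
rewrite (integral01_FTC cp (P := P)); last by move=> t /andP[t0 _]; exact: hP.
rewrite (integral01_FTC cq (P := Q)); last by move=> t /andP[t0 _]; exact: hQ.
rewrite (integral01_FTC (P := fun t => P t + Q t)); first by ring.
  exact: (continuousCD cp cq).
by move=> t /andP[t0 _]; apply: rderD; [exact: hP|exact: hQ].
Qed.

Lemma integral01Z (a : C) p : continuous p ->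
  integral01 (fun t => a * p t) = a * integral01 p.
Proof.
move=> cp; have [P hP] := antiderivative cp.
rewrite (integral01_FTC cp (P := P)); last by move=> t /andP[t0 _]; exact: hP.
rewrite (integral01_FTC (P := fun t => a * P t)); first by rewrite mulrBr.
  exact: (continuousCM (@continuousC_cst a) cp).
by move=> t /andP[t0 _]; apply: rderZ; exact: hP.
Qed.

Lemma integral01_sum (I : Type) (r : seq I) (F : I -> R -> C) :
  (forall i, continuous (F i)) ->
  integral01 (fun t => \sum_(i <- r) F i t) = \sum_(i <- r) integral01 (F i).
Proof.
move=> cF; elim: r => [|i r IH].
  by under eq_fun do rewrite big_nil; rewrite big_nil integral01_cst.
rewrite big_cons -IH -integral01D //.
  by under eq_fun do rewrite big_cons.
elim: r {IH} => [|j r IH].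
  by under eq_fun do rewrite big_nil; exact: (@continuousC_cst 0).
by under eq_fun do rewrite big_cons; exact: (continuousCD (cF j) IH).
Qed.

(** The 1-Lipschitz retraction of the line onto the unit interval, in a closed form without case
    distinction. *)
Definition clamp (t : R) : R := (1 + `|t| - `|t - 1|) / 2.

Lemma clamp_id t : 0 <= t <= 1 -> clamp t = t.
Proof.
move=> /andP[t0 t1]; rewrite /clamp ger0_norm // ler0_norm ?subr_le0 //.
by field.
Qed.
Lemma clamp01 t : 0 <= clamp t <= 1.
Proof.
have h1 := ler_normB t 1; have h2 := ler_normD (t - 1) 1.
rewrite subrK in h2; rewrite normr1 in h1 h2.
by rewrite /clamp; apply/andP; split; lra.
Qed.
Lemma clamp_dist s t : `|clamp s - clamp t| <= `|s - t|.
Proof.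
have h1 := ler_dist_dist s t; have h2 := ler_dist_dist (s - 1) (t - 1).
have e : s - 1 - (t - 1) = s - t by ring.
rewrite e in h2; move: h1 h2; rewrite /clamp !ler_norml => /andP[? ?] /andP[? ?].
by apply/andP; split; lra.
Qed.

End Integral01.

Section Segments.
Variable R : realType.
Local Notation C := (cplx R).
Implicit Types (f F : C -> C) (a b : C).

Definition pt (a b : C) (t : R) : C := a + t%:C * (b - a).

Lemma pt0 a b : pt a b 0 = a. Proof. by rewrite /pt [X in _ + X]mul0r addr0. Qed.
Lemma pt1 a b : pt a b 1 = b.
Proof. by rewrite /pt [X in _ + X]mul1r addrC subrK. Qed.
Lemma pt_sub a b (p q t : R) : pt (pt a b p) (pt a b q) t = pt a b (p + (q - p) * t).
Proof. by rewrite /pt rcD rcM rcB; ring. Qed.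
Lemma pt_cont a b : continuous (pt a b).
Proof.
move=> t; have /rder_locally[d d0 h] := rder_line a (b - a) t.
apply/continuous_cabs => e e0; apply/nbhs_ballP.
have L0 : 0 < cabs (b - a) + 1 by rewrite ltr_wpDl // cabs_ge0.
exists (Order.min d (e / (cabs (b - a) + 1))); first by rewrite /= lt_min d0 divr_gt0.
move=> s; rewrite /ball /= distrC lt_min => /andP[/h hs h2]; apply: (le_lt_trans hs).
by rewrite mulrC -ltr_pdivlMr.
Qed.

(* The values of [f] outside the segment are discarded by the clamping, so that
   continuity along the segment suffices for the integrand to be continuous. *)
Definition seg f a b : C := (b - a) * integral01 (fun t => f (pt a b (clamp t))).
Definition seg_cont f a b := forall t : R, 0 <= t <= 1 -> {for pt a b t, continuous f}.

Lemma clamp_cont : continuous (@clamp R).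
Proof.
move=> t; apply/cvgrPdist_lt => e e0; apply/nbhs_ballP; exists e => // s.
by rewrite /ball /=; apply: le_lt_trans; exact: clamp_dist.
Qed.

Lemma clamp_pt_cont f a b : seg_cont f a b -> continuous (fun t => f (pt a b (clamp t))).
Proof.
move=> h t; apply: (@continuous_comp _ _ _ (fun t => pt a b (clamp t)) f).
  by apply: continuous_comp; [exact: clamp_cont|exact: pt_cont].
exact: h (clamp01 t).
Qed.

Lemma sub01 (p q t : R) : 0 <= p <= 1 -> 0 <= q <= 1 -> 0 <= t <= 1 ->
  0 <= p + (q - p) * t <= 1.
Proof. by move=> /andP[? ?] /andP[? ?] /andP[? ?]; apply/andP; split; nra. Qed.

Lemma seg_cont_sub f a b p q : 0 <= p <= 1 -> 0 <= q <= 1 -> seg_cont f a b ->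
  seg_cont f (pt a b p) (pt a b q).
Proof. by move=> hp hq h t ht; rewrite pt_sub; apply: h; exact: sub01. Qed.

(** One antiderivative of the integrand along the whole segment computes the integral over every
    subsegment, in both directions. Subdivision and reversal then become identities between
    increments of [P]. *)
Lemma seg_primitive f a b : seg_cont f a b -> exists P : R -> C,
  forall p q, 0 <= p <= 1 -> 0 <= q <= 1 ->
    seg f (pt a b p) (pt a b q) = (b - a) * (P q - P p).
Proof.
move=> h; have [P hP] := antiderivative (clamp_pt_cont h).
exists P => p q hp hq; rewrite /seg.
have -> : pt a b q - pt a b p = (b - a) * (q - p)%:C by rewrite /pt rcB; ring.
rewrite -mulrA; congr (_ * _).
have cc := clamp_pt_cont (seg_cont_sub hp hq h).
rewrite -(integral01Z _ cc).
rewrite (integral01_FTC (P := fun t => P (p + (q - p) * t))).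
- have -> : p + (q - p) * 1 = q by ring.
  by have -> : p + (q - p) * 0 = p by ring.
- exact: (continuousCM (@continuousC_cst _ _) cc).
move=> t ht; apply: rder_affine; rewrite clamp_id // pt_sub.
have hh := sub01 hp hq ht.
by rewrite -{2}(clamp_id hh); apply: hP; case/andP: hh.
Qed.

Lemma seg_bound f a b M : seg_cont f a b ->
  (forall t : R, 0 <= t <= 1 -> cabs (f (pt a b t)) <= M) ->
  cabs (seg f a b) <= M * cabs (b - a).
Proof.
move=> h hM; rewrite /seg cabsM mulrC ler_wpM2r ?cabs_ge0 //.
apply: integral01_bound; first exact: clamp_pt_cont.
by move=> t _; exact: hM (clamp01 t).
Qed.

Lemma segD f g a b : seg_cont f a b -> seg_cont g a b ->
  seg (fun z => f z + g z) a b = seg f a b + seg g a b.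
Proof. by move=> hf hg; rewrite /seg integral01D ?mulrDr //; exact: clamp_pt_cont. Qed.

Lemma seg_FTC f F a b : seg_cont f a b ->
  (forall t : R, 0 <= t <= 1 -> cder F (pt a b t) (f (pt a b t))) ->
  seg f a b = F b - F a.
Proof.
move=> h hF; have cc := clamp_pt_cont h; rewrite /seg -(integral01Z _ cc).
rewrite (integral01_FTC (P := fun t => F (pt a b t))).
- by rewrite pt0 pt1.
- exact: (continuousCM (@continuousC_cst _ _) cc).
move=> t ht; rewrite clamp_id // mulrC.
exact: (rder_comp (p := pt a b) (hF _ ht) (rder_line _ _ _)).
Qed.

Lemma half01 : 0 <= (2^-1 : R) <= 1.
Proof. by rewrite invr_ge0 ler0n invf_le1 // ler1n. Qed.
Lemma zero01 : 0 <= (0 : R) <= 1. Proof. by rewrite lexx ler01. Qed.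
Lemma one01 : 0 <= (1 : R) <= 1. Proof. by rewrite lexx ler01. Qed.

Lemma seg_mid f a b : seg_cont f a b ->
  seg f a b = seg f a (pt a b 2^-1) + seg f (pt a b 2^-1) b.
Proof.
move=> /seg_primitive[P h].
have := h 0 1 zero01 one01; have := h 0 _ zero01 half01; have := h _ 1 half01 one01.
by rewrite pt0 pt1 => -> -> ->; ring.
Qed.

Lemma seg_rev f a b : seg_cont f a b -> seg f b a = - seg f a b.
Proof.
move=> /seg_primitive[P h].
have := h 0 1 zero01 one01; have := h 1 0 one01 zero01.
by rewrite pt0 pt1 => -> ->; ring.
Qed.

End Segments.

Section Goursat.
Variable R : realType.
Local Notation C := (cplx R).
Variables (f : C -> C) (o u v : C).

Definition plane (s t : R) : C := o + s%:C * u + t%:C * v.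
Definition simplex (s t : R) := [/\ 0 <= s, 0 <= t & s + t <= 1].

(* Boundary integral over the triangle with vertices [plane s t],
   [plane (s + r) t], [plane s (t + r)]; the four parts of the midpoint
   subdivision of such a triangle are again of this form, with [r] replaced by
   [r / 2] or, for the central one, [- r / 2]. *)
Definition tri (s t r : R) : C :=
  seg f (plane s t) (plane (s + r) t) +
  seg f (plane (s + r) t) (plane s (t + r)) +
  seg f (plane s (t + r)) (plane s t).

Definition inside (s t r : R) :=
  [/\ simplex s t, simplex (s + r) t & simplex s (t + r)].

Hypothesis df : forall s t, simplex s t -> exists L, cder f (plane s t) L.

Lemma plane_pt s t s' t' x :
  pt (plane s t) (plane s' t') x = plane (s + x * (s' - s)) (t + x * (t' - t)).
Proof. by rewrite /pt /plane !(rcD, rcM, rcB); ring. Qed.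

Lemma simplex_convex s t s' t' x : simplex s t -> simplex s' t' -> 0 <= x <= 1 ->
  simplex (s + x * (s' - s)) (t + x * (t' - t)).
Proof. by move=> [? ? ?] [? ? ?] /andP[? ?]; split; nra. Qed.

Lemma plane_seg_cont s t s' t' : simplex s t -> simplex s' t' ->
  seg_cont f (plane s t) (plane s' t').
Proof.
move=> h h' x x01; rewrite plane_pt.
have [L] := df (simplex_convex h h' x01); exact: cder_cont.
Qed.

Lemma plane_half s t s' t' :
  pt (plane s t) (plane s' t') 2^-1 = plane ((s + s') / 2) ((t + t') / 2).
Proof. by rewrite plane_pt; congr plane; field. Qed.

(** Besides the halves of the outer sides, the four boundaries contain each inner side twice, once
    in each direction. *)
Lemma tri_split s t r : inside s t r ->
  [/\ inside s t (r / 2), inside (s + r / 2) t (r / 2),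
      inside s (t + r / 2) (r / 2) & inside (s + r / 2) (t + r / 2) (- (r / 2))] /\
  tri s t r = tri s t (r / 2) + tri (s + r / 2) t (r / 2) +
      tri s (t + r / 2) (r / 2) + tri (s + r / 2) (t + r / 2) (- (r / 2)).
Proof.
move=> [[a1 a2 a3] [b1 b2 b3] [c1 c2 c3]].
have I1 : inside s t (r / 2) by split; split; lra.
have I2 : inside (s + r / 2) t (r / 2) by split; split; lra.
have I3 : inside s (t + r / 2) (r / 2) by split; split; lra.
have I4 : inside (s + r / 2) (t + r / 2) (- (r / 2)) by split; split; lra.
split=> //.
have A : simplex s t by split.
have B : simplex (s + r) t by split.
have D : simplex s (t + r) by split.
have AB : simplex (s + r / 2) t by split; lra.
have AD : simplex s (t + r / 2) by split; lra.
have BD : simplex (s + r / 2) (t + r / 2) by split; lra.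
have e1 : s + r / 2 + r / 2 = s + r by field.
have e2 : t + r / 2 + r / 2 = t + r by field.
have e3 : s + r / 2 - r / 2 = s by field.
have e4 : t + r / 2 - r / 2 = t by field.
rewrite /tri e1 e2 e3 e4.
rewrite (seg_mid (plane_seg_cont A B)) (seg_mid (plane_seg_cont B D)) (seg_mid (plane_seg_cont D A)).
rewrite !plane_half.
have -> : (s + (s + r)) / 2 = s + r / 2 by field.
have -> : (s + r + s) / 2 = s + r / 2 by field.
have -> : (t + (t + r)) / 2 = t + r / 2 by field.
have -> : (t + r + t) / 2 = t + r / 2 by field.
have -> : (s + s) / 2 = s by field.
have -> : (t + t) / 2 = t by field.
rewrite (seg_rev (plane_seg_cont AB BD)) (seg_rev (plane_seg_cont BD AD)) (seg_rev (plane_seg_cont AD AB)).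
repeat match goal with |- context [seg f ?a ?b] => move: (seg f a b) => ? end.
by ring.
Qed.

(** One of the four parts carries at least a quarter of the integral. The condition [inside] stands
    after the existential so that [choice] yields a selection function on all triples. *)
Lemma tri_step (p : R * R * R) : exists q : R * R * R,
  inside p.1.1 p.1.2 p.2 ->
  [/\ inside q.1.1 q.1.2 q.2, `|q.2| = `|p.2| / 2,
      `|q.1.1 - p.1.1| <= `|p.2|, `|q.1.2 - p.1.2| <= `|p.2| &
      cabs (tri p.1.1 p.1.2 p.2) <= 4 * cabs (tri q.1.1 q.1.2 q.2)].
Proof.
case: p => [[s t] r] /=.
have [h|] := pselect (inside s t r); last by exists (s, t, r).
have [[I1 I2 I3 I4] E] := tri_split h.
have r2 : `|r / 2| = `|r| / 2 by rewrite normf_div normr_nat.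
have aux (x : R) : x + r / 2 - x = r / 2 by ring.
have rr : `|r / 2| <= `|r| by rewrite r2; have := normr_ge0 r; lra.
have four (x a b c d : R) : x <= a + b + c + d ->
    [\/ x <= 4 * a, x <= 4 * b, x <= 4 * c | x <= 4 * d].
  move=> hx; have [h1|h1] := leP x (4 * a); first by constructor 1.
  have [h2|h2] := leP x (4 * b); first by constructor 2.
  have [h3|h3] := leP x (4 * c); first by constructor 3.
  by constructor 4; lra.
have bd : cabs (tri s t r) <= cabs (tri s t (r / 2)) + cabs (tri (s + r / 2) t (r / 2)) +
    cabs (tri s (t + r / 2) (r / 2)) + cabs (tri (s + r / 2) (t + r / 2) (- (r / 2))).
  rewrite E; apply: le_trans (cabsD _ _) _; rewrite lerD2r.
  by apply: le_trans (cabsD _ _) _; rewrite lerD2r; exact: cabsD.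
have [h1|h2|h3|h4] := four _ _ _ _ _ bd.
- exists (s, t, r / 2) => _; split; rewrite //= subrr normr0 //.
- exists (s + r / 2, t, r / 2) => _; split; rewrite //= ?aux ?subrr ?normr0 //.
- exists (s, t + r / 2, r / 2) => _; split; rewrite //= ?aux ?subrr ?normr0 //.
- exists (s + r / 2, t + r / 2, - (r / 2)) => _; split; rewrite //= ?aux ?normrN //.
Qed.

End Goursat.

(** * Limits from explicit error bounds *)

Section CauchySequences.
Variable R : realType.
Local Notation C := (cplx R).

(** The sequence [e] need not tend to 0: every [a n - e n] lies below every [a m + e m], and the
    supremum of the former is the required [l]. *)
Lemma cauchy_limit (a e : nat -> R) :
  (forall n m, (n <= m)%N -> `|a m - a n| <= e n) ->
  exists l, forall n, `|a n - l| <= e n.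
Proof.
move=> H.
have e0 n : 0 <= e n by rewrite (le_trans (normr_ge0 _) (H n n (leqnn n))).
have cmp n m : a n - e n <= a m + e m.
  have [/H|/ltnW /H] := leqP n m; rewrite ler_norml => /andP[h1 h2];
  by have := e0 n; have := e0 m; lra.
exists (sup [set a n - e n | n in setT]) => n.
rewrite ler_norml; apply/andP; split.
  have : sup [set a n - e n | n in setT] <= a n + e n; last by lra.
  by apply: ge_sup; [exists (a 0 - e 0); exists 0%N|move=> _ [m _ <-]; exact: cmp].
have : a n - e n <= sup [set a n - e n | n in setT]; last by lra.
apply: ub_le_sup; last by exists n.
by exists (a 0 + e 0) => _ [m _ <-]; exact: cmp.
Qed.

Lemma cauchy_limitC (a : nat -> C) (e : nat -> R) :
  (forall n m, (n <= m)%N -> cabs (a m - a n) <= e n) ->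
  exists l, forall n, cabs (a n - l) <= 2 * e n.
Proof.
move=> H.
have [x hx] : exists x, forall n, `|complex.Re (a n) - x| <= e n.
  by apply: cauchy_limit => n m nm; rewrite -cReB (le_trans (Re_le_cabs _)) // H.
have [y hy] : exists y, forall n, `|complex.Im (a n) - y| <= e n.
  by apply: cauchy_limit => n m nm; rewrite -cImB (le_trans (Im_le_cabs _)) // H.
exists (x +i* y) => n; apply: (le_trans (cabs_le _)); rewrite cReB cImB /=.
by have := hx n; have := hy n; lra.
Qed.

Lemma geometric_small (K q e : R) : 0 <= q < 1 -> 0 < e -> exists n, K * q ^+ n < e.
Proof.
move=> /andP[q0 q1] e0.
have : (fun n => K * q ^+ n) @ \oo --> K * 0.
  by apply: cvgM; [exact: cvg_cst|apply: cvg_expr; rewrite ger0_norm].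
rewrite mulr0 => /cvgrPdist_lt/(_ e e0)[n _ /(_ n (leqnn n))] /=.
by rewrite sub0r normrN => h; exists n; exact: le_lt_trans (ler_norm _) h.
Qed.

(** Closes the epsilon arguments below; the sign of [K] is arbitrary. *)
Lemma forall_le0 (x K : R) : (forall e, 0 < e -> x <= e * K) -> x <= 0.
Proof.
move=> H; rewrite leNgt; apply/negP => x0.
have K0 : 0 < `|K| + 1 by rewrite ltr_wpDl.
have := H (x / 2 / (`|K| + 1)); rewrite !divr_gt0 // => /(_ isT).
have : x / 2 / (`|K| + 1) * K <= x / 2.
  rewrite -mulrA -[X in _ <= X]mulr1; apply: ler_wpM2l; first by rewrite divr_ge0 // ltW.
  by rewrite mulrC ler_pdivrMr // mul1r (le_trans (ler_norm _)) // lerDl.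
by lra.
Qed.
End CauchySequences.

Section GoursatTheorem.
Variable R : realType.
Local Notation C := (cplx R).
Variables (f : C -> C) (o u v : C).
Hypothesis df : forall s t, simplex s t -> exists L, cder f (plane o u v s t) L.
Local Notation pl := (plane o u v).
Local Notation D := (cabs u + cabs v).

Lemma plane_dist s t s' t' (e : R) : `|s - s'| <= e -> `|t - t'| <= e ->
  cabs (pl s t - pl s' t') <= e * D.
Proof.
move=> hs ht.
have -> : pl s t - pl s' t' = (s - s')%:C * u + (t - t')%:C * v.
  by rewrite /plane !rcB; ring.
by rewrite (le_trans (cabsD _ _)) // !cabsM !cabsr mulrDr lerD // ler_wpM2r // cabs_ge0.
Qed.

(** The affine part of [f] at [z] has a primitive, so its contribution around the triangle
    telescopes. The remainder is at most [e] times the distance to [z]. This distance is at most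
    [3 * |r| * D], and each of the three sides has length at most [|r| * D], whence the factor 9. *)
Lemma tri_small (L z : C) (e d r s t : R) (ls lt : R) : inside s t r ->
  z = pl ls lt -> 0 <= e ->
  (forall w, cabs (w - z) < d -> cabs (f w - f z - L * (w - z)) <= e * cabs (w - z)) ->
  `|s - ls| <= 2 * `|r| -> `|t - lt| <= 2 * `|r| -> 3 * `|r| * D < d ->
  cabs (tri f o u v s t r) <= 9 * e * D ^+ 2 * `|r| ^+ 2.
Proof.
move=> [hA hB hC] zE e0 hf hs ht hd.
pose A w := f z + L * (w - z).
pose g w := f w - A w.
have dA w : cder A w L.
  have := cderD (cder_cst (f z) w) (cderZ L (cderB (cder_id w) (cder_cst z w))).
  by rewrite subr0 mulr1 add0r.
have cA a b : seg_cont A a b by move=> x _; exact: cder_cont (dA _).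
pose F w := f z * w + L / 2%:R * (w - z) ^+ 2.
have dF w : cder F w (A w).
  have h1 := cderB (cder_id w) (cder_cst z w).
  have := cderD (cderZ (f z) (cder_id w)) (cderZ (L / 2%:R) (cder_comp (f := fun w => w ^+ 2) (g := fun w => w - z) (cderX 2 (w - z)) h1)).
  rewrite /= expr1 mulr1 subr0 mulr1 /A.
  by congr cder; field.
have gc s1 t1 s2 t2 : simplex s1 t1 -> simplex s2 t2 -> seg_cont g (pl s1 t1) (pl s2 t2).
  move=> h1 h2 x x01; rewrite plane_pt.
  have [M hM] := df (simplex_convex h1 h2 x01).
  exact: cder_cont (cderB hM (dA _)).
have key s1 t1 s2 t2 : simplex s1 t1 -> simplex s2 t2 ->
   `|s1 - s| <= `|r| -> `|t1 - t| <= `|r| -> `|s2 - s| <= `|r| -> `|t2 - t| <= `|r| ->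
   `|s2 - s1| <= `|r| -> `|t2 - t1| <= `|r| ->
   seg f (pl s1 t1) (pl s2 t2) = seg g (pl s1 t1) (pl s2 t2) + (F (pl s2 t2) - F (pl s1 t1)) /\
   cabs (seg g (pl s1 t1) (pl s2 t2)) <= (e * (3 * `|r| * D)) * (`|r| * D).
  move=> h1 h2 b1 b2 b3 b4 b5 b6; split.
    rewrite -(seg_FTC (cA _ _) (F := F)); last by move=> *; exact: dF.
    rewrite -segD //; last exact: gc.
    by congr seg; apply/funext => w; rewrite /g subrK.
  apply: (le_trans (seg_bound (M := e * (3 * `|r| * D)) (gc _ _ _ _ h1 h2) _)).
    move=> x x01; rewrite plane_pt.
    have near_z : cabs (pl (s1 + x * (s2 - s1)) (t1 + x * (t2 - t1)) - z) <= 3 * `|r| * D.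
      rewrite zE; case/andP: x01 => x0 x1.
      move: b1 b2 b3 b4 hs ht; rewrite !ler_norml => /andP[? ?] /andP[? ?] /andP[? ?] /andP[? ?] /andP[? ?] /andP[? ?].
      by apply: plane_dist; rewrite ler_norml; apply/andP; split; nra.
    rewrite /g /A opprD addrA.
    apply: (le_trans (hf _ (le_lt_trans near_z hd))).
    by apply: ler_wpM2l.
  apply: ler_wpM2l; last exact: plane_dist.
  by rewrite !mulr_ge0 // addr_ge0 ?cabs_ge0.
have r0 := normr_ge0 r.
have n0 (x : R) : `|x - x| <= `|r| by rewrite subrr normr0.
have n1 (x : R) : `|x + r - x| <= `|r| by rewrite addrC addKr.
have n2 (x : R) : `|x - (x + r)| <= `|r| by rewrite distrC.
have [E1 B1] := key _ _ _ _ hA hB (n0 _) (n0 _) (n1 _) (n0 _) (n1 _) (n0 _).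
have [E2 B2] := key _ _ _ _ hB hC (n1 _) (n0 _) (n0 _) (n1 _) (n2 _) (n1 _).
have [E3 B3] := key _ _ _ _ hC hA (n0 _) (n1 _) (n0 _) (n0 _) (n0 _) (n2 _).
rewrite /tri E1 E2 E3.
set S1 := seg g _ _ in B1 *; set S2 := seg g _ _ in B2 *; set S3 := seg g _ _ in B3 *.
rewrite [X in cabs X](_ : _ = S1 + S2 + S3); last by ring.
apply: (le_trans (cabsD _ _)); apply: (le_trans (lerD (cabsD _ _) (lexx _))).
apply: (le_trans (lerD (lerD B1 B2) B3)).
by rewrite le_eqVlt; apply/orP; left; apply/eqP; ring.
Qed.

Theorem goursat : tri f o u v 0 0 1 = 0.
Proof.
have [nxt hn] := choice (tri_step df).
pose P n := iter n nxt (0, 0, 1 : R).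
pose s n := (P n).1.1; pose t n := (P n).1.2; pose r n := (P n).2.
have inv n : inside (s n) (t n) (r n) /\ `|r n| = 2^-1 ^+ n.
  elim: n => [|n [IH1 IH2]].
    split; last by rewrite expr0 /r /= normr1.
    by split; split; rewrite /s /t /r /= ?addr0 ?add0r ?lexx ?ler01.
  have [h1 h2 _ _ _] := hn _ IH1; split; first exact: h1.
  by rewrite exprSr -IH2; exact: h2.
have ds n : `|s n.+1 - s n| <= 2^-1 ^+ n.
  by have [h1 <-] := inv n; have [_ _ ? _ _] := hn _ h1.
have dt n : `|t n.+1 - t n| <= 2^-1 ^+ n.
  by have [h1 <-] := inv n; have [_ _ _ ? _] := hn _ h1.
have T n : cabs (tri f o u v 0 0 1) <= 4 ^+ n * cabs (tri f o u v (s n) (t n) (r n)).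
  elim: n => [|n IH]; first by rewrite expr0 mul1r.
  have [h1 _] := inv n; have [_ _ _ _ h] := hn _ h1.
  apply: (le_trans IH); rewrite exprSr -mulrA; apply: ler_wpM2l h.
  by rewrite exprn_ge0.
have tele (a : nat -> R) : (forall n, `|a n.+1 - a n| <= 2^-1 ^+ n) ->
    exists l, forall n, `|a n - l| <= 2 * 2^-1 ^+ n.
  move=> ha; apply: cauchy_limit => n m nm; rewrite -(subnK nm).
  (* The bound is strengthened by the term [2 * 2^-m] so that it telescopes in the induction. *)
  suff : `|a (m - n + n)%N - a n| <= 2 * 2^-1 ^+ n - 2 * 2^-1 ^+ (m - n + n).
    by move=> h; apply: (le_trans h); rewrite lerBlDr lerDl mulr_ge0 // exprn_ge0.
  elim: (m - n)%N => [|k IH]; first by rewrite !subrr normr0.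
  rewrite addSn exprS.
  have := ler_distD (a (k + n)%N) (a (k + n).+1) (a n); have := ha (k + n)%N.
  have e2 : 2 * (2^-1 * 2^-1 ^+ (k + n)) = 2^-1 ^+ (k + n) :> R by rewrite mulrA divff // mul1r.
  by rewrite e2; lra.
have [ls hs] := tele _ ds; have [lt ht] := tele _ dt.
have small K e : 0 < e -> exists n, K * (2^-1 : R) ^+ n < e.
  by apply: geometric_small; rewrite invr_ge0 ler0n invf_lt1 // ltr1n.
(* The closed simplex contains the limit of the nested triangles, so [f] is differentiable there. *)
have lim : simplex ls lt.
  split; rewrite leNgt; apply/negP => h.
  - have [|n hh] := small 2 (- ls); first by rewrite oppr_gt0.
    have [[[h1 _ _] _ _] _] := inv n; have := hs n; rewrite ler_norml => /andP[? ?]; lra.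
  - have [|n hh] := small 2 (- lt); first by rewrite oppr_gt0.
    have [[[_ h1 _] _ _] _] := inv n; have := ht n; rewrite ler_norml => /andP[? ?]; lra.
  - have [|n hh] := small 4 (ls + lt - 1); first by rewrite subr_gt0.
    have [[[_ _ h1] _ _] _] := inv n.
    have := hs n; have := ht n; rewrite !ler_norml => /andP[? ?] /andP[? ?]; lra.
have [L hL] := df lim.
suff : cabs (tri f o u v 0 0 1) <= 0.
  by rewrite le_eqVlt ltNge cabs_ge0 orbF cabs_eq0 => /eqP.
(* The factor [4 ^+ n] lost in the subdivisions is exactly compensated by the square of the size
   [2^-1 ^+ n], so the bound is [e] times a constant. *)
apply: (@forall_le0 _ _ (9 * D ^+ 2)) => e e0.
have [d d0 hd] := hL _ e0.
have [n hn3] := small (3 * D) d d0.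
have [hI hr] := inv n.
have := @tri_small L (pl ls lt) e d (r n) (s n) (t n) ls lt hI erefl (ltW e0) hd.
rewrite hr => /(_ (hs n) (ht n)); rewrite mulrAC => /(_ hn3) hh.
apply: (le_trans (T n)); apply: (le_trans (ler_wpM2l _ hh)); first by rewrite exprn_ge0.
have -> : 4 ^+ n * (9 * e * D ^+ 2 * 2^-1 ^+ n ^+ 2) = e * (9 * D ^+ 2) * (4 ^+ n * (2^-1 ^+ n ^+ 2)) by ring.
rewrite exprAC -exprMn.
have -> : 4 * 2^-1 ^+ 2 = 1 :> R by field.
by rewrite expr1n mulr1.
Qed.
End GoursatTheorem.

(** * Primitives, the Cauchy estimate and its consequences *)

Section Exponential.
Variable R : realType.
Local Notation C := (cplx R).
Implicit Types u v : C.

Lemma cexpD u v : cexp (u + v) = cexp u * cexp v.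
Proof.
rewrite /cexp cReD cImD expRD cosD sinD rcM.
rewrite mulrACA; congr (_ * _); apply/eqP.
by rewrite eq_complex /= [X in _ && (X == _)]addrC !eqxx.
Qed.
Lemma cexp0 : cexp (0 : C) = 1.
Proof. by rewrite /cexp /= expR0 cos0 sin0 mul1r. Qed.
Lemma cexpN u : cexp (- u) * cexp u = 1.
Proof. by rewrite -cexpD addNr cexp0. Qed.
Lemma cexp_neq0 u : cexp u != 0.
Proof.
apply/eqP => h; have := cexpN u; rewrite h mulr0 => /esym/eqP.
by rewrite oner_eq0.
Qed.
Lemma cabs_cexp u : cabs (cexp u) = expR (complex.Re u).
Proof.
rewrite /cexp cabsM cabsr ger0_norm ?expR_ge0 // /cabs /= cos2Dsin2 sqrtr1.
by rewrite mulr1.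
Qed.
Lemma cexp_period u : cexp (u + two_pi_i R) = cexp u.
Proof.
rewrite cexpD [X in _ * X](_ : _ = 1) ?mulr1 // /cexp /two_pi_i /= expR0 mul1r.
by rewrite mulrC -[_ * _]/(pi * 2) mulr_natr cos2pi sin2pi.
Qed.

(** Only the derivatives of the real [expR], [cos] and [sin] at 0 enter; the other points follow
    from [cexpD]. *)
Lemma cder_cexp0 : cder (@cexp R) 0 1.
Proof.
have E := (is_derive_epsP _ _ _).1 (is_derive_expR (0 : R)).
have Co := (is_derive_epsP _ _ _).1 (is_derive_cos (0 : R)).
have S := (is_derive_epsP _ _ _).1 (is_derive_sin (0 : R)).
rewrite expR0 in E; rewrite sin0 cos0 oppr0 in Co; rewrite cos0 sin0 in S.
move=> e e0.
(* The errors of the real and imaginary parts add up to at most [h * |x| + 8 * h * |y|], hence the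
   9; [h <= 1] is what bounds [expR x] by 3. *)
pose h := Order.min (e / 9) 1.
have h0 : 0 < h by rewrite lt_min ltr01 andbT divr_gt0.
have h1 : h <= 1 by rewrite ge_min lexx orbT.
have he : h <= e / 9 by rewrite ge_min lexx.
clearbody h.
have [d1 d10 H1] := E _ h0; have [d2 d20 H2] := Co _ h0; have [d3 d30 H3] := S _ h0.
exists (Order.min h (Order.min d1 (Order.min d2 d3))).
  by rewrite !lt_min h0 d10 d20.
move=> w; rewrite subr0 !lt_min => /and4P[wh wd1 wd2 wd3].
have xw := Re_le_cabs w; have yw := Im_le_cabs w.
set x := complex.Re w in xw; set y := complex.Im w in yw.
have {}H1 : `|expR x - 1 - x| <= h * `|x|.
  by have := H1 x; rewrite subr0 mul1r; apply; exact: le_lt_trans wd1.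
have {}H2 : `|cos y - 1| <= h * `|y|.
  by have := H2 y; rewrite !(mul0r, subr0, addr0); apply; exact: le_lt_trans wd2.
have {}H3 : `|sin y - y| <= h * `|y|.
  by have := H3 y; rewrite !subr0 mul1r; apply; exact: le_lt_trans wd3.
have x1 : `|x| <= h by rewrite (le_trans xw) // ltW.
have ex1 : `|expR x - 1| <= 2 * `|x|.
  rewrite -[expR x - 1](subrK x) (le_trans (ler_normD _ _)) //.
  have : h * `|x| <= 1 * `|x| by rewrite ler_wpM2r.
  by lra.
have ex : `|expR x| <= 3.
  by have := ler_normD (expR x - 1) 1; rewrite subrK normr1; lra.
apply: (le_trans (cabs_le _)); rewrite cexp0 mul1r.
have -> : complex.Re (cexp w - 1 - w) = (expR x - 1 - x) + expR x * (cos y - 1).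
  by rewrite !cReB /cexp cReM /= mul0r subr0; ring.
have -> : complex.Im (cexp w - 1 - w) = expR x * (sin y - y) + y * (expR x - 1).
  by rewrite !cImB /cexp cImM /= mul0r addr0; ring.
have a1 : `|(expR x - 1 - x) + expR x * (cos y - 1)| <= h * `|x| + 3 * (h * `|y|).
  by rewrite (le_trans (ler_normD _ _)) // lerD // normrM ler_pM.
have a2 : `|expR x * (sin y - y) + y * (expR x - 1)| <= 3 * (h * `|y|) + `|y| * (2 * h).
  rewrite (le_trans (ler_normD _ _)) // !normrM lerD ?ler_pM //.
  by rewrite (le_trans ex1) // ler_pM2l.
have hx : h * `|x| <= h * cabs w by rewrite ler_pM2l.
have hy : h * `|y| <= h * cabs w by rewrite ler_pM2l.
have hw : h * cabs w <= e / 9 * cabs w by rewrite ler_wpM2r // cabs_ge0.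
have yh : `|y| * (2 * h) = 2 * (h * `|y|) by ring.
by rewrite yh in a2; lra.
Qed.

Lemma cder_cexp u : cder (@cexp R) u (cexp u).
Proof.
have h1 : cder (fun w : C => w - u) u 1.
  by have := cderB (cder_id u) (cder_cst u u); rewrite subr0.
have h2 : cder (@cexp R) ((fun w : C => w - u) u) 1 by rewrite /= subrr; exact: cder_cexp0.
have := cderZ (cexp u) (cder_comp (g := fun w => w - u) h2 h1); rewrite !mulr1.
apply: cder_ext; near=> w.
by rewrite -cexpD addrC subrK.
Unshelve. all: by end_near. Qed.
End Exponential.

Section Primitives.
Variable R : realType.
Local Notation C := (cplx R).

Definition copen (U : set C) :=
  forall z, U z -> exists2 d : R, 0 < d & forall w, cabs (w - z) < d -> U w.
Definition star (U : set C) (p : C) :=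
  forall z, U z -> forall t : R, 0 <= t <= 1 -> U (pt p z t).
Definition holo (U : set C) (f : C -> C) := forall z, U z -> exists L, cder f z L.

Lemma pt_ball (z w : C) (d t : R) : cabs (w - z) < d -> 0 <= t <= 1 ->
  cabs (pt z w t - z) < d.
Proof.
move=> wz /andP[t0 t1]; rewrite /pt addrC addKr cabsM cabsr ger0_norm //.
by apply: le_lt_trans wz; rewrite ler_piMl // cabs_ge0.
Qed.

(** The primitive is the integral from the centre [p]. For [w] close to [z] the triangle [p], [z],
    [w] lies in [U], so by [goursat] the increment is the integral over the segment from [z] to [w],
    on which [f] stays within [e] of [f z]. *)
Lemma holo_primitive (U : set C) (p : C) (f : C -> C) : copen U -> star U p ->
  holo U f -> exists F, forall z, U z -> cder F z (f z).
Proof.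
move=> oU sU hf.
have sc a b : (forall t : R, 0 <= t <= 1 -> U (pt a b t)) -> seg_cont f a b.
  by move=> h t /h/hf[L]; exact: cder_cont.
exists (fun z => seg f p z) => z Uz e e0.
have [d d0 hd] := oU _ Uz.
have [L hL] := hf _ Uz.
have /continuous_cabs/(_ e e0)/nbhs_cabs[d' d'0 hd'] := cder_cont hL.
exists (Order.min d d'); first by rewrite lt_min d0.
move=> w; rewrite lt_min => /andP[wd wd'].
have Uw := hd _ wd.
have segU t : 0 <= t <= 1 -> U (pt z w t) by move=> t01; apply/hd/pt_ball.
(* Unless it is [p] itself, a point of the triangle lies on the segment from [p] to the point of
   parameter [t / (s + t)] of the segment from [z] to [w]. *)
have sub s t : simplex s t -> U (plane p (z - p) (w - p) s t).
  move=> [s0 t0 st].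
  have [st0|stp] := eqVneq (s + t) 0.
    have -> : s = 0 by lra.
    have -> : t = 0 by lra.
    by rewrite /plane !mul0r !addr0 -(pt0 p z); apply: sU; rewrite ?lexx ?ler01.
  have st1 : 0 < s + t by rewrite lt_def stp addr_ge0.
  have q01 : 0 <= t / (s + t) <= 1.
    by rewrite divr_ge0 ?addr_ge0 //= ler_pdivrMr // mul1r lerDr.
  have := sU _ (segU _ q01) (s + t); rewrite addr_ge0 // st => /(_ isT).
  congr U; rewrite /pt /plane.
  have -> : (s + t)%:C * (z + (t / (s + t))%:C * (w - z) - p) =
     (s + t)%:C * (z - p) + ((s + t) * (t / (s + t)))%:C * (w - z) by rewrite (rcM (s + t)); ring.
  by rewrite [(s + t) * _]mulrC divfK // rcD; ring.
have G : tri f p (z - p) (w - p) 0 0 1 = 0.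
  by apply: goursat => s t h; exact: hf (sub _ _ h).
have scw : seg_cont f p w by apply: sc; exact: sU.
have scz : seg_cont f z w by apply: sc.
move: G; rewrite /tri.
have -> : plane p (z - p) (w - p) 0 0 = p by rewrite /plane !mul0r !addr0.
have -> : plane p (z - p) (w - p) (0 + 1) 0 = z.
  by rewrite /plane mul0r addr0 add0r mul1r addrC subrK.
have -> : plane p (z - p) (w - p) 0 (0 + 1) = w.
  by rewrite /plane mul0r addr0 add0r mul1r addrC subrK.
rewrite (seg_rev scw) => /eqP; rewrite subr_eq0 => /eqP <-.
rewrite [seg f p z + _]addrC addrK.
have cc : seg_cont (fun=> - f z) z w by move=> t _; exact: cst_continuous.
have -> : - (f z * (w - z)) = seg (fun=> - f z) z w.
  rewrite (seg_FTC cc (F := fun u => - f z * u)); first by ring.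
  by move=> t _; have := cderZ (- f z) (cder_id (pt z w t)); rewrite mulr1.
rewrite -segD //; apply: seg_bound.
  by move=> t ht; apply: continuousD; [exact: scz|exact: cst_continuous].
by move=> t ht; apply/ltW/hd'/pt_ball.
Qed.

Lemma star_constant (U : set C) (p z : C) (F : C -> C) : star U p ->
  (forall w, U w -> cder F w 0) -> U z -> F z = F p.
Proof.
move=> sU dF Uz; apply/eqP; rewrite -subr_eq0 -cabs_eq0 eq_le cabs_ge0 andbT.
rewrite -[X in _ <= X](mul0r (cabs (z - p))).
by apply: cder_mvt => t t01; exists 0; [apply: dF; exact: sU|rewrite cabs0].
Qed.
End Primitives.

Section CauchyEstimate.
Variable R : realType.
Local Notation C := (cplx R).

(* In the coordinate [u] with [z = c + exp u], the function
   [g u = f (c + exp u) exp (- u)] is holomorphic on a half-plane, hence has a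
   primitive [F]; [F (u + 2 pi i) - F u] has derivative 0, and its value is
   found to be [2 pi i f' c] by letting [Re u] tend to minus infinity. *)
Lemma cauchy_estimate (f : C -> C) (c L : C) (r M : R) : 0 < r ->
  holo [set z | cabs (z - c) < r] f -> (forall z, cabs (z - c) < r -> cabs (f z) <= M) ->
  cder f c L -> cabs L * r <= M.
Proof.
move=> r0 hf hM hL.
pose U := [set u : C | complex.Re u < ln r].
have inU u : U u -> cabs (c + cexp u - c) < r.
  by move=> h; rewrite addrC addKr cabs_cexp -(lnK r0) ltr_expR.
have oU : copen U.
  move=> z Uz; exists (ln r - complex.Re z); first by rewrite subr_gt0.
  move=> w wz; rewrite /U /=; have := Re_le_cabs (w - z); rewrite cReB.
  by move=> /(le_trans (ler_norm _)) h; rewrite /U /= in Uz; lra.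
pose p : C := (ln r - 1)%:C.
have sU : star U p.
  move=> z Uz t /andP[t0 t1]; rewrite /U /= /pt cReD cReM /= mul0r subr0 cReB /=.
  rewrite /U /= in Uz; have h : 0 <= t * (ln r - complex.Re z) by rewrite mulr_ge0 // subr_ge0 ltW.
  have [t1'|t1'] := ltP t 1; first by lra.
  by have -> : t = 1; lra.
pose g u := f (c + cexp u) * cexp (- u).
have dexp u : cder (fun u : C => c + cexp u) u (cexp u).
  by have := cderD (cder_cst c u) (cder_cexp u); rewrite add0r.
have dexpN u : cder (fun u : C => cexp (- u)) u (- cexp (- u)).
  by have := cder_comp (g := fun u => - u) (cder_cexp (- u)) (cderN (cder_id u)); rewrite mulrN mulr1.
have hg : holo U g.
  move=> u /inU/hf[l hl]; eexists; apply: cderM; last exact: dexpN.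
  exact: (cder_comp (g := fun u => c + cexp u) hl (dexp u)).
have [F hF] := holo_primitive oU sU hg.
have perU u t : U u -> U (u + t%:C * two_pi_i R).
  by rewrite /U /= cReD cReM /= mul0r mulr0 subr0 addr0.
have perU1 u : U u -> U (u + two_pi_i R) by move=> /(perU _ 1); rewrite [_ * two_pi_i R]mul1r.
have gper u : g (u + two_pi_i R) = g u.
  rewrite /g cexp_period; congr (_ * _).
  by rewrite -[in LHS]cexp_period opprD -addrA addNr addr0.
have shift (E : C -> C) u l : cder E (u + two_pi_i R) l -> cder (fun u => E (u + two_pi_i R)) u l.
  move=> h; have hs := cderD (cder_id u) (cder_cst (two_pi_i R) u).
  by rewrite addr0 in hs; have := cder_comp (f := E) (g := fun u => u + two_pi_i R) h hs; rewrite mulr1.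
pose K := F (p + two_pi_i R) - F p.
have KE u : U u -> F (u + two_pi_i R) - F u = K.
  move=> Uu; apply: (@star_constant _ U p u (fun u => F (u + two_pi_i R) - F u) sU) => // w Uw.
  have := cderB (shift _ _ _ (hF _ (perU1 _ Uw))) (hF _ Uw).
  by rewrite gper subrr.
have pi_abs : cabs (two_pi_i R) = 2 * pi.
  rewrite /cabs /two_pi_i /= expr0n /= add0r sqrtr_sqr ger0_norm //.
  by rewrite mulr_ge0 // pi_ge0.
have move_u (E : C -> C) (u : C) (m : R) : U u ->
  (forall t : R, exists2 l, cder E (u + t%:C * two_pi_i R) l & cabs l <= m) ->
  cabs (E (u + two_pi_i R) - E u) <= m * (2 * pi).
  move=> Uu h; rewrite -pi_abs -{2}[two_pi_i R](addKr u) [X in _ * cabs X]addrC.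
  by apply: cder_mvt => t _; rewrite [u + _ - u]addrC addKr; exact: h.
have Kbound s : s < ln r -> cabs K <= (M * expR (- s)) * (2 * pi).
  move=> sr; have Us : U s%:C by [].
  rewrite -(KE _ Us); apply: move_u => // t.
  exists (g (s%:C + t%:C * two_pi_i R)); first by apply: hF; exact: perU.
  rewrite /g cabsM cabs_cexp ler_pM ?cabs_ge0 ?expR_ge0 //.
    by apply: hM; apply: inU; exact: perU.
  by rewrite /= mul0r !mulr0 subr0 addr0.
have Kval : K = two_pi_i R * L.
  apply/eqP; rewrite -subr_eq0 -cabs_eq0 eq_le cabs_ge0 andbT.
  apply: (@forall_le0 _ _ (2 * pi)) => e e0.
  have [d d0 hd] := hL _ e0.
  pose s := Order.min (ln r) (ln d) - 1.
  have sr : s < ln r by rewrite ltrBlDr (le_lt_trans (y := ln r)) ?ge_min ?lexx // ltrDl.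
  have sd : s < ln d by rewrite ltrBlDr (le_lt_trans (y := ln d)) ?ge_min ?lexx ?orbT // ltrDl.
  have Us : U s%:C by [].
  (* [E] is [F] minus a primitive of [f c * exp (- u) + L], the main part of [g]. Its derivative is
     [exp (- u)] times the error of the linear approximation of [f] at [c], at most [e] once
     [exp (Re u)] is less than [d]. *)
  pose E u := F u + f c * cexp (- u) - L * u.
  have -> : K - two_pi_i R * L = E (s%:C + two_pi_i R) - E s%:C.
    rewrite -(KE _ Us) /E.
    have -> : cexp (- (s%:C + two_pi_i R)) = cexp (- s%:C).
      by rewrite -[in LHS]cexp_period opprD -addrA addNr addr0.
    by ring.
  apply: move_u => // t; set w := s%:C + _.
  have Uw : U w by exact: perU.
  exists (g w + f c * - cexp (- w) - L * 1).
    apply: cderB; last exact: cderZ (cder_id w).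
    by apply: cderD; [exact: hF|apply: cderZ; exact: dexpN].
  have -> : g w + f c * - cexp (- w) - L * 1 =
      cexp (- w) * (f (c + cexp w) - f c - L * (c + cexp w - c)).
    rewrite /g [c + _ - c]addrC addKr -(cexpN w).
    by ring.
  rewrite cabsM.
  have wE : complex.Re w = s by rewrite /w /= mul0r !mulr0 subr0 addr0.
  have hwd : cabs (c + cexp w - c) < d.
    by rewrite addrC addKr cabs_cexp wE -(lnK d0) ltr_expR.
  apply: (le_trans (ler_wpM2l (cabs_ge0 _) (hd _ hwd))).
  rewrite [c + _ - c]addrC addKr mulrCA -cabsM cexpN cabs1 mulr1 //.
rewrite leNgt; apply/negP => ML.
have M0 : 0 <= M by rewrite (le_trans (cabs_ge0 (f c))) // hM // subrr cabs0.
have L0 : 0 < cabs L.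
  by rewrite lt_def cabs_ge0 andbT; apply/eqP => h; move: ML; rewrite h mul0r ltNge M0.
(* [Kbound] requires a radius strictly below [r]. As [M / |L| < x < r], it gives [|L| * x <= M], a
   contradiction. *)
pose x := (M / cabs L + r) / 2.
have MLr : M / cabs L < r by rewrite ltr_pdivrMr // mulrC.
have ML0 : 0 <= M / cabs L by rewrite divr_ge0 // cabs_ge0.
have x0 : 0 < x by rewrite /x; lra.
have xr : x < r by rewrite /x; lra.
have := Kbound (ln x); rewrite ltr_ln ?posrE // => /(_ xr).
rewrite Kval cabsM pi_abs expRN lnK ?posrE // mulrC ler_pM2r ?mulr_gt0 ?pi_gt0 //.
rewrite ler_pdivlMr // leNgt => /negP; apply.
by rewrite mulrC -ltr_pdivrMr // /x; lra.
Qed.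
End CauchyEstimate.

(** * Estimates on discs, locally uniform limits, holomorphy of the derivative *)

Section HolomorphicFunctions.
Variable R : realType.
Local Notation C := (cplx R).
Implicit Types (f : C -> C) (c z : C) (r M : R).

Definition cball c r : set C := [set z | cabs (z - c) < r].
Definition cdv f z : C := 'D_1 f z.

Lemma cdvP f z L : cder f z L -> cder f z (cdv f z).
Proof. by move=> h; have /cderP[_ e] := h; rewrite /cdv e. Qed.
Lemma cdvE f z L : cder f z L -> cdv f z = L.
Proof. by move=> /cderP[_]. Qed.
Lemma holoP (U : set C) f z : holo U f -> U z -> cder f z (cdv f z).
Proof. by move=> hf /hf[L]; exact: cdvP. Qed.
Lemma holo_sub (U V : set C) f : U `<=` V -> holo V f -> holo U f.
Proof. by move=> UV h z /UV /h. Qed.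

Lemma holomorphic_onP (V : set C) (f : C -> C) : holomorphic_on V f <-> holo V f.
Proof.
split=> h z Vz.
  have /derivable1_diffP/derivableP/cderP hd := h _ Vz; by eexists; exact: hd.
have [L /cderP hL] := h _ Vz; apply/derivable1_diffP; exact: ex_derive.
Qed.

Lemma cball_open c r : copen (cball c r).
Proof.
move=> z zc; exists (r - cabs (z - c)); first by rewrite subr_gt0.
by move=> w wz; rewrite /cball /=; have := cabs_tri w z c; lra.
Qed.
Lemma cball_sub z c r r' : cabs (z - c) + r' <= r -> cball z r' `<=` cball c r.
Proof.
by move=> h w; rewrite /cball /= => wz; have := cabs_tri w z c; lra.
Qed.
Lemma cball_pt c r z w t : cball c r z -> cball c r w -> 0 <= t <= 1 ->
  cball c r (pt z w t).
Proof.
rewrite /cball /= => hz hw /andP[t0 t1].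
have -> : pt z w t - c = (1 - t)%:C * (z - c) + t%:C * (w - c).
  by rewrite /pt rcB; ring.
apply: (le_lt_trans (cabsD _ _)); rewrite !cabsM !cabsr.
rewrite ger0_norm ?subr_ge0 // ger0_norm //.
have [t0'|t0'] := ltP 0 t; last first.
  by have -> : t = 0; [lra|rewrite subr0 mul1r mul0r addr0].
have h1 : (1 - t) * cabs (z - c) <= (1 - t) * r by rewrite ler_wpM2l ?subr_ge0 // ltW.
have h2 : t * cabs (w - c) < t * r by rewrite ltr_pM2l.
by lra.
Qed.

Lemma cauchy_estimate2 f c r M z : 0 < r -> holo (cball c r) f ->
  (forall w, cball c r w -> cabs (f w) <= M) -> cball c (r / 2) z ->
  cabs (cdv f z) <= 2 * M / r.
Proof.
move=> r0 hf hM zc.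
have sub : cball z (r / 2) `<=` cball c r.
  by apply: cball_sub; rewrite /cball /= in zc; lra.
have zb : cball c r z by rewrite /cball /= in zc *; lra.
have r2 : 0 < r / 2 by rewrite divr_gt0.
have := cauchy_estimate r2 (holo_sub sub hf) (fun w hw => hM w (sub w hw)) (holoP hf zb).
by rewrite ler_pdivlMr //; lra.
Qed.

Lemma cball_lipschitz f c r K z w : holo (cball c r) f ->
  (forall u, cball c r u -> cabs (cdv f u) <= K) ->
  cball c r z -> cball c r w -> cabs (f w - f z) <= K * cabs (w - z).
Proof.
move=> hf hK hz hw; apply: cder_mvt => t t01; exists (cdv f (pt z w t)).
  by apply: holoP hf _; exact: cball_pt.
by apply: hK; exact: cball_pt.
Qed.

(** Second order without a second derivative. For fixed [k] the function [f (z + k) - f z] is at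
    most [2 * M / r * |k|] on the disc of radius [r / 4]; the Cauchy estimate then shows that
    [cdv f] moves by at most [8 * M / r^2 * |k|], and the mean value inequality concludes. *)
Lemma taylor2 f c r M h : 0 < r -> holo (cball c r) f ->
  (forall w, cball c r w -> cabs (f w) <= M) -> cabs h < r / 4 ->
  cabs (f (c + h) - f c - cdv f c * h) <= 8 * M / r ^+ 2 * cabs h ^+ 2.
Proof.
move=> r0 hf hM hh.
have r40 : 0 < r / 4 by rewrite divr_gt0.
have r20 : 0 < r / 2 by rewrite divr_gt0.
have sub2 : cball c (r / 2) `<=` cball c r by apply: cball_sub; rewrite subrr cabs0; lra.
have sub4 : cball c (r / 4) `<=` cball c (r / 2) by apply: cball_sub; rewrite subrr cabs0; lra.
have M0 : 0 <= M by rewrite (le_trans (cabs_ge0 (f c))) // hM // /cball /= subrr cabs0.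
have hf2 := holo_sub sub2 hf.
have shift k z : cabs k < r / 4 -> cball c (r / 4) z -> cball c (r / 2) (z + k).
  rewrite /cball /= => hk hz; rewrite addrAC.
  by have := cabsD (z - c) k; lra.
have dlip k : cabs k < r / 4 -> cabs (cdv f (c + k) - cdv f c) <= 8 * M / r ^+ 2 * cabs k.
  move=> hk.
  have hphi : holo (cball c (r / 4)) (fun z => f (z + k) - f z).
    move=> z hz; have zk := shift _ _ hk hz; eexists; apply: cderB.
      apply: (cder_comp (g := fun z => z + k)); first exact: holoP hf2 zk.
      exact: cderD (cder_id z) (cder_cst k z).
    exact: holoP hf2 (sub4 _ hz).
  have bphi z : cball c (r / 4) z -> cabs (f (z + k) - f z) <= 2 * M / r * cabs k.
    move=> hz; have zk := shift _ _ hk hz.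
    rewrite -{2}[k](addrK z) [k + z]addrC.
    apply: (cball_lipschitz hf2) => //; last exact: sub4.
    by move=> u hu; apply: cauchy_estimate2 hu.
  have dphi : cder (fun z => f (z + k) - f z) c (cdv f (c + k) - cdv f c).
    have cc : cball c (r / 4) c by rewrite /cball /= subrr cabs0.
    apply: cderB; last exact: holoP hf2 (sub4 _ cc).
    rewrite -[cdv f (c + k)]mulr1 -[in X in cder _ _ (_ * X)](addr0 1).
    apply: (cder_comp (g := fun z => z + k)); first exact: holoP hf2 (shift _ _ hk cc).
    exact: cderD (cder_id c) (cder_cst k c).
  have := cauchy_estimate r40 hphi bphi dphi.
  rewrite -ler_pdivlMr //; congr (_ <= _); field.
  by rewrite gt_eqF.
have e1 : c + h - c = h by rewrite addrC addKr.
have -> : f (c + h) - f c - cdv f c * h =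
  (f (c + h) - cdv f c * (c + h)) - (f c - cdv f c * c) by ring.
rewrite expr2 mulrA -{4}e1.
apply: (cder_mvt (f := fun w => f w - cdv f c * w)) => t t01.
have -> : c + t%:C * (c + h - c) = c + t%:C * h by rewrite e1.
have ht : cabs (t%:C * h) <= cabs h.
  rewrite cabsM cabsr; case/andP: t01 => t0 t1; rewrite ger0_norm //.
  by rewrite ler_piMl // cabs_ge0.
have ht4 := le_lt_trans ht hh.
exists (cdv f (c + t%:C * h) - cdv f c * 1).
  apply: cderB; last exact: cderZ (cder_id _).
  by apply: holoP hf2 _; rewrite /cball /= [c + _]addrC addrK; lra.
rewrite mulr1; apply: (le_trans (dlip _ ht4)).
apply: ler_wpM2l => //.
by rewrite divr_ge0 ?exprn_ge0 ?mulr_ge0 // ltW.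
Qed.

(** By the Cauchy estimate [f m - f n] is Lipschitz with constant [4 * e n / r] on the half disc,
    uniformly in [m >= n]. Letting [m] grow gives the same for [g - f n], which transfers
    differentiability at [c] from [f n] to [g]. *)
Lemma weierstrass (f : nat -> C -> C) (g : C -> C) c r (e : nat -> R) : 0 < r ->
  (forall n, holo (cball c r) (f n)) ->
  (forall n z, cball c r z -> cabs (f n z - g z) <= e n) ->
  (forall n m, (n <= m)%N -> e m <= e n) ->
  (forall x, 0 < x -> exists n, e n < x) ->
  exists L, cder g c L /\ forall n, cabs (cdv (f n) c - L) <= 4 * e n / r.
Proof.
move=> r0 hf hg emon esmall.
have cc : cball c r c by rewrite /cball /= subrr cabs0.
have r20 : 0 < r / 2 by rewrite divr_gt0.
have cc2 : cball c (r / 2) c by rewrite /cball /= subrr cabs0.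
have sub2 : cball c (r / 2) `<=` cball c r by apply: cball_sub; rewrite subrr cabs0; lra.
have holoB n m : holo (cball c r) (fun z => f m z - f n z).
  by move=> z hz; eexists; exact: cderB (holoP (hf m) hz) (holoP (hf n) hz).
have bndB n m z : (n <= m)%N -> cball c r z -> cabs (f m z - f n z) <= 2 * e n.
  move=> nm hz; have := cabs_tri (f m z) (g z) (f n z).
  by have := hg m z hz; have := hg n z hz; rewrite [cabs (f n z - _)]cabsBC; have := emon _ _ nm; lra.
have dB n m z : cball c r z -> cdv (fun z => f m z - f n z) z = cdv (f m) z - cdv (f n) z.
  by move=> hz; apply: cdvE; exact: cderB (holoP (hf m) hz) (holoP (hf n) hz).
have [L hL] : exists L, forall n, cabs (cdv (f n) c - L) <= 2 * (2 * e n / r).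
  apply: cauchy_limitC => n m nm; rewrite -dB // ler_pdivlMr //.
  exact: cauchy_estimate r0 (@holoB n m) (fun z hz => bndB n m z nm hz) (holoP (@holoB n m) cc).
exists L; split; last by move=> n; have := hL n; rewrite !mulrA -natrM.
move=> x x0.
(* Three errors will be added: [4 * e n / r] from [G], [x / 2] from [f n], and [4 * e n / r] from
   the derivatives at [c]; this choice makes their sum less than [x]. *)
have [n en] : exists n, e n < x * r / 16 by apply: esmall; rewrite divr_gt0 // mulr_gt0.
have x20 : 0 < x / 2 by rewrite divr_gt0.
have [d d0 hd] := holoP (hf n) cc x20.
exists (Order.min d (r / 2)); first by rewrite lt_min d0.
move=> w; rewrite lt_min => /andP[wd wr].
have wc : cball c (r / 2) w by [].
have B m : (n <= m)%N -> cabs ((f m w - f n w) - (f m c - f n c)) <= 4 * e n / r * cabs (w - c).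
  move=> nm; apply: (cball_lipschitz (f := fun z => f m z - f n z) (holo_sub sub2 (@holoB n m))) => // u hu.
  have := cauchy_estimate2 r0 (@holoB n m) (fun z hz => bndB n m z nm hz) hu.
  by rewrite !mulrA -natrM.
have G : cabs ((g w - f n w) - (g c - f n c)) <= 4 * e n / r * cabs (w - c).
  rewrite -subr_le0; apply: (@forall_le0 _ _ 2) => y y0.
  have [m em] := esmall _ y0.
  have nk := B _ (leq_maxl n m).
  have ek : e (maxn n m) < y by apply: le_lt_trans em; apply: emon; exact: leq_maxr.
  have h1 := hg (maxn n m) _ (sub2 _ wc); have h2 := hg (maxn n m) _ cc.
  move: nk ek h1 h2; set k := maxn n m => nk ek h1 h2.
  have -> : (g w - f n w) - (g c - f n c) = ((f k w - f n w) - (f k c - f n c)) + ((f k c - g c) - (f k w - g w)) by ring.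
  have := cabsD ((f k w - f n w) - (f k c - f n c)) ((f k c - g c) - (f k w - g w)).
  by have := cabsB (f k c - g c) (f k w - g w); lra.
have -> : g w - g c - L * (w - c) = ((g w - f n w) - (g c - f n c)) +
   (f n w - f n c - cdv (f n) c * (w - c)) + (cdv (f n) c - L) * (w - c) by ring.
apply: (le_trans (cabsD _ _)); apply: (le_trans (lerD (cabsD _ _) (lexx _))).
rewrite cabsM.
have h3 := hd _ wd; have h4 := ler_wpM2r (cabs_ge0 (w - c)) (hL n).
apply: (le_trans (lerD (lerD G h3) h4)).
rewrite -!mulrDl; apply: ler_wpM2r; first exact: cabs_ge0.
have : e n / r < x / 16 by rewrite ltr_pdivrMr // mulrAC.
by rewrite -!mulrA; lra.
Qed.

Lemma holo_locally_bounded (U : set C) f c : copen U -> holo U f -> U c ->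
  exists r M, 0 < r /\ forall z, cball c r z -> U z /\ cabs (f z) <= M.
Proof.
move=> oU hf Uc; have [d d0 hd] := oU _ Uc.
have [d' d'0 hd'] := cder_locally (holoP hf Uc).
set K := cabs (cdv f c) + 1 in hd'.
exists (Order.min d d'), (cabs (f c) + K * d'); rewrite lt_min d0 d'0; split=> // z.
rewrite /cball /= lt_min => /andP[/hd Uz zd]; split=> //.
have := cabsD (f z - f c) (f c); rewrite subrK.
have : K * cabs (z - c) <= K * d'.
  by apply: ler_wpM2l; [rewrite addr_ge0 // cabs_ge0|exact: ltW].
by have := hd' _ zd; lra.
Qed.

Lemma quotient_bound f c r M (h : C) : 0 < r -> holo (cball c r) f ->
  (forall w, cball c r w -> cabs (f w) <= M) -> h != 0 -> cabs h < r / 4 ->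
  cabs ((f (c + h) - f c) / h - cdv f c) <= 8 * M / r ^+ 2 * cabs h.
Proof.
move=> r0 hf hM h0 hr.
have := taylor2 r0 hf hM hr.
have hp : 0 < cabs h by rewrite cabs_gt0.
have -> : f (c + h) - f c - cdv f c * h = ((f (c + h) - f c) / h - cdv f c) * h.
  by rewrite mulrBl divfK.
by rewrite cabsM expr2 mulrA ler_pM2r.
Qed.

(** On a small disc [cdv f] is the uniform limit of difference quotients of [f], at the rate given
    by [taylor2], so that [weierstrass] applies. *)
Lemma holo_cdv (U : set C) f : copen U -> holo U f -> holo U (cdv f).
Proof.
move=> oU hf c Uc.
have [r [M [r0 hr]]] := holo_locally_bounded oU hf Uc.
have M0 : 0 <= M.
  by have [_ h] := hr c (eq_ind_r (fun x => x < r) r0 (etrans (congr1 _ (subrr c)) (cabs0 R))); exact: le_trans (cabs_ge0 _) h.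
(* Steps of modulus at most [r / 16] keep [z + h n] in the disc of radius [r] and meet the condition
   of [quotient_bound] for the radius [r / 2]. *)
pose h n : C := (r / 16 * 2^-1 ^+ n)%:C.
have hE n : cabs (h n) = r / 16 * 2^-1 ^+ n.
  by rewrite /h cabsr ger0_norm // mulr_ge0 ?exprn_ge0 // divr_ge0 // ltW.
have h0 n : h n != 0 by rewrite -cabs_gt0 hE mulr_gt0 ?exprn_gt0 // divr_gt0.
have pow_le n m : (n <= m)%N -> (2^-1 : R) ^+ m <= 2^-1 ^+ n.
  by move=> nm; rewrite ler_wiXn2l // invf_le1 // ler1n.
have hlt n : cabs (h n) <= r / 16.
  by rewrite hE ler_piMr ?divr_ge0 ?(ltW r0) //; have := pow_le 0%N n (leq0n n); rewrite expr0.
have r20 : 0 < r / 2 by rewrite divr_gt0.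
have r40 : 0 < r / 4 by rewrite divr_gt0.
pose K := 8 * M / (r / 2) ^+ 2.
have K0 : 0 <= K by rewrite divr_ge0 ?exprn_ge0 ?mulr_ge0 // ltW.
have hU : holo (cball c r) f by apply: holo_sub hf => z /hr[].
have [||||L [hL _]] := @weierstrass (fun n z => (f (z + h n) - f z) / h n) (cdv f) c (r / 4) (fun n => K * (r / 16 * 2^-1 ^+ n)) r40.
- move=> n z; rewrite /cball /= => zc; eexists; under eq_fun do rewrite mulrC; apply: cderZ; apply: cderB.
    apply: (cder_comp (g := fun z => z + h n)); last exact: cderD (cder_id z) (cder_cst _ z).
    apply: holoP hU _; rewrite /cball /= addrAC; have := cabsD (z - c) (h n).
    by have := hlt n; lra.
  by apply: holoP hU _; rewrite /cball /=; lra.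
- move=> n z; rewrite /cball /= => zc; rewrite -hE.
  have sub : cball z (r / 2) `<=` cball c r by apply: cball_sub; lra.
  apply: quotient_bound => //; first exact: holo_sub sub hU.
    by move=> w /sub /hr[].
  by have := hlt n; lra.
- move=> n m nm; apply: ler_wpM2l => //; apply: ler_wpM2l; last exact: pow_le.
  by rewrite divr_ge0 // ltW.
- move=> x x0; have [|n hn] := @geometric_small R (K * (r / 16)) 2^-1 x _ x0.
    by rewrite invr_ge0 ler0n invf_lt1 // ltr1n.
  by exists n; rewrite mulrA.
by exists L.
Qed.

End HolomorphicFunctions.

(** * Separately holomorphic functions of two variables *)

Section SeparatelyHolomorphic.
Variable R : realType.
Local Notation C := (cplx R).
Implicit Types (f g : C * C -> C) (U : set (C * C)) (p q : C * C).

Definition box p (r : R) : set (C * C) :=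
  [set q | cabs (q.1 - p.1) < r /\ cabs (q.2 - p.2) < r].

(* Separately holomorphic and locally bounded on [U]; the third clause also
   makes [U] open.  By Osgood's lemma this is joint holomorphy, but it is stable
   under the operations used here for elementary reasons. *)
Record sep_holo U f : Prop := SepHolo {
  sh_x : forall p, U p -> exists L, cder (fun x => f (x, p.2)) p.1 L;
  sh_y : forall p, U p -> exists L, cder (fun y => f (p.1, y)) p.2 L;
  sh_bd : forall p, U p -> exists r M, 0 < r /\
    forall q, box p r q -> U q /\ cabs (f q) <= M }.

(** Both sides are the same function of [h]; hence [Dx] is a one-variable derivative without any
    assumption of joint differentiability. *)
Lemma quotient_x f p : (fun h : C => h^-1 *: ((f \o shift p) (h *: (1, 0)) - f p)) =
  (fun h : C => h^-1 *: (((fun x => f (x, p.2)) \o shift p.1) (h *: 1) - f (p.1, p.2))).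
Proof.
apply/funext => h; case: p => x y; congr (_ *: (f _ - _)).
by congr pair; rewrite /= scaler0 add0r.
Qed.
Lemma quotient_y f p : (fun h : C => h^-1 *: ((f \o shift p) (h *: (0, 1)) - f p)) =
  (fun h : C => h^-1 *: (((fun y => f (p.1, y)) \o shift p.2) (h *: 1) - f (p.1, p.2))).
Proof.
apply/funext => h; case: p => x y; congr (_ *: (f _ - _)).
by congr pair; rewrite /= scaler0 add0r.
Qed.
Lemma DxE f p : Dx f p = cdv (fun x => f (x, p.2)) p.1.
Proof. by rewrite /Dx /cdv /derive quotient_x. Qed.
Lemma DyE f p : Dy f p = cdv (fun y => f (p.1, y)) p.2.
Proof. by rewrite /Dy /cdv /derive quotient_y. Qed.
Lemma derivable_x f p : derivable f p (1, 0) -> cder (fun x => f (x, p.2)) p.1 (Dx f p).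
Proof.
by rewrite /derivable quotient_x => h; apply/cderP; rewrite DxE; exact: derivableP.
Qed.
Lemma derivable_y f p : derivable f p (0, 1) -> cder (fun y => f (p.1, y)) p.2 (Dy f p).
Proof.
by rewrite /derivable quotient_y => h; apply/cderP; rewrite DyE; exact: derivableP.
Qed.
Lemma cder_Dx f p L : cder (fun x => f (x, p.2)) p.1 L -> Dx f p = L.
Proof. by rewrite DxE; exact: cdvE. Qed.
Lemma cder_Dy f p L : cder (fun y => f (p.1, y)) p.2 L -> Dy f p = L.
Proof. by rewrite DyE; exact: cdvE. Qed.
Lemma sh_Dx U f p : sep_holo U f -> U p -> cder (fun x => f (x, p.2)) p.1 (Dx f p).
Proof. by move=> [h _ _] /h[L hL]; rewrite DxE; exact: cdvP hL. Qed.
Lemma sh_Dy U f p : sep_holo U f -> U p -> cder (fun y => f (p.1, y)) p.2 (Dy f p).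
Proof. by move=> [_ h _] /h[L hL]; rewrite DyE; exact: cdvP hL. Qed.

Lemma box_pp p (r : R) : 0 < r -> box p r p.
Proof. by move=> r0; split; rewrite subrr cabs0. Qed.

Definition popen U := forall p, U p -> exists2 r : R, 0 < r & box p r `<=` U.
Lemma sh_open U f : sep_holo U f -> popen U.
Proof. by move=> [_ _ h] p /h[r [M [r0 hr]]]; exists r => // q /hr[]. Qed.
Lemma popenX U p : popen U -> U p -> copen [set x | U (x, p.2)].
Proof.
move=> oU Up x /= Ux; have [r r0 hr] := oU _ Ux; exists r => // w wx.
by apply: hr; split => //=; rewrite subrr cabs0.
Qed.
Lemma popenY U p : popen U -> U p -> copen [set y | U (p.1, y)].
Proof.
move=> oU Up x /= Ux; have [r r0 hr] := oU _ Ux; exists r => // w wx.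
by apply: hr; split => //=; rewrite subrr cabs0.
Qed.

Lemma copen_near (U : set C) z : copen U -> U z -> \forall w \near z, U w.
Proof. by move=> oU /oU[d d0 hd]; apply/nbhs_cabs; exists d. Qed.

Lemma Dx_ext U f g p : popen U -> (forall q, U q -> f q = g q) -> U p -> Dx f p = Dx g p.
Proof.
move=> oU fg Up; rewrite !DxE /cdv.
have Ux : [set x | U (x, p.2)] p.1 by move: Up; rewrite /=; case: (p).
have fgx : \forall x \near p.1, f (x, p.2) = g (x, p.2).
  by apply: filterS (copen_near (popenX oU Up) Ux) => x; exact: fg.
exact: near_eq_derive fgx.
Qed.
Lemma sh_ext U f g : (forall q, U q -> f q = g q) -> sep_holo U f -> sep_holo U g.
Proof.
move=> fg hf; have oU := sh_open hf; split => p Up.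
- exists (Dx f p).
  have Ux : [set x | U (x, p.2)] p.1 by move: Up; rewrite /=; case: (p).
  apply: cder_ext (sh_Dx hf Up).
  by apply: filterS (copen_near (popenX oU Up) Ux) => x; exact: fg.
- exists (Dy f p).
  have Uy : [set y | U (p.1, y)] p.2 by move: Up; rewrite /=; case: (p).
  apply: cder_ext (sh_Dy hf Up).
  by apply: filterS (copen_near (popenY oU Up) Uy) => x; exact: fg.
- have [r [M [r0 hr]]] := sh_bd hf Up; exists r, M; split => // q /hr[Uq].
  by rewrite fg.
Qed.

Lemma sh_sub U V f : popen U -> U `<=` V -> sep_holo V f -> sep_holo U f.
Proof.
move=> oU UV [hx hy hb]; split => p Up; [exact/hx/UV|exact/hy/UV|].
have [r [M [r0 hr]]] := hb _ (UV _ Up); have [r' r'0 hr'] := oU _ Up.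
exists (Order.min r r'), M; rewrite lt_min r0 r'0; split=> // q [].
rewrite !lt_min => /andP[a b] /andP[c d].
by split; [exact: hr'|apply: (hr q _).2].
Qed.

Lemma sh_add U f g : sep_holo U f -> sep_holo U g -> sep_holo U (fun p => f p + g p).
Proof.
move=> hf hg; split => p Up.
- by eexists; exact: cderD (sh_Dx hf Up) (sh_Dx hg Up).
- by eexists; exact: cderD (sh_Dy hf Up) (sh_Dy hg Up).
have [r [M [r0 hr]]] := sh_bd hf Up; have [r' [M' [r'0 hr']]] := sh_bd hg Up.
exists (Order.min r r'), (M + M'); rewrite lt_min r0 r'0; split=> // q [].
rewrite !lt_min => /andP[a b] /andP[c d].
have [Uq fM] := hr q (conj a c); have [_ gM] := hr' q (conj b d).
by split=> //; rewrite (le_trans (cabsD _ _)) // lerD.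
Qed.

Lemma sh_mul U f g : sep_holo U f -> sep_holo U g -> sep_holo U (fun p => f p * g p).
Proof.
move=> hf hg; split => p Up.
- by eexists; exact: cderM (sh_Dx hf Up) (sh_Dx hg Up).
- by eexists; exact: cderM (sh_Dy hf Up) (sh_Dy hg Up).
have [r [M [r0 hr]]] := sh_bd hf Up; have [r' [M' [r'0 hr']]] := sh_bd hg Up.
exists (Order.min r r'), (M * M'); rewrite lt_min r0 r'0; split=> // q [].
rewrite !lt_min => /andP[a b] /andP[c d].
have [Uq fM] := hr q (conj a c); have [_ gM] := hr' q (conj b d).
by split=> //; rewrite cabsM ler_pM // cabs_ge0.
Qed.

Lemma sh_fst U (D : set C) (m : C -> C) : popen U -> copen D ->
  (forall p, U p -> D p.1) -> holo D m -> sep_holo U (fun p => m p.1).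
Proof.
move=> oU oD UD hm; split => p Up.
- by have [L hL] := hm _ (UD _ Up); exists L.
- by exists 0; exact: cder_cst.
have [r r0 hr] := oU _ Up.
have [r' [M [r'0 hr']]] := holo_locally_bounded oD hm (UD _ Up).
exists (Order.min r r'), M; rewrite lt_min r0 r'0; split=> // q [].
rewrite !lt_min => /andP[a b] /andP[c d].
by split; [exact: hr|exact: (hr' _ _).2].
Qed.
Lemma sh_snd U (D : set C) (m : C -> C) : popen U -> copen D ->
  (forall p, U p -> D p.2) -> holo D m -> sep_holo U (fun p => m p.2).
Proof.
move=> oU oD UD hm; split => p Up.
- by exists 0; exact: cder_cst.
- by have [L hL] := hm _ (UD _ Up); exists L.
have [r r0 hr] := oU _ Up.
have [r' [M [r'0 hr']]] := holo_locally_bounded oD hm (UD _ Up).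
exists (Order.min r r'), M; rewrite lt_min r0 r'0; split=> // q [].
rewrite !lt_min => /andP[a b] /andP[c d].
by split; [exact: hr|exact: (hr' _ _).2].
Qed.

Lemma sh_cst U (a : C) : popen U -> sep_holo U (fun=> a).
Proof.
move=> oU; apply: (@sh_fst _ setT (fun=> a)) => // [z _|z _]; first by exists 1.
by exists 0; exact: cder_cst.
Qed.

Lemma sh_sum U (I : Type) (s : seq I) (F : I -> C * C -> C) : popen U ->
  (forall i, sep_holo U (F i)) -> sep_holo U (fun p => \sum_(i <- s) F i p).
Proof.
move=> oU hF; elim: s => [|i s IH].
  by under eq_fun do rewrite big_nil; exact: sh_cst.
by under eq_fun do rewrite big_cons; exact: sh_add.
Qed.

(** Serves for the inversion of the second variable, between the slit exterior and its star-shaped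
    image. *)
Lemma sh_comp_snd U V (phi : C -> C) f : popen U ->
  (forall p, U p -> V (p.1, phi p.2) /\ exists L, cder phi p.2 L) ->
  sep_holo V f -> sep_holo U (fun p => f (p.1, phi p.2)).
Proof.
move=> oU UV [hx hy hb]; split => p Up; have [Vp [L hL]] := UV _ Up.
- exact: (hx _ Vp).
- have [M hM] := hy _ Vp; exists (M * L).
  exact: (cder_comp (f := fun y => f (p.1, y)) hM hL).
have [r [M [r0 hr]]] := hb _ Vp; have [r' r'0 hr'] := oU _ Up.
have /continuous_cabs/(_ r r0)/nbhs_cabs[d d0 hd] := cder_cont hL.
exists (Order.min r (Order.min r' d)), M; rewrite !lt_min r0 r'0 d0; split=> // q [].
rewrite !lt_min => /and3P[a1 a2 a3] /and3P[b1 b2 b3].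
split; first exact: hr'.
by apply: (hr (q.1, phi q.2) _).2; split=> //=; exact: hd.
Qed.

Section Box.
Variables (U : set (C * C)) (f : C * C -> C) (p : C * C) (r M : R).
Hypotheses (r0 : 0 < r) (hf : sep_holo U f).
Hypothesis hr : forall q, box p r q -> U q /\ cabs (f q) <= M.

Lemma box_holo_x y : cabs (y - p.2) < r -> holo (cball p.1 r) (fun x => f (x, y)).
Proof.
by move=> yr x xr; apply: (sh_x hf (p := (x, y))); exact: (hr (q := (x, y)) (conj xr yr)).1.
Qed.
Lemma box_holo_y x : cabs (x - p.1) < r -> holo (cball p.2 r) (fun y => f (x, y)).
Proof.
by move=> xr y yr; apply: (sh_y hf (p := (x, y))); exact: (hr (q := (x, y)) (conj xr yr)).1.
Qed.
Lemma box_bd_x y : cabs (y - p.2) < r -> forall x, cball p.1 r x -> cabs (f (x, y)) <= M.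
Proof. by move=> yr x xr; exact: (hr (q := (x, y)) (conj xr yr)).2. Qed.

(** [M] bounds [f] on all slices of the box, so the one-variable remainder estimates hold with a
    constant independent of [q]. The 32 is the 8 of [quotient_bound] at the radius [r / 2]. *)
Lemma box_quotient (h : C) q : box p (r / 2) q -> h != 0 -> cabs h < r / 8 ->
  cabs ((f (q.1 + h, q.2) - f q) / h - Dx f q) <= 32 * M / r ^+ 2 * cabs h.
Proof.
move=> [qx qy] h0 hh; rewrite DxE.
have r20 : 0 < r / 2 by rewrite divr_gt0.
have sub : cball q.1 (r / 2) `<=` cball p.1 r by apply: cball_sub; lra.
have yr : cabs (q.2 - p.2) < r by lra.
have := quotient_bound r20 (holo_sub sub (box_holo_x yr)) (fun w hw => box_bd_x yr (sub w hw)) h0.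
have -> : r / 2 / 4 = r / 8 by field.
move=> /(_ hh); have -> : (q.1, q.2) = q by case: (q).
have -> // : 8 * M / (r / 2) ^+ 2 = 32 * M / r ^+ 2 by field; rewrite gt_eqF.
Qed.

Lemma box_taylor (h : C) q : box p (r / 2) q -> cabs h < r / 8 ->
  cabs (f (q.1 + h, q.2) - f q - Dx f q * h) <= 32 * M / r ^+ 2 * cabs h ^+ 2.
Proof.
move=> [qx qy] hh; rewrite DxE.
have r20 : 0 < r / 2 by rewrite divr_gt0.
have sub : cball q.1 (r / 2) `<=` cball p.1 r by apply: cball_sub; lra.
have yr : cabs (q.2 - p.2) < r by lra.
have := taylor2 (h := h) r20 (holo_sub sub (box_holo_x yr)) (fun w hw => box_bd_x yr (sub w hw)).
have -> : r / 2 / 4 = r / 8 by field.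
move=> /(_ hh); have -> : (q.1, q.2) = q by case: (q).
have -> // : 8 * M / (r / 2) ^+ 2 = 32 * M / r ^+ 2 by field; rewrite gt_eqF.
Qed.

Lemma box_Dx_bound q : box p (r / 2) q -> cabs (Dx f q) <= 2 * M / r.
Proof.
move=> [qx qy]; rewrite DxE; have r20 : 0 < r by [].
have yr : cabs (q.2 - p.2) < r by lra.
exact: cauchy_estimate2 r0 (box_holo_x yr) (box_bd_x yr) qx.
Qed.

Lemma box_sub q : box p (r / 2) q -> box p r q.
Proof. by have r20 : 0 < r by []; move=> [? ?]; split; lra. Qed.
End Box.

(** In [x] this is [holo_cdv]. In [y], [Dx f] is a uniform limit of difference quotients in [x],
    each of them holomorphic in [y]; here the local bound does the work of joint holomorphy. The
    bound on [Dx f] itself is a Cauchy estimate. *)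
Lemma sh_Dx_closed U f : sep_holo U f -> sep_holo U (Dx f).
Proof.
move=> hf; have oU := sh_open hf; split => p Up.
- have Ux : [set x | U (x, p.2)] p.1 by move: Up; rewrite /=; case: (p).
  have [L hL] := holo_cdv (popenX oU Up) (fun x (h : U (x, p.2)) => sh_x hf h) Ux.
  by exists L; under eq_fun do rewrite DxE.
- have [r [M [r0 hr]]] := sh_bd hf Up.
  have M0 : 0 <= M by have [_ h] := hr _ (box_pp p r0); exact: le_trans (cabs_ge0 _) h.
  pose h n : C := (r / 16 * 2^-1 ^+ n)%:C.
  have hE n : cabs (h n) = r / 16 * 2^-1 ^+ n.
    by rewrite /h cabsr ger0_norm // mulr_ge0 ?exprn_ge0 // divr_ge0 // ltW.
  have h0 n : h n != 0 by rewrite -cabs_gt0 hE mulr_gt0 ?exprn_gt0 // divr_gt0.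
  have pow_le n m : (n <= m)%N -> (2^-1 : R) ^+ m <= 2^-1 ^+ n.
    by move=> nm; rewrite ler_wiXn2l // invf_le1 // ler1n.
  have hlt n : cabs (h n) <= r / 16.
    by rewrite hE ler_piMr ?divr_ge0 ?(ltW r0) //; have := pow_le 0%N n (leq0n n); rewrite expr0.
  have r20 : 0 < r / 2 by rewrite divr_gt0.
  pose K := 32 * M / r ^+ 2.
  have K0 : 0 <= K by rewrite divr_ge0 ?exprn_ge0 ?mulr_ge0 // ltW.
  have [||||L [hL _]] := @weierstrass _ (fun n y => (f (p.1 + h n, y) - f (p.1, y)) / h n) (fun y => Dx f (p.1, y)) p.2 (r / 2) (fun n => K * (r / 16 * 2^-1 ^+ n)) r20.
  + move=> n y; rewrite /cball /= => yr.
    have yr2 : cball p.2 r y by rewrite /cball /=; lra.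
    eexists; under eq_fun do rewrite mulrC; apply: cderZ; apply: cderB.
      apply: holoP (box_holo_y hf hr _) yr2; rewrite [p.1 + _]addrC addrK.
      by have := hlt n; lra.
    by apply: holoP (box_holo_y hf hr _) yr2; rewrite subrr cabs0.
  + move=> n y yr; rewrite -hE.
    apply: (box_quotient r0 hf hr (q := (p.1, y))) => //.
      by split=> //=; rewrite subrr cabs0.
    by have := hlt n; lra.
  + move=> n m nm; apply: ler_wpM2l => //; apply: ler_wpM2l; last exact: pow_le.
    by rewrite divr_ge0 // ltW.
  + move=> x x0; have [|n hn] := @geometric_small R (K * (r / 16)) 2^-1 x _ x0.
      by rewrite invr_ge0 ler0n invf_lt1 // ltr1n.
    by exists n; rewrite mulrA.
  by exists L.
have [r [M [r0 hr]]] := sh_bd hf Up.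
exists (r / 2), (2 * M / r); rewrite divr_gt0 //; split=> // q hq.
by split; [exact: (hr _ (box_sub r0 hq)).1|exact: box_Dx_bound r0 hf hr _ hq].
Qed.

(** [weierstrass] is applied in each variable separately. The rate for the partial derivatives is
    recorded because series will be differentiated term by term. *)
Lemma sh_limit U (F : nat -> C * C -> C) g : popen U ->
  (forall n, sep_holo U (F n)) ->
  (forall p, U p -> exists r (e : nat -> R), [/\ 0 < r,
     forall n q, box p r q -> U q /\ cabs (F n q - g q) <= e n,
     forall n m, (n <= m)%N -> e m <= e n & forall x, 0 < x -> exists n, e n < x]) ->
  sep_holo U g /\
  forall p, U p -> exists e : nat -> R, [/\ forall n m, (n <= m)%N -> e m <= e n,
     forall x, 0 < x -> exists n, e n < x &
     forall n, cabs (Dx (F n) p - Dx g p) <= e n /\ cabs (Dy (F n) p - Dy g p) <= e n].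
Proof.
move=> oU hF hg.
have key p : U p -> exists e : nat -> R, [/\ forall n m, (n <= m)%N -> e m <= e n,
    forall x, 0 < x -> exists n, e n < x,
    exists2 L, cder (fun x => g (x, p.2)) p.1 L & forall n, cabs (Dx (F n) p - L) <= e n &
    exists2 L, cder (fun y => g (p.1, y)) p.2 L & forall n, cabs (Dy (F n) p - L) <= e n].
  move=> Up; have [r [e [r0 he emon esm]]] := hg _ Up.
  exists (fun n => 4 * e n / r); split.
  - move=> n m nm; apply: ler_wpM2r; first by rewrite invr_ge0 ltW.
    by apply: ler_wpM2l => //; exact: emon.
  - move=> x x0; have [n hn] := esm (x * r / 4) (divr_gt0 (mulr_gt0 x0 r0) (ltr0n R 4)).
    by exists n; rewrite ltr_pdivrMr // mulrC -ltr_pdivlMr.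
  - have [||L [h1 h2]] := @weierstrass _ (fun n x => F n (x, p.2)) (fun x => g (x, p.2)) p.1 r e r0 _ _ emon esm.
    + move=> n x xr; apply: (sh_x (hF n) (p := (x, p.2))).
      by have [] := he n (x, p.2) => //; split=> //=; rewrite subrr cabs0.
    + move=> n x xr.
      by have [] := he n (x, p.2) => //; split=> //=; rewrite subrr cabs0.
    exists L; first exact: h1.
    by move=> n; rewrite DxE; exact: h2.
  - have [||L [h1 h2]] := @weierstrass _ (fun n y => F n (p.1, y)) (fun y => g (p.1, y)) p.2 r e r0 _ _ emon esm.
    + move=> n x xr; apply: (sh_y (hF n) (p := (p.1, x))).
      by have [] := he n (p.1, x) => //; split=> //=; rewrite subrr cabs0.
    + move=> n x xr.
      by have [] := he n (p.1, x) => //; split=> //=; rewrite subrr cabs0.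
    exists L; first exact: h1.
    by move=> n; rewrite DyE; exact: h2.
split; last first.
  move=> p /key[e [emon esm [L hL h1] [L' hL' h2]]]; exists e; split=> [||n]; [exact: emon|exact: esm|].
  split; first by rewrite (cder_Dx hL); exact: h1.
  by rewrite (cder_Dy hL'); exact: h2.
split=> p Up; first by have [e [_ _ [L hL _] _]] := key _ Up; exists L.
  by have [e [_ _ _ [L hL _]]] := key _ Up; exists L.
have [r [e [r0 he emon esm]]] := hg _ Up.
have [r' [M [r'0 hr']]] := sh_bd (hF 0%N) Up.
exists (Order.min r r'), (M + e 0%N); rewrite lt_min r0 r'0; split=> // q [].
rewrite !lt_min => /andP[a b] /andP[c d].
have [Uq h1] := he 0%N _ (conj a c); have [_ h2] := hr' _ (conj b d).
split=> //; have := cabsB (F 0%N q) (F 0%N q - g q); rewrite opprB addrC subrK; lra.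
Qed.

(** Compactness of the segment. One parameter [e] serves both as the radius and, inverted, as the
    bound, so that the two conditions become a single one for [e] near 0 on the right, as the
    covering form of compactness requires. *)
Lemma tube U f (x0 p0 y0 : C) : sep_holo U f ->
  (forall t : R, 0 <= t <= 1 -> U (x0, pt p0 y0 t)) ->
  exists r M, 0 < r /\ forall t, 0 <= t <= 1 -> forall q,
    box (x0, pt p0 y0 t) r q -> U q /\ cabs (f q) <= M.
Proof.
move=> hf hU.
have /compact_near_coveringP nc := @segment_compact R 0 1.
pose P (e t : R) := forall q, box (x0, pt p0 y0 t) e q -> U q /\ cabs (f q) <= e^-1.
have : \forall e \near 0^'+, `[0, 1] `<=` P e.
  apply: nc => t; rewrite /= in_itv /= => t01.
  have [r [M [r0 hr]]] := sh_bd hf (hU _ t01).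
  have M0 : 0 <= M by have [_ h] := hr _ (box_pp _ r0); exact: le_trans (cabs_ge0 _) h.
  have r20 : 0 < r / 2 by rewrite divr_gt0.
  have /continuous_cabs/(_ _ r20) nt := @pt_cont _ p0 y0 t.
  have Mi : 0 < (M + 1)^-1 by rewrite invr_gt0 ltr_wpDl.
  exists ([set t' | cabs (pt p0 y0 t' - pt p0 y0 t) < r / 2],
          [set e | 0 < e /\ e < Order.min (r / 2) (M + 1)^-1]).
    split; first exact: nt.
    near=> e; split; first by near: e; exact: nbhs_right_gt.
    by near: e; apply: nbhs_right_lt; rewrite lt_min r20.
  move=> [t' e] [/= ht' [e0]]; rewrite lt_min => /andP[er eM] q [/= qx qy].
  have [|Uq fq] := hr q.
    split; rewrite /=; first by lra.
    by have := cabs_tri q.2 (pt p0 y0 t') (pt p0 y0 t); lra.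
  split=> //; apply: (le_trans fq); rewrite -[M]invrK.
  have [->|Mn0] := eqVneq M 0; first by rewrite invr0 invr0 invr_ge0 ltW.
  have M1 : 0 < M by rewrite lt_def Mn0.
  rewrite lef_pV2 ?posrE ?invr_gt0 //; apply/ltW/(lt_le_trans eM).
  by rewrite lef_pV2 ?posrE ?ltr_wpDl // lerDl.
move=> ne; near (0 : R)^'+ => e.
have e0 : 0 < e by near: e; exact: nbhs_right_gt.
have he : `[0, 1] `<=` P e by near: e.
exists e, e^-1; split=> // t t01 q; exact: he.
Unshelve. all: by end_near. Qed.

Lemma pairP (D S : set C) : copen D -> copen S -> popen [set p | D p.1 /\ S p.2].
Proof.
move=> oD oS p [/oD[r r0 hr] /oS[r' r'0 hr']]; exists (Order.min r r').
  by rewrite lt_min r0.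
move=> q []; rewrite !lt_min => /andP[a _] /andP[_ b].
by split; [exact: hr|exact: hr'].
Qed.

(** The primitives, chosen for each [x] separately, are tied together by their vanishing at [p0].
    The derivative in [x] of the primitive [F] of [f] is the primitive [G] of [Dx f], as under an
    integral sign. *)
Lemma sh_primitive (D S : set C) (p0 : C) f : copen D -> copen S -> star S p0 ->
  sep_holo [set p | D p.1 /\ S p.2] f ->
  exists F, sep_holo [set p | D p.1 /\ S p.2] F /\
    forall p, D p.1 -> S p.2 -> cder (fun y => F (p.1, y)) p.2 (f p).
Proof.
set U := [set p | _] => oD oS sS hf.
have oU : popen U by exact: pairP.
have prim f' : sep_holo U f' -> exists F : C -> C -> C, forall x, D x ->
    F x p0 = 0 /\ forall y, S y -> cder (F x) y (f' (x, y)).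
  move=> hf'.
  suff /choice[F hF] : forall x, exists F : C -> C, D x ->
      F p0 = 0 /\ forall y, S y -> cder F y (f' (x, y)) by exists F.
  move=> x.
  have [Dx|nDx] := pselect (D x); last by exists (fun=> 0).
  have [|F hF] := @holo_primitive _ S p0 (fun y => f' (x, y)) oS sS.
    by move=> y Sy; exact: (sh_y hf' (p := (x, y))).
  exists (fun y => F y - F p0) => _; rewrite subrr; split=> // y /hF h.
  by have := cderB h (cder_cst (F p0) y); rewrite subr0.
have [F hF] := prim _ hf.
have [G hG] := prim _ (sh_Dx_closed hf).
have line x y : D x -> S y -> forall t : R, 0 <= t <= 1 -> U (x, pt p0 y t).
  by move=> Dx Sy t t01; split=> //=; exact: sS.
exists (fun p => F p.1 p.2); split; last first.
  by move=> [x y] /= /hF[_ h] /h.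
split=> [[x y] [/= Dx Sy]|[x y] [/= Dx Sy]|[x y] [/= Dx Sy]].
- exists (G x y) => e e0.
  have [r [M [r0 hr]]] := tube hf (line _ _ Dx Sy).
  have M0 : 0 <= M.
    have [_ h] := hr 0 (introT andP (conj (lexx 0) ler01)) _ (box_pp _ r0).
    exact: le_trans (cabs_ge0 _) h.
  pose K := 32 * M / r ^+ 2.
  have K0 : 0 <= K by rewrite divr_ge0 ?exprn_ge0 ?mulr_ge0 // ltW.
  pose l := cabs (y - p0).
  have l0 : 0 <= l by exact: cabs_ge0.
  have [d dd hd] := oD _ Dx.
  have Kl : 0 < K * l + 1 by rewrite ltr_wpDl // mulr_ge0.
  exists (Order.min d (Order.min (r / 8) (e / (K * l + 1)))).
    by rewrite !lt_min dd !divr_gt0.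
  move=> w; rewrite !lt_min => /and3P[/hd Dw w8 we].
  pose h := w - x; have wE : w = x + h by rewrite /h addrC subrK.
  (* The derivative in [y] of this function is the Taylor remainder of [f] in [x], which [tube] and
     [box_taylor] bound by [K * |h|^2] along the whole segment. *)
  have := @cder_mvt _ (fun y => F w y - F x y - G x y * h) p0 y (K * cabs h ^+ 2).
  rewrite (hF _ Dw).1 (hF _ Dx).1 (hG _ Dx).1 mul0r !subrr subr0 -/l -/h.
  move=> key; apply: (le_trans (key _)).
    move=> t t01; have Upt := line _ _ Dx Sy t t01.
    exists (f (w, pt p0 y t) - f (x, pt p0 y t) - Defs.Dx f (x, pt p0 y t) * h).
      apply: cderB; first by apply: cderB; [apply: (hF _ Dw).2|apply: (hF _ Dx).2]; exact: sS.
      have := cderM ((hG _ Dx).2 _ (sS _ Sy t t01)) (cder_cst h (pt p0 y t)).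
      by rewrite mulr0 addr0.
    rewrite wE; have := box_taylor r0 hf (hr t t01) (h := h) (q := (x, pt p0 y t)).
    apply=> //; apply: box_pp; exact: divr_gt0.
  rewrite expr2 mulrA mulrAC; apply: ler_wpM2r; first exact: cabs_ge0.
  rewrite mulrAC; apply: (@le_trans _ _ ((K * l + 1) * cabs h)).
    by rewrite ler_wpM2r ?cabs_ge0 // lerDl.
  by rewrite mulrC -ler_pdivlMr // ltW.
- by exists (f (x, y)); have [_ h] := hF _ Dx; exact: h.
have [r [M [r0 hr]]] := tube hf (line _ _ Dx Sy).
have [d d0 hd] := oU (x, y) (conj Dx Sy).
exists (Order.min r d), (M * (cabs (y - p0) + r)); rewrite lt_min r0 d0; split=> // q [].
rewrite /= !lt_min => /andP[a1 a2] /andP[b1 b2].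
have Uq : U q by apply: hd.
have [Dq Sq] := Uq.
have M0 : 0 <= M.
  have [_ h] := hr 0 (introT andP (conj (lexx 0) ler01)) _ (box_pp _ r0).
  exact: le_trans (cabs_ge0 _) h.
split=> //; have [F0 hFq] := hF _ Dq.
rewrite -[F q.1 q.2]subr0 -F0; apply: (le_trans (cder_mvt (M := M) _)).
  move=> t t01; exists (f (q.1, pt p0 q.2 t)); first by apply: hFq; exact: sS.
  apply: (hr t t01 _ _).2; split=> //=.
  have -> : pt p0 q.2 t - pt p0 y t = t%:C * (q.2 - y) by rewrite /pt; ring.
  case/andP: t01 => t0 t1; rewrite cabsM cabsr ger0_norm //.
  by apply: le_lt_trans b1; rewrite ler_piMl // cabs_ge0.
apply: ler_wpM2l => //.
by have := cabs_tri q.2 y p0; lra.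
Qed.

End SeparatelyHolomorphic.

(** * Primitives on slit domains *)

Section UnitModulus.
Variable R : realType.
Local Notation C := (cplx R).
Variable tau : C.
Hypothesis tau1 : cabs tau = 1.
Local Notation ctau := (tau^*%C : C).

Lemma conj_tau : ctau * tau = 1.
Proof.
have : cabs tau ^+ 2 = 1 by rewrite tau1 expr1n.
move: tau => [a b]; rewrite /cabs /= sqr_sqrtr ?addr_ge0 ?sqr_ge0 // => h.
apply/eqP; rewrite eq_complex /=; apply/andP; split; apply/eqP.
  by rewrite mulNr opprK -!expr2.
by ring.
Qed.
Lemma cabs_ctau : cabs ctau = 1.
Proof. by have := congr1 (@cabs R) conj_tau; rewrite cabsM tau1 mulr1 cabs1. Qed.
Lemma ctau_neq0 : ctau != 0.
Proof. by rewrite -cabs_gt0 cabs_ctau. Qed.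
Lemma ctauV : ctau^-1 = tau.
Proof. by apply: (mulfI ctau_neq0); rewrite mulfV ?ctau_neq0 // conj_tau. Qed.
End UnitModulus.

Section RayComplement.
Variable R : realType.
Local Notation C := (cplx R).

Lemma rayE (tau y : C) : cabs tau = 1 ->
  ray tau y <-> complex.Im (tau^*%C * y : C) = 0 /\ 0 <= complex.Re (tau^*%C * y : C).
Proof.
move=> t1; split.
  move=> [t t0 ->]; rewrite mulrCA conj_tau // mulr1 /=; split=> //.
move=> [h1 h2]; exists (complex.Re (tau^*%C * y : C)) => //.
rewrite -[LHS]mul1r -(conj_tau t1) [_ * tau]mulrC -mulrA mulrC; congr (_ * _).
by apply/eqP; rewrite eq_complex /= eqxx /= h1.
Qed.

Lemma ray_compl_open (tau : C) : cabs tau = 1 -> copen [set y | ~ ray tau y].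
Proof.
move=> t1 y /=; rewrite rayE // => h.
have dist w : cabs (tau^*%C * w - tau^*%C * y : C) = cabs (w - y).
  by rewrite -mulrBr cabsM cabs_ctau // mul1r.
have [i0|i0] := eqVneq (complex.Im (tau^*%C * y : C)) 0; last first.
  exists `|complex.Im (tau^*%C * y : C)|; first by rewrite normr_gt0.
  move=> w wy; rewrite rayE // => -[h1 _].
  have := Im_le_cabs (tau^*%C * w - tau^*%C * y : C).
  by rewrite dist cImB h1 sub0r normrN; apply/negP; rewrite -ltNge.
have re : complex.Re (tau^*%C * y : C) < 0 by rewrite ltNge; apply/negP => h0; exact: h.
exists (- complex.Re (tau^*%C * y : C)); first by rewrite oppr_gt0.
move=> w wy; rewrite rayE // => -[_ h1].
have := Re_le_cabs (tau^*%C * w - tau^*%C * y : C).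
by rewrite dist cReB => /(le_trans (ler_norm _)); lra.
Qed.

Lemma Omega_open (r : R) (tau : C) : cabs tau = 1 -> copen (Omega r tau).
Proof.
move=> t1 y [ry ny]; have [d d0 hd] := ray_compl_open t1 ny.
exists (Order.min d (cabs y - r)); first by rewrite lt_min d0 subr_gt0.
move=> w; rewrite lt_min => /andP[/hd w1 w2]; split=> //.
by have := cabs_dist y w; rewrite cabsBC; lra.
Qed.

(* The image of [Omega r tau] under inversion; unlike [Omega r tau] it is
   star-shaped, with respect to the points opposite to the slit. *)
Definition slit_disc (r : R) (tau : C) : set C :=
  [set v | r * cabs v < 1 /\ ~ ray tau^*%C v].

Lemma slit_open (r : R) (tau : C) : 0 <= r -> cabs tau = 1 -> copen (slit_disc r tau).
Proof.
move=> r0 t1 y [ry ny]; have [d d0 hd] := ray_compl_open (cabs_ctau t1) ny.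
have r1 : 0 < r + 1 by rewrite ltr_wpDl.
exists (Order.min d ((1 - r * cabs y) / (r + 1))).
  by rewrite lt_min d0 divr_gt0 // subr_gt0.
move=> w; rewrite lt_min ltr_pdivlMr // => /andP[/hd w1 w2]; split=> //.
have h1 := cabs_dist w y.
have h2 : r * (cabs w - cabs y) <= r * cabs (w - y) by rewrite ler_wpM2l.
by have := cabs_ge0 (w - y); lra.
Qed.

(** Opposite to the slit, at a modulus [1 / (r + 1)] that is admissible for every [r >= 0]; the
    value [r = 0] is that of [J]. *)
Definition slit_center (r : R) (tau : C) : C := - (r + 1)^-1%:C * tau^*%C.

Lemma slit_center_abs (r : R) (tau : C) : 0 <= r -> cabs tau = 1 ->
  r * cabs (slit_center r tau) < 1.
Proof.
move=> r0 t1; rewrite /slit_center cabsM cabsN cabsr cabs_ctau // mulr1.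
have r1 : 0 < r + 1 by rewrite ltr_wpDl.
by rewrite gtr0_norm ?invr_gt0 // ltr_pdivrMr // mul1r ltrDl.
Qed.

Lemma slit_star (r : R) (tau : C) : 0 <= r -> cabs tau = 1 ->
  star (slit_disc r tau) (slit_center r tau).
Proof.
move=> r0 t1 z [rz nz] t /andP[t0 t01].
have r1 : 0 < r + 1 by rewrite ltr_wpDl.
have c1 := slit_center_abs r0 t1.
have ptE : pt (slit_center r tau) z t = (1 - t)%:C * slit_center r tau + t%:C * z.
  by rewrite /pt rcB; ring.
split.
  have h : cabs (pt (slit_center r tau) z t) <= (1 - t) * cabs (slit_center r tau) + t * cabs z.
    rewrite ptE (le_trans (cabsD _ _)) // !cabsM !cabsr.
    by rewrite ger0_norm ?subr_ge0 // ger0_norm.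
  have h2 := ler_wpM2l r0 h.
  have [tt|tt] := ltP 0 t; last first.
    by have tE : t = 0; [lra|move: h2; rewrite tE subr0 mul1r mul0r addr0; lra].
  have h3 : (1 - t) * (r * cabs (slit_center r tau)) <= (1 - t) * 1.
    by rewrite ler_wpM2l ?subr_ge0 // ltW.
  have h4 : t * (r * cabs z) < t * 1 by rewrite ltr_pM2l.
  have h5 : r * ((1 - t) * cabs (slit_center r tau) + t * cabs z) =
     (1 - t) * (r * cabs (slit_center r tau)) + t * (r * cabs z) by ring.
  by rewrite h5 in h2; lra.
move=> [u u0]; rewrite ptE => E.
(* The centre is a negative multiple of the conjugate of [tau]. If the point of the segment were a
   nonnegative multiple, so would be [t * z], and [z] would lie on the ray; for [t = 0] a positive
   number would be 0. *)
have E2 : t%:C * z = (u + (1 - t) * (r + 1)^-1)%:C * tau^*%C.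
  rewrite rcD rcM mulrDl -E /slit_center; ring.
have [tt|tt] := ltP 0 t; last first.
  have tE : t = 0 by lra.
  move: E2; rewrite tE subr0 mul1r mul0r => /esym/eqP.
  rewrite mulf_eq0 (negbTE (ctau_neq0 t1)) orbF => /eqP/(congr1 (@complex.Re R)) /=.
  by apply/eqP; rewrite gt_eqF // ltr_wpDl // invr_gt0.
apply: nz; exists ((u + (1 - t) * (r + 1)^-1) / t).
  by rewrite divr_ge0 ?(ltW tt) // addr_ge0 // mulr_ge0 ?subr_ge0 // invr_ge0 ltW.
have tn : (t%:C : C) != 0 by rewrite -cabs_gt0 cabsr normr_gt0 gt_eqF.
by apply: (mulfI tn); rewrite E2 mulrA -rcM [t * _]mulrC divfK // gt_eqF.
Qed.

Lemma Omega_neq0 (r : R) (tau y : C) : 0 <= r -> Omega r tau y -> y != 0.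
Proof. by move=> r0 [ry _]; rewrite -cabs_gt0 (le_lt_trans r0). Qed.

Lemma slit_neq0 (r : R) (tau v : C) : slit_disc r tau v -> v != 0.
Proof. by move=> [_ h]; apply/eqP => v0; apply: h; exists 0 => //; rewrite v0 mul0r. Qed.

Lemma rayV (tau y : C) : cabs tau = 1 -> ray tau y -> ray tau^*%C y^-1.
Proof.
move=> t1 [t t0 ->]; exists t^-1; first by rewrite invr_ge0.
by rewrite invfM rcV; congr (_ * _); rewrite -[RHS]invrK ctauV.
Qed.

Lemma OmegaV (r : R) (tau y : C) : 0 <= r -> cabs tau = 1 -> Omega r tau y ->
  slit_disc r tau y^-1.
Proof.
move=> r0 t1 Oy; have y0 := Omega_neq0 r0 Oy; case: Oy => ry ny.
split; first by rewrite cabsV ltr_pdivrMr ?mul1r // cabs_gt0.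
by move=> /(rayV (cabs_ctau t1)); rewrite invrK conjcK.
Qed.

Lemma slitV (r : R) (tau v : C) : 0 <= r -> cabs tau = 1 -> slit_disc r tau v ->
  Omega r tau v^-1.
Proof.
move=> r0 t1 Sv; have v0 := slit_neq0 Sv; case: Sv => rv nv.
split; first by rewrite cabsV -div1r ltr_pdivlMr // cabs_gt0.
by move=> /(rayV t1); rewrite invrK.
Qed.

Lemma cder_inv (v : C) : v != 0 -> cder (fun w => w^-1) v (- v ^- 2).
Proof. by move=> v0; have := cderV (f := id) v0 (cder_id v); rewrite mulN1r. Qed.

(** The rays through 1, -1 and ['i] meet only at 0, so each of the two points lies on at most one of
    them, and one of the three rays is left free. *)
Lemma slit_choice (y z : C) : y != 0 -> z != 0 ->
  exists tau : C, [/\ cabs tau = 1, ~ ray tau y & ~ ray tau z].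
Proof.
move=> y0 z0.
have c1 : cabs (1 : C) = 1 := cabs1 R.
have cN1 : cabs (-1 : C) = 1 by rewrite cabsN.
have ci : cabs ('i : C) = 1 by rewrite /cabs /= expr0n expr1n add0r sqrtr1.
have key (u : C) : u != 0 -> [/\ ~ (ray 1 u /\ ray (-1) u),
    ~ (ray 1 u /\ ray 'i u) & ~ (ray (-1) u /\ ray 'i u)].
  move=> /eqP u0.
  have h1 := (rayE u c1).1; have h2 := (rayE u cN1).1; have h3 := (rayE u ci).1.
  move: u0 h1 h2 h3; case: u => a b u0.
  move: (ray 1 _) (ray (-1) _) (ray 'i _) => P1 P2 P3 /=.
  rewrite !(mul0r, mul1r, mulN1r, oppr0, subr0, addr0, add0r, mulNr, opprK) => h1 h2 h3.
  split=> -[p q]; apply: u0; congr (_ +i* _).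
  - by have := h1 p; have := h2 q; lra.
  - by have := h1 p; have := h2 q; lra.
  - by have := h1 p; have := h3 q; lra.
  - by have := h1 p; have := h3 q; lra.
  - by have := h2 p; have := h3 q; lra.
  - by have := h2 p; have := h3 q; lra.
have [k1 k2 k3] := key _ y0; have [l1 l2 l3] := key _ z0.
apply: contrapT => no.
have f t : cabs t = 1 -> ray t y \/ ray t z.
  by move=> ht; apply: contrapT => /not_orP[n1 n2]; apply: no; exists t.
by case: (f _ c1) => ?; case: (f _ cN1) => ?; case: (f _ ci) => ?; tauto.
Qed.
Section Primitive.
Variables (r : R) (tau : C) (D : set C).
Hypotheses (r0 : 0 <= r) (t1 : cabs tau = 1) (oD : copen D).
Let Z : set (C * C) := [set p | D p.1 /\ Omega r tau p.2].
Let W : set (C * C) := [set p | D p.1 /\ slit_disc r tau p.2].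

Lemma slit_popen : popen Z.
Proof. by apply: pairP => //; exact: Omega_open. Qed.

(** In the coordinate [v = 1 / y] the form [f dy] becomes [- f (x, 1 / v) / v^2 dv] on a star-shaped
    domain. *)
Lemma sh_primitive_slit (f : C * C -> C) : sep_holo Z f -> exists F, sep_holo Z F /\
  forall p, Z p -> cder (fun y => F (p.1, y)) p.2 (f p).
Proof.
move=> hf.
have oW : popen W by apply: pairP => //; exact: slit_open.
have hV : sep_holo W (fun p => f (p.1, p.2^-1) * - p.2 ^- 2).
  apply: sh_mul.
    apply: (sh_comp_snd (V := Z) (phi := fun v => v^-1)) => // p [Dp Sp]; split.
      by split=> //=; exact: slitV.
    by eexists; apply: cder_inv; exact: slit_neq0 Sp.
  apply: (@sh_snd _ _ (slit_disc r tau) (fun v => - v ^- 2)) => //.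
  - exact: slit_open.
  - by move=> p [].
  by move=> v /slit_neq0 v0; eexists; apply: cderN; exact: cderXV.
have [F [hF dF]] := sh_primitive oD (slit_open r0 t1) (slit_star r0 t1) hV.
exists (fun p => F (p.1, p.2^-1)); split.
  apply: (sh_comp_snd (V := W) (phi := fun v => v^-1)) => //; first exact: slit_popen.
  move=> p [Dp Op]; split; first by split=> //=; exact: OmegaV.
  by eexists; apply: cder_inv; exact: Omega_neq0 Op.
move=> [x y] [/= Dx Oy]; have y0 := Omega_neq0 r0 Oy.
have := cder_comp (f := fun v => F (x, v)) (g := fun y => y^-1) (dF (x, y^-1) Dx (OmegaV r0 t1 Oy)) (cder_inv y0).
rewrite /= invrK; congr cder.
by rewrite mulrN mulrN mulNr opprK -mulrA exprVn invrK mulfV ?mulr1 // expf_neq0.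
Qed.

Lemma slit_constant (G : C -> C) (y w : C) : (forall z, Omega r tau z -> cder G z 0) ->
  Omega r tau y -> Omega r tau w -> G y = G w.
Proof.
move=> dG Oy Ow.
have key v : slit_disc r tau v -> G v^-1 = G (slit_center r tau)^-1.
  apply: (@star_constant _ (slit_disc r tau) (slit_center r tau) v (fun v => G v^-1)).
    exact: slit_star.
  move=> u Su; rewrite -(mul0r (- u ^- 2)).
  apply: (cder_comp (g := fun v => v^-1)); first by apply: dG; exact: slitV.
  by apply: cder_inv; exact: slit_neq0 Su.
by rewrite -[y]invrK -[w]invrK !key //; exact: OmegaV.
Qed.

(** Two primitives on the slit domain differ by a constant, so the choice made by [xget] does not
    matter and any known [F] computes the value. *)
Lemma primitiveE (omega : C) (f F : C -> C) (y : C) :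
  (forall z, Omega r tau z -> cder F z (f z)) -> Omega r tau omega -> Omega r tau y ->
  primitive r tau omega f y = F y - F omega.
Proof.
move=> dF Ow Oy; rewrite /primitive.
set S := [set F : C -> C | _].
have S1 : S (fun z => F z - F omega).
  split; first by rewrite subrr.
  move=> z Oz; apply/cderP; have := cderB (dF z Oz) (cder_cst (F omega) z).
  by rewrite subr0.
have [G0 dG] : S (xget (fun=> 0) S) by apply: xgetI S1.
set G := xget _ _ in G0 dG *.
have E : G y - F y = G omega - F omega.
  apply: (@slit_constant (fun z => G z - F z)) => // z Oz; rewrite -(subrr (f z)).
  by apply: cderB (dF z Oz); apply/cderP; exact: dG.
by rewrite -[LHS](subrK (F y)) E G0 sub0r addrC.
Qed.

End Primitive.
End RayComplement.

(** * Expansion of G_1 at infinity *)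

Section GeometricSeries.
Variable R : realType.
Local Notation C := (cplx R).

Lemma geo_tail (q : R) (m n : nat) : 0 <= q < 1 ->
  \sum_(m <= k < n) q ^+ k <= q ^+ m / (1 - q).
Proof.
move=> /andP[q0 q1]; have q1' : 0 < 1 - q by rewrite subr_gt0.
have [mn|nm] := leqP m n; last first.
  by rewrite (big_geq (ltnW nm)) divr_ge0 ?exprn_ge0 // ltW.
suff -> : \sum_(m <= k < n) q ^+ k = (q ^+ m - q ^+ n) / (1 - q).
  by rewrite ler_pM2r ?invr_gt0 // gerBl exprn_ge0.
have {}q1' := lt0r_neq0 q1'.
elim: n mn => [|n IH]; first by rewrite leqn0 => /eqP ->; rewrite big_geq // subrr mul0r.
rewrite leq_eqVlt => /orP[/eqP ->|mn]; first by rewrite big_geq // subrr mul0r.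
by rewrite big_nat_recr //= IH // exprS; field.
Qed.

Lemma geo_partial (u : nat -> C) (K q : R) (n m : nat) : 0 <= q < 1 -> (n <= m)%N ->
  (forall k, cabs (u k) <= K * q ^+ k) ->
  cabs (\sum_(0 <= k < m) u k - \sum_(0 <= k < n) u k) <= K * q ^+ n / (1 - q).
Proof.
move=> q01 nm hu; have K0 : 0 <= K.
  by have := hu 0%N; rewrite expr0 mulr1; exact: le_trans (cabs_ge0 _).
rewrite [X in cabs X](_ : _ = \sum_(n <= k < m) u k); last first.
  rewrite (big_cat_nat (leq0n n) nm) /=. by rewrite addrAC subrr add0r.
apply: (le_trans (cabs_sum _ _ _)); apply: (@le_trans _ _ (\sum_(n <= k < m) K * q ^+ k)).
  by apply: ler_sum => k _; exact: hu.
by rewrite -mulr_sumr -mulrA ler_wpM2l // geo_tail.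
Qed.

Lemma geo_decr (K q : R) (n m : nat) : 0 <= q < 1 -> 0 <= K -> (n <= m)%N ->
  K * q ^+ m <= K * q ^+ n.
Proof.
by move=> /andP[q0 q1] K0 nm; rewrite ler_wpM2l // ler_wiXn2l // ltW.
Qed.

Lemma geo_series (u : nat -> C) (K q : R) : 0 <= q < 1 ->
  (forall k, cabs (u k) <= K * q ^+ k) ->
  exists l, forall n, cabs (\sum_(0 <= k < n) u k - l) <= 2 * K / (1 - q) * q ^+ n.
Proof.
move=> q01 hu.
have [l hl] := @cauchy_limitC R (fun n => \sum_(0 <= k < n) u k) (fun n => K * q ^+ n / (1 - q)) (fun n m nm => geo_partial q01 nm hu).
by exists l => n; apply: (le_trans (hl n)); rewrite le_eqVlt; apply/orP; left; apply/eqP; ring.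
Qed.

Lemma cvg_of_bound (u : nat -> C) (l : C) (K q : R) : 0 <= q < 1 -> 0 <= K ->
  (forall n, cabs (u n - l) <= K * q ^+ n) -> u @ \oo --> l.
Proof.
move=> q01 K0 h; apply/cvg_cabs => e e0.
have [N hN] := geometric_small K q01 e0.
exists N => // n /= Nn; apply: (le_lt_trans (h n)); apply: le_lt_trans hN.
exact: geo_decr.
Qed.

Lemma limn_of_bound (u : nat -> C) (l : C) (K q : R) : 0 <= q < 1 -> 0 <= K ->
  (forall n, cabs (u n - l) <= K * q ^+ n) -> limn u = l.
Proof. by move=> q01 K0 h; apply: cvg_lim => //; exact: cvg_of_bound h. Qed.

(** If the coefficients before [m] vanish, the sum being 0 at [v = c] bounds the term of index [m]
    by the tail, of order [c^(m+1)], with [c] as small as desired. Only [v != 0] is tested since [v]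
    will be [1 / y]. *)
Lemma powerseries_unique (b : nat -> C) (e : R) : 0 < e ->
  (forall v : C, 0 < cabs v < e ->
     (fun n => \sum_(0 <= k < n) b k * v ^+ k) @ \oo --> (0 : C)) ->
  forall m, b m = 0.
Proof.
move=> e0 H.
pose a := e / 2; have a0 : 0 < a by rewrite divr_gt0.
have aa : cabs (a%:C : C) = a by rewrite cabsr gtr0_norm.
have [K [K0 hK]] : exists K, 0 <= K /\ forall k, cabs (b k) * a ^+ k <= K.
  have /H/cvg_cabs/(_ 1 ltr01)[N _ hN] : 0 < cabs (a%:C : C) < e by rewrite aa a0 /a; lra.
  (* From the index [N] on, a term is the difference of two partial sums of modulus less than 1; the
     finitely many others are bounded by their sum. *)
  exists (2 + \sum_(0 <= k < N) cabs (b k) * a ^+ k).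
  have pos k : 0 <= cabs (b k) * a ^+ k by rewrite mulr_ge0 ?cabs_ge0 // exprn_ge0 // ltW.
  have spos : 0 <= \sum_(0 <= k < N) cabs (b k) * a ^+ k by apply: sumr_ge0.
  split; first by rewrite addr_ge0.
  move=> k; have [kN|Nk] := ltnP k N.
    rewrite big_mkord (bigD1 (Ordinal kN)) //= addrCA lerDl addr_ge0 //.
    by apply: sumr_ge0.
  have h1 := hN k Nk; have h2 := hN k.+1 (leqW Nk).
  have : cabs (b k * a%:C ^+ k) <= 2.
    have -> : b k * a%:C ^+ k = (\sum_(0 <= j < k.+1) b j * a%:C ^+ j - 0) - (\sum_(0 <= j < k) b j * a%:C ^+ j - 0).
      by rewrite big_nat_recr //= !subr0 addrAC subrr add0r.
    apply: (le_trans (cabsB _ _)); move: h1 h2 => /=; lra.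
  by rewrite cabsM cabsX aa; lra.
elim/ltn_ind => m IH; apply/eqP; rewrite -cabs_eq0 eq_le cabs_ge0 andbT.
apply: (@forall_le0 _ _ 1) => y y0; rewrite mulr1.
have am0 : 0 < a ^+ m.+1 by rewrite exprn_gt0.
have T0 : 0 < 2 * K + 1 by rewrite ltr_wpDl // mulr_ge0.
(* [c <= a / 2] makes the ratio [q] at most 1/2, so that the tail is at most twice its first bound.
   The second condition makes the final estimate [2 * K * c / a^(m+1)] at most [y], the [+ 1]
   covering [K = 0]. *)
pose c := Order.min (a / 2) (y * a ^+ m.+1 / (2 * K + 1)).
have c0 : 0 < c by rewrite lt_min !divr_gt0 // mulr_gt0.
have ca : c <= a / 2 by rewrite ge_min lexx.
have cy : c <= y * a ^+ m.+1 / (2 * K + 1) by rewrite ge_min lexx orbT.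
clearbody c.
have cc : cabs (c%:C : C) = c by rewrite cabsr gtr0_norm.
pose q := c / a.
have q01 : 0 <= q < 1 by rewrite divr_ge0 ?(ltW c0) ?(ltW a0) //= ltr_pdivrMr // mul1r; lra.
have q2 : q <= 1 / 2 by rewrite ler_pdivrMr //; lra.
have key : cabs (b m) * c ^+ m <= K * (2 * q ^+ m.+1).
  rewrite -subr_le0; apply: (@forall_le0 _ _ 1) => x x0; rewrite mulr1.
  have /H/cvg_cabs/(_ x x0)[N _ hN] : 0 < cabs (c%:C : C) < e by rewrite cc c0 /=; rewrite /a in ca; lra.
  have := hN (maxn N m.+1) (leq_maxl _ _); rewrite /= subr0.
  set n := maxn N m.+1; have mn : (m < n)%N by exact: leq_maxr.
  rewrite (big_cat_nat (leq0n m) (ltnW mn)) /= big_nat big1 => [|k /andP[_ /IH ->]]; last by rewrite mul0r.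
  rewrite add0r big_ltn // => hx.
  have tail : cabs (\sum_(m.+1 <= k < n) b k * c%:C ^+ k) <= K * (2 * q ^+ m.+1).
    apply: (le_trans (cabs_sum _ _ _)); apply: (@le_trans _ _ (\sum_(m.+1 <= k < n) K * q ^+ k)).
      apply: ler_sum => k _; rewrite cabsM cabsX cc.
      have -> : c ^+ k = a ^+ k * q ^+ k by rewrite -exprMn /q mulrC divfK // gt_eqF.
      by rewrite mulrA ler_wpM2r ?hK // exprn_ge0 // divr_ge0 // ltW.
    rewrite -mulr_sumr ler_wpM2l //; apply: (le_trans (geo_tail _ _ q01)).
    have qn : 0 <= q ^+ m.+1 by rewrite exprn_ge0 //; case/andP: q01.
    by rewrite ler_pdivrMr; [nra|lra].
  have h3 : cabs (b m * c%:C ^+ m) <= x + K * (2 * q ^+ m.+1).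
    set S := \sum_(m.+1 <= k < n) _ in hx tail.
    have -> : b m * c%:C ^+ m = (b m * c%:C ^+ m + S) - S by rewrite addrK.
    by apply: (le_trans (cabsB _ _)); lra.
  by move: h3; rewrite cabsM cabsX cc; lra.
have cm0 : 0 < c ^+ m by rewrite exprn_gt0.
have : cabs (b m) <= 2 * K * c / a ^+ m.+1.
  rewrite -(ler_pM2r cm0); apply: (le_trans key).
  by rewrite /q expr_div_n [c ^+ m.+1]exprS le_eqVlt; apply/orP; left; apply/eqP; ring.
move=> /le_trans; apply; rewrite ler_pdivrMr //.
move: cy; rewrite ler_pdivlMr //; lra.
Qed.

End GeometricSeries.

(** * The Cauchy kernel along a finite family of paths *)

Section CauchyKernelExpansion.
Variable R : realType.
Local Notation C := (cplx R).
Variables (n : nat) (W1 W2 V1 V2 : 'I_n -> R -> C) (kappa : C).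
Hypotheses (cW1 : forall i, continuous (W1 i)) (cW2 : forall i, continuous (W2 i)).
Hypotheses (cV1 : forall i, continuous (V1 i)) (cV2 : forall i, continuous (V2 i)).
Hypothesis W1n0 : forall i t, W1 i t != 0.

(* The pole in [y] of [W1 / (x + y W1 + W2)]. *)
Definition pole (x : C) (i : 'I_n) (t : R) : C := - (x + W2 i t) / W1 i t.

(** With [a] the pole, [W1 / (x + y * W1 + W2)] is [1 / (y - a)], and [(y * V1 + V2) / (y - a) = V1
    + (a * V1 + V2) / (y - a)]. Expanding in powers of [a / y] makes [kcoef m] the coefficient of
    [y ^- m.+1] and [kcoef0] the constant term. *)
Definition kcoef (m : nat) (x : C) : C :=
  kappa * \sum_(i < n) integral01 (fun t => (pole x i t * V1 i t + V2 i t) * pole x i t ^+ m).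
Definition kcoef0 : C := kappa * \sum_(i < n) integral01 (V1 i).
Definition kint (x y : C) : C :=
  kappa * \sum_(i < n) integral01 (fun t => W1 i t / (x + y * W1 i t + W2 i t) * (y * V1 i t + V2 i t)).

Lemma continuousCV (p : R -> C) : continuous p -> (forall t, p t != 0) ->
  continuous (fun t => (p t)^-1).
Proof. by move=> cp p0 t; apply: cvgV; [exact: p0|exact: cp]. Qed.

Lemma continuousCN (p : R -> C) : continuous p -> continuous (fun t => - p t).
Proof. by move=> cp t; apply: cvgN; exact: cp. Qed.

Lemma pole_cont x i : continuous (pole x i).
Proof.
have h1 := continuousCN (continuousCD (@continuousC_cst R x) (@cW2 i)).
exact: (continuousCM h1 (continuousCV (@cW1 i) (@W1n0 i))).
Qed.

Lemma kernel_cont m x i :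
  continuous (fun t => (pole x i t * V1 i t + V2 i t) * pole x i t ^+ m).
Proof.
have h1 := continuousCD (continuousCM (@pole_cont x i) (@cV1 i)) (@cV2 i).
exact: (continuousCM h1 (@continuousCX _ _ m (@pole_cont x i))).
Qed.

Lemma continuous_bounded (p : R -> C) : continuous p ->
  exists M : R, 0 <= M /\ forall t : R, 0 <= t <= 1 -> cabs (p t) <= M.
Proof.
move=> cp.
have cab : continuous (fun t => cabs (p t)).
  move=> t; apply/cvgrPdist_lt => e e0.
  have /continuous_cabs/(_ e e0) := cp t; apply: filterS => s hs.
  have h1 := cabs_dist (p s) (p t); have h2 := cabs_dist (p t) (p s).
  by rewrite cabsBC in h2; rewrite ltr_norml; apply/andP; split; lra.
have [c c01 hc] := EVT_max ler01 (continuous_subspaceT cab).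
exists (cabs (p c)); split; first exact: cabs_ge0.
by move=> t t01; apply: hc; rewrite in_itv.
Qed.

Lemma bounded_family (V : 'I_n -> R -> C) : (forall i, continuous (V i)) ->
  exists M : R, 0 <= M /\ forall i (t : R), 0 <= t <= 1 -> cabs (V i t) <= M.
Proof.
move=> cV.
have /choice[M hM] : forall i, exists M : R, 0 <= M /\ forall t : R, 0 <= t <= 1 -> cabs (V i t) <= M.
  by move=> i; exact: continuous_bounded.
exists (\sum_(i < n) M i); split; first by apply: sumr_ge0 => i _; have [] := hM i.
move=> i t t01; rewrite (bigD1 i) //=; apply: (le_trans ((hM i).2 t t01)).
by rewrite lerDl sumr_ge0 // => j _; have [] := hM j.
Qed.

Lemma kernel_sum (x y : C) i t N : y != 0 -> y != pole x i t -> (0 < N)%N ->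
  W1 i t / (x + y * W1 i t + W2 i t) * (y * V1 i t + V2 i t) =
  V1 i t + \sum_(1 <= m < N) y ^- m * ((pole x i t * V1 i t + V2 i t) * pole x i t ^+ m.-1) +
  (pole x i t * V1 i t + V2 i t) * (pole x i t / y) ^+ N.-1 / (y - pole x i t).
Proof.
move=> y0 ya N0; have w0 := W1n0 i t.
set a := pole x i t in ya *.
have ya0 : y - a != 0 by rewrite subr_eq0.
have E : x + y * W1 i t + W2 i t = W1 i t * (y - a).
  by rewrite /a /pole; field.
rewrite E invfM mulrA mulfV // mul1r; clear E; clearbody a.
have S : \sum_(1 <= m < N) y ^- m * ((a * V1 i t + V2 i t) * a ^+ m.-1) =
   (a * V1 i t + V2 i t) * ((1 - (a / y) ^+ N.-1) / (y - a)).
  case: N N0 => // N _; rewrite big_add1 /=.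
  elim: N => [|N IH]; first by rewrite big_geq // expr0 subrr mul0r mulr0.
  rewrite big_nat_recr //= IH !expr_div_n !exprS.
  have yN : y ^+ N != 0 by rewrite expf_neq0.
  move: (y ^+ N) (a ^+ N) yN => Y X Y0.
  by field; rewrite ya0 Y0 y0.
by rewrite S; move: ((a / y) ^+ _) => X; field.
Qed.

Section Bounds.
Variables (rho : R).
Hypothesis rho0 : 0 <= rho.

(** [B] is built from bounds of [V1] and [V2] along the paths and does not depend on [x], so the
    estimates are uniform as long as the poles stay in the disc of radius [rho]. *)
Lemma kernel_bound : exists B : R, 0 <= B /\ forall x,
  (forall i (t : R), 0 <= t <= 1 -> cabs (pole x i t) <= rho) ->
  (forall m, cabs (kcoef m x) <= B * rho ^+ m) /\
  forall y N, rho < cabs y ->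
    cabs (kint x y - (kcoef0 + \sum_(1 <= m < N.+1) kcoef m.-1 x * y ^- m)) <=
    B / (cabs y - rho) * (rho / cabs y) ^+ N.
Proof.
have [B1 [B10 hB1]] := bounded_family cV1; have [B2 [B20 hB2]] := bounded_family cV2.
pose b := rho * B1 + B2.
have b0 : 0 <= b by rewrite addr_ge0 // mulr_ge0.
exists (cabs kappa * (n%:R * b)); split; first by rewrite !mulr_ge0 // cabs_ge0.
move=> x hx.
have hb i t : 0 <= t <= 1 -> cabs (pole x i t * V1 i t + V2 i t) <= b.
  move=> t01; apply: (le_trans (cabsD _ _)); rewrite cabsM lerD ?hB2 //.
  by rewrite ler_pM ?cabs_ge0 ?hx ?hB1.
split.
  move=> m; rewrite /kcoef cabsM -mulrA ler_wpM2l ?cabs_ge0 //.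
  apply: (le_trans (cabs_sum _ _ _)).
  apply: (@le_trans _ _ (\sum_(i < n) b * rho ^+ m)); last first.
    by rewrite sumr_const card_ord -mulrA mulr_natl.
  apply: ler_sum => i _; apply: integral01_bound; first exact: kernel_cont.
  move=> t t01; rewrite cabsM cabsX ler_pM ?cabs_ge0 ?exprn_ge0 ?cabs_ge0 ?hb //.
  by rewrite lerXn2r ?nnegrE ?cabs_ge0 ?hx.
move=> y N ry.
have yp : 0 < cabs y by exact: le_lt_trans ry.
have y0 : y != 0 by rewrite -cabs_gt0.
have yr : 0 < cabs y - rho by rewrite subr_gt0.
pose F i t := W1 i t / (x + y * W1 i t + W2 i t) * (y * V1 i t + V2 i t).
(* Outside the unit interval nothing keeps the pole away from [y]; clamping makes [y - pole] nonzero
   for every [t], hence [rem] continuous. *)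
pose rem i t := (pole x i (clamp t) * V1 i (clamp t) + V2 i (clamp t)) *
   (pole x i (clamp t) / y) ^+ N / (y - pole x i (clamp t)).
have ya i t : y != pole x i (clamp t).
  by apply/eqP => h; have := hx i _ (clamp01 t); rewrite -h leNgt ry.
have cl (p : R -> C) : continuous p -> continuous (fun t => p (clamp t)).
  by move=> cp t; apply: continuous_comp; [exact: clamp_cont|exact: cp].
have crem i : continuous (rem i).
  have h1 := cl _ (continuousCD (continuousCM (@pole_cont x i) (@cV1 i)) (@cV2 i)).
  have h2 := cl _ (@continuousCX _ _ N (continuousCM (@pole_cont x i) (@continuousC_cst R y^-1))).
  have h3 := cl _ (continuousCD (@continuousC_cst R y) (continuousCN (@pole_cont x i))).
  apply: (continuousCM (continuousCM h1 h2) (continuousCV h3 _)) => t.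
  by rewrite subr_eq0.
have cs i : continuous (fun t => \sum_(1 <= m < N.+1)
    y ^- m * ((pole x i t * V1 i t + V2 i t) * pole x i t ^+ m.-1)).
  elim: (index_iota _ _) => [|m s IH].
    by under eq_fun do rewrite big_nil; move=> t; exact: cst_continuous.
  under eq_fun do rewrite big_cons.
  exact: (continuousCD (continuousCM (@continuousC_cst R (y ^- m)) (@kernel_cont m.-1 x i)) IH).
have key i : integral01 (F i) = integral01 (V1 i) + \sum_(1 <= m < N.+1)
     y ^- m * integral01 (fun t => (pole x i t * V1 i t + V2 i t) * pole x i t ^+ m.-1) +
     integral01 (rem i).
  have -> : integral01 (F i) = integral01 (fun t => (V1 i t + \sum_(1 <= m < N.+1)
    y ^- m * ((pole x i t * V1 i t + V2 i t) * pole x i t ^+ m.-1)) + rem i t).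
    apply: integral01_ext => t t01; rewrite /F /rem clamp_id //.
    by rewrite (@kernel_sum x y i t N.+1) // -(clamp_id t01).
  rewrite (integral01D (continuousCD (@cV1 i) (cs i)) (crem i)).
  rewrite (integral01D (@cV1 i) (cs i)); congr (_ + _ + _).
  rewrite integral01_sum; last first.
    move=> m; exact: (continuousCM (@continuousC_cst R (y ^- m)) (@kernel_cont m.-1 x i)).
  by apply: eq_bigr => m _; rewrite integral01Z //; exact: kernel_cont.
have -> : kint x y - (kcoef0 + \sum_(1 <= m < N.+1) kcoef m.-1 x * y ^- m) =
   kappa * \sum_(i < n) integral01 (rem i).
  have -> : kint x y = kappa * \sum_(i < n) integral01 (F i) by [].
  rewrite (eq_bigr _ (fun i _ => key i)) !big_split /= exchange_big /= !mulrDr.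
  rewrite -/kcoef0 [X in _ + X + _](_ : _ = \sum_(1 <= m < N.+1) kcoef m.-1 x * y ^- m).
    by rewrite addrAC subrr add0r.
  rewrite mulr_sumr; apply: eq_bigr => m _; rewrite -mulr_sumr /kcoef.
  by rewrite mulrCA mulrC.
rewrite cabsM -!mulrA ler_wpM2l ?cabs_ge0 //.
apply: (le_trans (cabs_sum _ _ _)).
apply: (@le_trans _ _ (\sum_(i < n) (b * ((cabs y - rho)^-1 * (rho / cabs y) ^+ N)))); last first.
  by rewrite sumr_const card_ord mulr_natl.
apply: ler_sum => i _; apply: integral01_bound => // t _.
have ct := clamp01 t.
rewrite /rem cabsM cabsM cabsX cabsM !cabsV mulrAC -mulrA.
apply: ler_pM; rewrite ?cabs_ge0 ?hb //.
  by rewrite mulr_ge0 ?invr_ge0 ?exprn_ge0 ?divr_ge0 ?cabs_ge0.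
apply: ler_pM; rewrite ?invr_ge0 ?exprn_ge0 ?divr_ge0 ?cabs_ge0 //.
  rewrite lef_pV2 ?posrE // ?cabs_gt0 ?subr_eq0 ?ya //.
  by have := cabs_dist y (pole x i (clamp t)); have := hx i _ ct; lra.
rewrite lerXn2r ?nnegrE ?divr_ge0 ?cabs_ge0 //.
by rewrite ler_wpM2r ?invr_ge0 ?cabs_ge0 // hx.
Qed.
End Bounds.

(** The pole is affine in [x] with slope [- 1 / W1]. For the boundary data of [Q] the slope obtained
    here is minus the integral defining [delta]. *)
Lemma kcoef_first x x' : kcoef 0 x - kcoef 0 x' =
  - (kappa * \sum_(i < n) integral01 (fun t => (W1 i t)^-1 * V1 i t)) * (x - x').
Proof.
rewrite /kcoef -mulrBr mulNr -mulrA -mulrN; congr (_ * _).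
rewrite -sumrB mulr_suml -sumrN; apply: eq_bigr => i _.
have cv : continuous (fun t => (W1 i t)^-1 * V1 i t).
  exact: (continuousCM (continuousCV (@cW1 i) (@W1n0 i)) (@cV1 i)).
have -> : - (integral01 (fun t => (W1 i t)^-1 * V1 i t) * (x - x')) =
  (x' - x) * integral01 (fun t => (W1 i t)^-1 * V1 i t) by ring.
rewrite -(integral01Z _ cv).
have -> : integral01 (fun t => (pole x i t * V1 i t + V2 i t) * pole x i t ^+ 0) =
  integral01 (fun t => (pole x' i t * V1 i t + V2 i t) * pole x' i t ^+ 0 +
     (x' - x) * ((W1 i t)^-1 * V1 i t)).
  by apply: integral01_ext => t _; rewrite !expr0 /pole; field; exact: W1n0.
rewrite integral01D; first by rewrite addrAC subrr add0r.
  exact: kernel_cont.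
exact: (continuousCM (@continuousC_cst R (x' - x)) cv).
Qed.

End CauchyKernelExpansion.

(** * Regularity of the coordinates along [bQ] and the coefficients of [G1] *)

Section BoundaryIntegrals.
Variables (R : realType) (Q : nodal_domain R).
Local Notation C := (cplx R).
Local Notation X := (nd_X Q).
Local Notation S := (@nd_S R Q).
Local Notation gam := (@nd_gam R Q).
Local Notation w := (@nc_pt R X).
Hypothesis hQ : general_position Q.

Lemma gam_bdry i t : bdry S (gam i t).
Proof. by rewrite nd_bdry; exists i, t. Qed.

Lemma bdry_neq0 p j : bdry S p -> w p 0 j != 0.
Proof. by case: hQ => h _; exact: h. Qed.

(** The homogeneous coordinates have no regularity of their own. In a chart their ratio is a
    holomorphic [phi] and the boundary curve a [C^1] path [al]; the data are local because one chart
    need not cover the curve. *)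
Lemma bdry_path_local (j : 'I_3) i (t : R) :
  exists (phi : C -> C) (al : R -> C) (d : R),
    [/\ 0 < d, holo (cball (al t) d) phi, {for t, continuous (rderive al)},
        \forall s \near t, rder al s (rderive al s) &
        \forall s \near t, aff w j 0 (gam i s) = phi (al s)].
Proof.
have [a aat adom] := rs_cover (gam i t).
have cat_ : chart_at (gam i t) a by split.
pose G := [set p : X | chart_dom a p /\ w p 0 0 != 0].
have oG : open G by apply: openI; [exact: chart_dom_open|exact: nc_chart_open].
have Gt : G (gam i t) by split=> //; exact: bdry_neq0 (gam_bdry i t).
pose z0 : C := a (gam i t).
have im0 : (a @` chart_dom a) z0 by exists (gam i t).
have n1 : nbhs z0 (a @` chart_dom a) by apply: open_nbhs_nbhs; split=> //; exact: chart_im_open.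
have n2 : nbhs z0 (chart_inv a @^-1` G).
  apply: (chart_inv_continuous im0); apply: open_nbhs_nbhs; split=> //.
  by rewrite chartK.
have [d d0 hd] := (nbhs_cabs z0 _).1 (filterI n1 n2).
exists (fun z => aff w j 0 (chart_inv a z)), (fun s => a (gam i s)), d; split=> //.
- move=> z /hd[[p dp pz] [dq wq]]; exists (cdv (fun z => aff w j 0 (chart_inv a z)) z).
  apply/cderP/derivableP; rewrite -pz.
  have wp : w p 0 0 != 0 by move: wq; rewrite -pz chartK.
  by apply: nc_holomorphic => //; split.
- by have [[_ h] _] := nd_C1 cat_.
- have [[h _] _] := nd_C1 cat_; apply: filterS h => s [h1 h2].
  exact: rderiveP.
have n3 : \forall s \near t, chart_dom a (gam i s).
  apply: (@nd_continuous R Q i t); apply: open_nbhs_nbhs; split=> //; exact: chart_dom_open.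
by apply: filterS n3 => s ds; rewrite chartK.
Qed.

Lemma bdry_path (j : 'I_3) i :
  (forall t : R, rder (fun s => aff w j 0 (gam i s)) t (rderive (fun s => aff w j 0 (gam i s)) t)) /\
  continuous (rderive (fun s => aff w j 0 (gam i s))).
Proof.
set W := fun s => aff w j 0 (gam i s).
have key t : exists (V : R -> C), {for t, continuous V} /\ \forall s \near t, rder W s (V s).
  have [phi [al [d [d0 hphi ral dal eW]]]] := bdry_path_local j i t.
  have al_t := nbhs_singleton dal.
  have [e e0 he] := rder_locally al_t.
  have K0 : 0 < cabs (rderive al t) + 1 by rewrite ltr_wpDl // cabs_ge0.
  have near_al : \forall s \near t, cball (al t) d (al s).
    apply/nbhs_ballP; exists (Order.min e (d / (cabs (rderive al t) + 1))).
      by rewrite /= lt_min e0 divr_gt0.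
    move=> s; rewrite /ball /= distrC lt_min => /andP[/he h1 h2].
    by apply: le_lt_trans h1 _; rewrite mulrC -ltr_pdivlMr.
  exists (fun s => cdv phi (al s) * rderive al s); split.
    apply: continuousM; last exact: ral.
    apply: (@continuous_comp _ _ _ al (cdv phi)).
      apply/continuous_cabs => x x0.
      have [L hL] := holo_cdv (@cball_open _ (al t) d) hphi (nbhs_singleton near_al).
      apply/nbhs_ballP; exists (Order.min e (x / (cabs (rderive al t) + 1))).
        by rewrite /= lt_min e0 divr_gt0.
      move=> s; rewrite /ball /= distrC lt_min => /andP[/he h1 h2].
      by apply: le_lt_trans h1 _; rewrite mulrC -ltr_pdivlMr.
    have [L hL] := holo_cdv (@cball_open _ (al t) d) hphi (nbhs_singleton near_al).
    exact: cder_cont hL.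
  (* The factorisation must hold near each [s] close to [t], so that it can be differentiated at [s]
     and not only at [t]. *)
  have eW2 := near_join eW.
  near=> s.
  have b1 : cball (al t) d (al s) by near: s.
  have b2 : rder al s (rderive al s) by near: s.
  have b3 : \forall r \near s, W r = phi (al r) by near: s.
  apply: rder_ext (rder_comp (holoP hphi b1) b2).
  by apply: filterS b3 => r ->.
have rW t : rder W t (rderive W t).
  have [V [_ /nbhs_singleton h]] := key t.
  by rewrite (rder_rderive h).
split=> // t.
have [V [cV hV]] := key t.
apply/continuous_cabs => e e0.
have /continuous_cabs/(_ e e0) cV' := cV.
have hVt := nbhs_singleton hV.
near=> s.
have h1 : rder W s (V s) by near: s.
have h2 : cabs (V s - V t) < e by near: s.
by rewrite (rder_rderive h1) (rder_rderive hVt).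
Unshelve. all: by end_near. Qed.

Lemma rder_cont (p : R -> C) (t : R) L : rder p t L -> {for t, continuous p}.
Proof.
move=> /rder_locally[d d0 h]; apply/continuous_cabs => e e0; apply/nbhs_ballP.
have L0 : 0 < cabs L + 1 by rewrite ltr_wpDl // cabs_ge0.
exists (Order.min d (e / (cabs L + 1))); first by rewrite /= lt_min d0 divr_gt0.
move=> s; rewrite /ball /= distrC lt_min => /andP[/h hs h2]; apply: (le_lt_trans hs).
by rewrite mulrC -ltr_pdivlMr.
Qed.

Let W j i (t : R) : C := aff w j 0 (gam i t).
Let V j i (t : R) : C := rderive (W j i) t.
Local Notation kap := ((two_pi_i R)^-1).

Lemma W_cont j i : continuous (W j i).
Proof. by move=> t; have [h _] := bdry_path j i; exact: rder_cont (h t). Qed.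
Lemma V_cont j i : continuous (V j i).
Proof. by have [_ h] := bdry_path j i. Qed.
Lemma W1_neq0 i t : W 1 i t != 0.
Proof. by rewrite /W /aff mulf_neq0 ?invr_eq0 ?bdry_neq0 //; exact: gam_bdry. Qed.

Lemma G1E x y : G1 Q (x, y) = kint (W 1) (W 2) (V 1) (V 2) kap x y.
Proof.
rewrite /G1 /kint /bdry_integral; congr (_ * _); apply: eq_bigr => i _.
congr integral01; apply/funext => t; congr (_ * _).
have [h1 _] := bdry_path 1 i; have [h2 _] := bdry_path 2 i.
apply: rder_rderive.
have r0 : rder (fun=> x) t 0.
  by move=> e e0; exists 1 => // s _; rewrite subrr mul0r subrr cabs0 mulr_ge0 // ltW.
by have := rderD (rderD r0 (rderZ y (h1 t))) (h2 t); rewrite add0r.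
Qed.

Lemma deltaE : delta Q = kap * \sum_(i < nd_nb Q) integral01 (fun t => (W 1 i t)^-1 * V 1 i t).
Proof. by []. Qed.

Section Annulus.
Variables (omega : C) (rho_w : R).
Hypothesis h_rho : admissible_radius Q omega rho_w.

Lemma rho_ge0 : 0 <= rho Q.
Proof.
rewrite /rho; set A := [set _ | _ in _].
(* When the set has no supremum, [sup] is 0 by convention. *)
have [hA|/sup_out ->//] := pselect (has_sup A).
have [a Aa] := hA.1; have ub := ub_le_sup hA.2 Aa.
by apply: le_trans ub; case: Aa => p _ <-; exact: cabs_ge0.
Qed.
Lemma rho_w_gt0 : 0 < rho_w.
Proof. by case: h_rho => h _ _; exact: le_lt_trans rho_ge0 h. Qed.

Lemma mmin_le (y : C) p : bdry S p -> mmin Q y <= cabs (y * aff w 1 0 p + aff w 2 0 p).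
Proof.
move=> bp; apply: ge_inf; last by exists p.
by exists 0 => _ [q _ <-]; exact: cabs_ge0.
Qed.

(* For [x] in [D_omega] and [|y| >= rho_w] the form [x + y w_1 + w_2] has no zero
   on [bQ], that is, its zero in [y] has modulus less than [rho_w]. *)
Lemma pole_bound x i (t : R) : D_omega Q omega x -> cabs (pole (W 1) (W 2) x i t) <= rho_w.
Proof.
move=> Dx; rewrite leNgt; apply/negP => h.
case: h_rho => _ _ /(_ _ (ltW h)) hm.
have := mmin_le (pole (W 1) (W 2) x i t) (gam_bdry i t).
have -> : pole (W 1) (W 2) x i t * aff w 1 0 (gam i t) + aff w 2 0 (gam i t) = - x.
  by rewrite /pole -/(W 1 i t) -/(W 2 i t) divfK ?W1_neq0 // opprD subrK.
by rewrite cabsN; move: Dx; rewrite /D_omega /=; lra.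
Qed.

Variable g : nat -> {poly C}.
Hypothesis hg : G1_coefficients Q g.
Let c m x : C := kcoef (W 1) (W 2) (V 1) (V 2) kap m x.
Let c0 : C := kcoef0 (V 1) kap.

Lemma G1_bound : exists B : R, 0 <= B /\ forall x, D_omega Q omega x ->
  (forall m, cabs (c m x) <= B * rho_w ^+ m) /\
  forall y N, rho_w < cabs y ->
    cabs (G1 Q (x, y) - (c0 + \sum_(1 <= m < N.+1) c m.-1 x * y ^- m)) <=
    B / (cabs y - rho_w) * (rho_w / cabs y) ^+ N.
Proof.
have [B [B0 hB]] := kernel_bound kap (@W_cont 1) (@W_cont 2) (@V_cont 1) (@V_cont 2) W1_neq0 (ltW rho_w_gt0).
exists B; split=> // x Dx.
have [h1 h2] := hB x (fun i t _ => pole_bound i t Dx).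
by split=> // y N ry; rewrite G1E; exact: h2.
Qed.

(** For large [|y|] both expansions in [v = 1 / y] converge to [G1], so their difference is a power
    series with sum 0 and constant term [- c0]. The vanishing of [c0], up to a factor the total
    increment of [w_1 / w_0] along closed curves, comes out at the same time. *)
Lemma G1_coefE x m : D_omega Q omega x -> c0 = 0 /\ (g m.+1).[x] = c m x.
Proof.
move=> Dx; have [B [B0 /(_ x Dx)[hc hG]]] := G1_bound.
have [r hr] := hg x.
pose b k : C := if k is k'.+1 then (g k).[x] - c k' x else - c0.
suff bz k : b k = 0.
  split; first by have /eqP := bz 0%N; rewrite oppr_eq0 => /eqP.
  by have /eqP := bz m.+1; rewrite subr_eq0 => /eqP.
have rw := rho_w_gt0.
have M0 : 0 < `|r| + rho_w + 1 by rewrite ltr_wpDl // addr_ge0 // ltW.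
(* For such [v] the modulus of [y] exceeds both [rho_w] and [r], whose sign is unknown. *)
apply: (@powerseries_unique _ _ (`|r| + rho_w + 1)^-1); first by rewrite invr_gt0.
move=> v /andP[v0 vr].
have vn : v != 0 by rewrite -cabs_gt0.
pose y := v^-1.
have yr : `|r| + rho_w + 1 < cabs y.
  by rewrite /y cabsV -ltf_pV2 ?posrE ?invr_gt0 // invrK.
have y1 : rho_w < cabs y by have := normr_ge0 r; lra.
have y2 : r < cabs y by have := ler_norm r; lra.
have h1 := hr y y2.
have q01 : 0 <= rho_w / cabs y < 1.
  by rewrite divr_ge0 ?cabs_ge0 ?(ltW rw) //= ltr_pdivrMr ?mul1r //; lra.
have K0 : 0 <= B / (cabs y - rho_w) by rewrite divr_ge0 // subr_ge0 ltW.
have h2 : (fun N => c0 + \sum_(1 <= m < N.+1) c m.-1 x * y ^- m) @ \oo --> G1 Q (x, y).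
  by apply: (cvg_of_bound q01 K0) => N; rewrite cabsBC; exact: hG.
have h1' : (fun N => \sum_(1 <= m < N.+1) (g m).[x] * y ^- m) @ \oo --> G1 Q (x, y).
  by have := h1; rewrite -cvg_shiftS.
have : (fun N => \sum_(0 <= k < N.+1) b k * v ^+ k) @ \oo --> (0 : C).
  apply/cvg_cabs => e e0; have e20 : 0 < e / 2 by rewrite divr_gt0.
  have /cvg_cabs/(_ _ e20) n1 := h1'; have /cvg_cabs/(_ _ e20) n2 := h2.
  near=> N; have b1 : cabs (\sum_(1 <= m < N.+1) (g m).[x] * y ^- m - G1 Q (x, y)) < e / 2 by near: N.
  have b2 : cabs (c0 + \sum_(1 <= m < N.+1) c m.-1 x * y ^- m - G1 Q (x, y)) < e / 2 by near: N.
  rewrite [X in cabs X](_ : _ = (\sum_(1 <= m < N.+1) (g m).[x] * y ^- m - G1 Q (x, y)) -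
     (c0 + \sum_(1 <= m < N.+1) c m.-1 x * y ^- m - G1 Q (x, y))).
    by apply: le_lt_trans (cabsB _ _) _; lra.
  rewrite subr0 opprB addrA subrK opprD big_ltn // expr0 mulr1 addrCA; congr (_ + _).
  rewrite -sumrN -big_split /= big_nat [RHS]big_nat; apply: eq_bigr => -[//|l] _.
  by rewrite /b /y exprVn invrK mulrBl.
by rewrite (cvg_shiftS (fun N => \sum_(0 <= k < N) b k * v ^+ k)).
Unshelve. all: by end_near. Qed.

Lemma G1_coef_bound : exists B : R, 0 <= B /\ forall x, D_omega Q omega x ->
  (forall m, cabs (g m.+1).[x] <= B * rho_w ^+ m) /\
  forall y N, rho_w < cabs y ->
    cabs (G1 Q (x, y) - \sum_(1 <= m < N.+1) (g m).[x] * y ^- m) <=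
    B / (cabs y - rho_w) * (rho_w / cabs y) ^+ N.
Proof.
have [B [B0 hB]] := G1_bound; exists B; split=> // x Dx; have [h1 h2] := hB x Dx.
split; first by move=> m; rewrite (G1_coefE m Dx).2.
move=> y N ry; have := h2 y N ry; rewrite (G1_coefE 0 Dx).1 add0r.
congr (cabs (_ - _) <= _); rewrite big_nat [RHS]big_nat; apply: eq_bigr => -[//|l] _.
by rewrite (G1_coefE l Dx).2.
Qed.

Lemma D_omega_open : copen (D_omega Q omega).
Proof.
move=> x Dx; exists (mmin Q omega / 2 - cabs x); first by rewrite subr_gt0.
by move=> y yx; rewrite /D_omega /=; have := cabs_dist y x; lra.
Qed.

(** On the open set [D_omega] the polynomial agrees with the affine function given by [kcoef_first],
    and derivatives are unique. *)
Lemma g1_deriv x : D_omega Q omega x -> (g 1)^`().[x] = - delta Q.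
Proof.
move=> Dx; apply: (cder_unique (cder_horner (g 1) x)).
have h : cder (fun z => (g 1).[x] + - delta Q * (z - x)) x (- delta Q).
  have := cderD (cder_cst (g 1).[x] x) (cderZ (- delta Q) (cderB (cder_id x) (cder_cst x x))).
  by rewrite subr0 mulr1 add0r.
apply: cder_ext h; apply: filterS (copen_near D_omega_open Dx) => z Dz.
rewrite (G1_coefE 0 Dx).2 (G1_coefE 0 Dz).2 deltaE.
have := kcoef_first kap (@W_cont 1) (@W_cont 2) (@V_cont 1) (@V_cont 2) W1_neq0 z x.
by rewrite -/(c 0 z) -/(c 0 x) => <-; rewrite addrC subrK.
Qed.

End Annulus.
End BoundaryIntegrals.

(** * The function H and the operator E *)

Section PhaseFunction.
Variables (R : realType) (Q : nodal_domain R).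
Local Notation C := (cplx R).
Hypothesis hQ : general_position Q.
Variables (g : nat -> {poly C}) (omega : C) (rho_w : R).
Hypotheses (hg : G1_coefficients Q g) (h_rho : admissible_radius Q omega rho_w).
Local Notation D := (D_omega Q omega).
Local Notation E := (Z_omega Q omega rho_w).

Lemma exterior_open : copen [set y : C | rho_w < cabs y].
Proof.
move=> y ry; exists (cabs y - rho_w); first by rewrite subr_gt0.
by move=> w wy /=; have := cabs_dist y w; rewrite cabsBC; lra.
Qed.

Lemma E_open : popen E.
Proof. by have := pairP (@D_omega_open R Q omega) exterior_open. Qed.

Lemma E_neq0 p : E p -> p.2 != 0.
Proof.
by move=> [_ h]; rewrite -cabs_gt0 (lt_trans _ h) // (rho_w_gt0 h_rho).
Qed.

(** The data needed uniformly near a point: a ratio [q < 1] dominating [rho_w / |y|], and a margin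
    [e] in [x] on which the Cauchy estimate can be applied. *)
Lemma E_box p : E p -> exists r e q : R, [/\ 0 < r, 0 < e, 0 <= q < 1 &
  forall z, box p r z -> [/\ E z, rho_w / cabs z.2 <= q &
     forall x, cabs (x - z.1) < e -> D x]].
Proof.
move=> [Dp rp]; have rw := rho_w_gt0 h_rho.
have [d d0 hd] := @D_omega_open R Q omega _ Dp.
pose sg := (rho_w + cabs p.2) / 2.
have sg0 : rho_w < sg by rewrite /sg; lra.
exists (Order.min (d / 2) ((cabs p.2 - rho_w) / 2)), (d / 2), (rho_w / sg); split.
- by rewrite lt_min !divr_gt0 // subr_gt0.
- by rewrite divr_gt0.
- by rewrite divr_ge0 ?ler_pdivrMr ?ltr_pdivrMr ?mul1r //; lra.
move=> z []; rewrite !lt_min => /andP[a _] /andP[_ b].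
have sz : sg < cabs z.2 by have := cabs_dist p.2 z.2; rewrite cabsBC /sg; lra.
split.
- by split; [apply: hd; lra|exact: lt_trans sz].
- rewrite ler_pM2l // lef_pV2 ?posrE ?ltW //; lra.
- by move=> x xz; apply: hd; have := cabs_tri x z.1 p.1; lra.
Qed.

Definition kterm (m : nat) (p : C * C) : C := (g m.+1)^`().[p.1] / m%:R * p.2 ^- m.
Definition kpart (n : nat) (p : C * C) : C := \sum_(1 <= m < n) kterm m p.
Definition kser (p : C * C) : C := limn (kpart ^~ p).

Lemma kterm_holo m : sep_holo E (kterm m).
Proof.
apply: sh_mul.
  apply: (@sh_fst _ _ D (fun x => (g m.+1)^`().[x] / m%:R)).
  - exact: E_open.
  - exact: D_omega_open.
  - by move=> p [].
  move=> x _; eexists; apply: cderM; first exact: cder_horner.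
  exact: cder_cst.
apply: (@sh_snd _ _ [set y | rho_w < cabs y] (fun y => y ^- m)).
- exact: E_open.
- exact: exterior_open.
- by move=> p [].
move=> y ry; eexists; apply: cderXV.
by rewrite -cabs_gt0 (lt_trans _ ry) // (rho_w_gt0 h_rho).
Qed.

Lemma gterm_holo m : sep_holo E (fun p => (g m).[p.1] * p.2 ^- m).
Proof.
apply: sh_mul.
  apply: (@sh_fst _ _ D (fun x => (g m).[x])).
  - exact: E_open.
  - exact: D_omega_open.
  - by move=> p [].
  by move=> x _; eexists; exact: cder_horner.
apply: (@sh_snd _ _ [set y | rho_w < cabs y] (fun y => y ^- m)).
- exact: E_open.
- exact: exterior_open.
- by move=> p [].
move=> y ry; eexists; apply: cderXV.
by rewrite -cabs_gt0 (lt_trans _ ry) // (rho_w_gt0 h_rho).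
Qed.

(** The Cauchy estimate on a disc of radius [e] turns the bound [B * rho_w^m] of the coefficient
    into [B / e * rho_w^m] for its derivative; the factor [y ^- m] then leaves [q^m]. *)
Lemma kterm_bound p : E p -> exists r K q : R, [/\ 0 < r, 0 <= K, 0 <= q < 1 &
  forall z, box p r z -> E z /\ forall m, cabs (kterm m z) <= K * q ^+ m].
Proof.
move=> Ep; have [r [e [q [r0 e0 q01 h]]]] := E_box Ep.
have [B [B0 hB]] := G1_coef_bound hQ h_rho hg.
have rw := rho_w_gt0 h_rho.
exists r, (B / e), q; split=> //; first by rewrite divr_ge0 // ltW.
move=> z /h[Ez qz hD]; split=> // m.
have y0 : 0 < cabs z.2 by rewrite cabs_gt0 E_neq0.
have der : cabs (g m.+1)^`().[z.1] <= B / e * rho_w ^+ m.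
  rewrite mulrAC ler_pdivlMr //.
  apply: (cauchy_estimate (f := horner (g m.+1)) (c := z.1) e0 _ _ (cder_horner _ _)).
    by move=> x _; eexists; exact: cder_horner.
  by move=> x /hD Dx; have [h1 _] := hB _ Dx; exact: h1.
(* The term of index 0 vanishes because the inverse of 0 is 0; for the same reason the sum may start
   at 0 in [kpart0]. *)
case: m der => [|m] der.
  by rewrite /kterm invr0 mulr0 mul0r cabs0 mulr_ge0 ?exprn_ge0 //; [rewrite divr_ge0 // ltW|case/andP: q01].
rewrite /kterm !cabsM !cabsV cabsX.
have m1 : 1 <= cabs (m.+1%:R : C).
  rewrite -[m.+1%:R](rmorph_nat (real_complex R)) cabsr.
  by rewrite ger0_norm // ler1n.
apply: (@le_trans _ _ (B / e * rho_w ^+ m.+1 * 1 * (cabs z.2 ^+ m.+1)^-1)).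
  apply: ler_wpM2r; first by rewrite invr_ge0 exprn_ge0 // ltW.
  apply: ler_pM; rewrite ?cabs_ge0 ?invr_ge0 ?cabs_ge0 //.
  by rewrite invf_le1 //; exact: lt_le_trans m1.
rewrite mulr1 -mulrA -exprVn -exprMn; apply: ler_wpM2l.
  by rewrite divr_ge0 // ltW.
by rewrite lerXn2r ?nnegrE ?divr_ge0 ?(ltW rw) ?(ltW y0) //; case/andP: q01.
Qed.

Lemma kpart0 n p : kpart n p = \sum_(0 <= m < n) kterm m p.
Proof.
case: n => [|n]; first by rewrite /kpart !big_geq.
by rewrite [RHS]big_ltn // /kterm invr0 mulr0 mul0r add0r.
Qed.

Lemma kser_holo : sep_holo E kser /\
  forall p, E p -> exists e : nat -> R, [/\ forall n m, (n <= m)%N -> e m <= e n,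
     forall x, 0 < x -> exists n, e n < x &
     forall n, cabs (Dx (kpart n) p - Dx kser p) <= e n /\ cabs (Dy (kpart n) p - Dy kser p) <= e n].
Proof.
apply: sh_limit; first exact: E_open.
  by move=> n; apply: sh_sum; [exact: E_open|exact: kterm_holo].
move=> p Ep; have [r [K [q [r0 K0 q01 h]]]] := kterm_bound Ep.
have A0 : 0 <= 2 * K / (1 - q).
  by rewrite divr_ge0 ?mulr_ge0 // subr_ge0 ltW //; case/andP: q01.
exists r, (fun n => 2 * K / (1 - q) * q ^+ n); split=> //.
- move=> n z /h[Ez hz]; split=> //.
  have [l hl] := geo_series q01 hz.
  have hl' k : cabs (kpart k z - l) <= 2 * K / (1 - q) * q ^+ k by rewrite kpart0.
  by rewrite /kser (limn_of_bound q01 A0 hl').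
- by move=> n m; exact: geo_decr.
- by move=> x; exact: geometric_small.
Qed.

Lemma G1_holo : sep_holo E (G1 Q) /\
  forall p, E p -> exists e : nat -> R, [/\ forall n m, (n <= m)%N -> e m <= e n,
     forall x, 0 < x -> exists n, e n < x &
     forall n, cabs (Dx (fun p => \sum_(1 <= m < n.+1) (g m).[p.1] * p.2 ^- m) p - Dx (G1 Q) p) <= e n /\
       cabs (Dy (fun p => \sum_(1 <= m < n.+1) (g m).[p.1] * p.2 ^- m) p - Dy (G1 Q) p) <= e n].
Proof.
have [B [B0 hB]] := G1_coef_bound hQ h_rho hg.
apply: sh_limit; first exact: E_open.
  by move=> n; apply: sh_sum; [exact: E_open|exact: gterm_holo].
move=> p Ep; have [r [e [q [r0 e0 q01 h]]]] := E_box Ep.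
have [q0 q1] := andP q01; have rw := rho_w_gt0 h_rho.
have A0 : 0 <= B / (rho_w * (1 - q)).
  by rewrite divr_ge0 ?mulr_ge0 // ?ltW ?subr_gt0.
(* From [rho_w <= q * |y|] follows [rho_w * (1 - q) <= q * (|y| - rho_w)], which gives a constant
   free of [y]. *)
have K0 : 0 <= B * q / (rho_w * (1 - q)).
  by rewrite divr_ge0 ?mulr_ge0 // ?ltW ?subr_gt0.
exists r, (fun n => B * q / (rho_w * (1 - q)) * q ^+ n); split=> //.
- move=> n [x y] /h[[/= Dx ry] /= hq _]; split=> //.
  rewrite cabsBC; have [_ h2] := hB x Dx.
  have yp : 0 < cabs y by exact: lt_trans ry.
  have yr : 0 < cabs y - rho_w by rewrite subr_gt0.
  apply: (le_trans (h2 y n ry)); apply: ler_pM.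
  + by rewrite divr_ge0 // ltW.
  + by rewrite exprn_ge0 // divr_ge0 ?ltW.
  + rewrite -mulrA; apply: ler_wpM2l => //.
    rewrite -[(cabs y - rho_w)^-1]mul1r ler_pdivrMr // mulrAC ler_pdivlMr ?mulr_gt0 ?subr_gt0 //.
    by rewrite ler_pdivrMr // in hq; nra.
  + by rewrite lerXn2r ?nnegrE // divr_ge0 // ltW.
- by move=> n m; exact: geo_decr.
- by move=> x; exact: geometric_small.
Qed.

(** The [1 / m] in [kterm] is made for this: the derivative in [y] of the term of index [m] is minus
    the term of index [m + 1] of [dG1/dx], whose first term is [- delta / y] by [g1_deriv]. *)
Lemma Dx_G1 p : E p -> Dx (G1 Q) p = - delta Q / p.2 - Dy kser p.
Proof.
move=> Ep; have y0 := E_neq0 Ep.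
have [e [emon esm he]] := kser_holo.2 _ Ep.
have [e' [emon' esm' he']] := G1_holo.2 _ Ep.
have Dxp N : Dx (fun p => \sum_(1 <= m < N.+1) (g m).[p.1] * p.2 ^- m) p =
   \sum_(1 <= m < N.+1) (g m)^`().[p.1] * p.2 ^- m.
  apply: cder_Dx; apply: cder_sum => m _.
  have := cderM (cder_horner (g m) p.1) (cder_cst (p.2 ^- m) p.1).
  by rewrite mulr0 addr0.
have Dyk N : Dy (kpart N) p = - \sum_(1 <= m < N) (g m.+1)^`().[p.1] * p.2 ^- m.+1.
  apply: cder_Dy; rewrite -sumrN /kpart big_nat; under eq_fun do rewrite big_nat.
  apply: cder_sum => m /andP[m0 _].
  have := cderZ ((g m.+1)^`().[p.1] / m%:R) (cderXV m y0).
  congr cder; rewrite mulrA mulrN -mulrA mulNr mulVf ?mulr1 ?mulNr //.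
  by rewrite pnatr_eq0 -lt0n.
(* The upper bounds differ by one because index [m] of [kpart] corresponds to index [m + 1] of the
   expansion of [G1]. *)
have rel N : Dx (fun p => \sum_(1 <= m < N.+2) (g m).[p.1] * p.2 ^- m) p =
    - delta Q / p.2 - Dy (kpart N.+1) p.
  rewrite Dxp Dyk opprK big_ltn //; congr (_ + _).
    by rewrite (g1_deriv hQ h_rho hg (proj1 Ep)).
  by rewrite big_add1.
apply/eqP; rewrite -subr_eq0 -cabs_eq0 eq_le cabs_ge0 andbT.
apply: (@forall_le0 _ _ 2) => x x0.
have [n hn] := esm _ x0; have [n' hn'] := esm' _ x0.
set N := maxn n n'.
have h1 := (he N.+1).2; have h2 := (he' N.+1).1.
have a1 : e N.+1 < x by apply: le_lt_trans hn; apply: emon; rewrite leqW // leq_maxl.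
have a2 : e' N.+1 < x by apply: le_lt_trans hn'; apply: emon'; rewrite leqW // leq_maxr.
rewrite rel in h2; move: h1 h2.
move: (Dx (G1 Q) p) (Dy kser p) (Dy (kpart N.+1) p) (- delta Q / p.2) => a b c u h1 h2.
have -> : a - (u - b) = - (u - c - a) - (c - b) by ring.
by apply: (le_trans (cabsB _ _)); rewrite cabsN; lra.
Qed.

(** * The functions [J] and [H] and the operator [E] for a fixed slit *)

Section Slit.
Variable tau : C.
Hypotheses (t1 : cabs tau = 1) (tw : ~ ray tau omega).
Local Notation U := (Z_omega_tau Q omega rho_w tau).

Lemma ZtauE : U = [set p | D p.1 /\ Omega rho_w tau p.2].
Proof.
by apply/seteqP; split => p; [move=> [[? ?] ?]|move=> [? [? ?]]]; split.
Qed.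

Lemma U_open : popen U.
Proof. by rewrite ZtauE; apply: slit_popen => //; exact: D_omega_open. Qed.

Lemma UE : U `<=` E.
Proof. by move=> p []. Qed.

Lemma omega_Omega : Omega rho_w tau omega.
Proof. by case: h_rho. Qed.

Lemma Omega_sub0 y : Omega rho_w tau y -> Omega 0 tau y.
Proof. by move=> [h1 h2]; split=> //; exact: lt_trans (rho_w_gt0 h_rho) h1. Qed.

Lemma J_spec : (forall y, Omega 0 tau y -> cder (J omega tau) y y^-1) /\ J omega tau omega = 0.
Proof.
(* The existence lemma with a parameter is reused here with a dummy [x]. *)
pose T : set C := setT.
have oT : copen T by move=> z _; exists 1.
have [F [_ dF]] : exists F, sep_holo [set p | T p.1 /\ Omega 0 tau p.2] F /\
    forall p, T p.1 /\ Omega 0 tau p.2 -> cder (fun y => F (p.1, y)) p.2 ((fun q : C * C => q.2^-1) p).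
  apply: sh_primitive_slit => //.
  apply: (@sh_snd _ _ (Omega 0 tau) (fun y => y^-1)).
  - exact: slit_popen.
  - exact: Omega_open.
  - by move=> p [].
  by move=> y Oy; eexists; apply: cder_inv; exact: Omega_neq0 Oy.
have JE y : Omega 0 tau y -> J omega tau y = F (0, y) - F (0, omega).
  move=> Oy; apply: (@primitiveE _ 0 tau (lexx 0) t1 omega (fun y => y^-1) (fun y => F (0, y))) => //.
    by move=> z Oz; exact: (dF (0, z)).
  exact: Omega_sub0 omega_Omega.
split; last by rewrite JE ?subrr //; exact: Omega_sub0 omega_Omega.
move=> y Oy.
have := cderB (dF (0, y) (conj I Oy)) (cder_cst (F (0, omega)) y); rewrite subr0 /=.
by apply: cder_ext; apply: filterS (copen_near (Omega_open (r := 0) t1) Oy) => z /JE ->.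
Qed.

Lemma HE p : H Q g omega tau p = - delta Q * J omega tau p.2 - kser p.
Proof. by []. Qed.

Lemma H_holo : sep_holo U (H Q g omega tau).
Proof.
have hk := sh_sub U_open UE kser_holo.1.
have hJ : sep_holo U (fun p => - delta Q * J omega tau p.2).
  apply: (@sh_snd _ _ (Omega 0 tau) (fun y => - delta Q * J omega tau y)).
  - exact: U_open.
  - exact: Omega_open.
  - by rewrite ZtauE => p [_]; exact: Omega_sub0.
  by move=> y Oy; eexists; apply: cderZ; exact: J_spec.1 Oy.
have hm := sh_mul (sh_cst (-1) U_open) hk.
by apply: sh_ext (sh_add hJ hm) => p _; rewrite HE mulN1r.
Qed.

Lemma Dy_H p : U p -> cder (fun y => H Q g omega tau (p.1, y)) p.2 (Dx (G1 Q) p).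
Proof.
move=> Up; have Ep := UE Up; rewrite Dx_G1 //.
apply: (cderB (f := fun y => - delta Q * J omega tau y) (g := fun y => kser (p.1, y))).
  apply: cderZ; apply: J_spec.1; apply: Omega_sub0.
  by move: Up; rewrite ZtauE => -[].
exact: sh_Dy kser_holo.1 Ep.
Qed.

Lemma H_omega x : H Q g omega tau (x, omega) = - kser (x, omega).
Proof. by rewrite HE /= J_spec.2 mulr0 sub0r. Qed.

Lemma Dop_holo f : sep_holo U f -> sep_holo U (Dop Q g omega tau f).
Proof.
move=> hf; apply: sh_add (sh_Dx_closed hf) _.
exact: sh_mul (sh_Dx_closed H_holo) hf.
Qed.

(** The definition through [xget] is unfolded only here; the triangular system relies on these three
    properties alone. *)
Lemma Eop_spec f : sep_holo U f ->
  [/\ sep_holo U (Eop Q g omega rho_w tau f),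
      forall p, U p -> cder (fun y => Eop Q g omega rho_w tau f (p.1, y)) p.2 (Dop Q g omega tau f p) &
      forall x, D x -> Eop Q g omega rho_w tau f (x, omega) = 0].
Proof.
move=> hf; have hD := Dop_holo hf; have r0 := ltW (rho_w_gt0 h_rho).
rewrite ZtauE in hD.
have [F [hF dF]] := sh_primitive_slit r0 t1 (@D_omega_open R Q omega) hD.
have EE p : U p -> Eop Q g omega rho_w tau f p = F p - F (p.1, omega).
  rewrite ZtauE => -[Dp Op]; rewrite /Eop /primitive_y.
  rewrite (@primitiveE _ rho_w tau r0 t1 omega _ (fun y => F (p.1, y))) //.
  - by case: p {Dp Op}.
  - by move=> z Oz; exact: (dF (p.1, z)).
  - exact: omega_Omega.
split.
- have hc : sep_holo U (fun p => F (p.1, omega)).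
    apply: (@sh_fst _ _ D (fun x => F (x, omega))).
    - exact: U_open.
    - exact: D_omega_open.
    - by move=> p [[]].
    by move=> x Dx; exact: (sh_x hF (p := (x, omega))) (conj Dx omega_Omega).
  rewrite -ZtauE in hF.
  have hm := sh_mul (sh_cst (-1) U_open) hc.
  by apply: sh_ext (sh_add hF hm) => p Up; rewrite EE // mulN1r.
- move=> p Up; have := Up; rewrite ZtauE => Up'.
  have := cderB (dF p Up') (cder_cst (F (p.1, omega)) p.2); rewrite subr0.
  apply: cder_ext; have Uy : [set y | U (p.1, y)] p.2 by move: Up; rewrite /=; case: (p).
  by apply: filterS (copen_near (popenY U_open Up) Uy) => y Uxy; rewrite EE.
by move=> x Dx; rewrite EE ?subrr // ZtauE; split=> //; exact: omega_Omega.
Qed.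

End Slit.
End PhaseFunction.

(** * The triangular system *)

Section Triangular.
Variables (R : realType) (Q : nodal_domain R).
Local Notation C := (cplx R).
Hypothesis hQ : general_position Q.
Variables (g : nat -> {poly C}) (omega : C) (rho_w : R).
Hypotheses (hg : G1_coefficients Q g) (h_rho : admissible_radius Q omega rho_w).
Variables (A B : {poly C}).
Hypothesis hBroots : forall z, root B z -> cabs z <= rho Q.
Local Notation D := (D_omega Q omega).
Local Notation E := (Z_omega Q omega rho_w).
Local Notation U := (Z_omega_tau Q omega rho_w).
Local Notation H := (H Q g omega).
Local Notation Eop := (Eop Q g omega rho_w).
Local Notation Dop := (Dop Q g omega).

Lemma B_neq0 p : E p -> B.[p.2] != 0.
Proof.
move=> [_ ry]; apply/negP => /eqP h0.
have /hBroots : root B p.2 by apply/rootP.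
by case: h_rho => h _ _; rewrite leNgt (lt_trans h ry).
Qed.

Lemma Dx_N p : E p -> Dx (Nfun Q A B) p = Dx (G1 Q) p - B^`().[p.2] / B.[p.2].
Proof.
move=> Ep; apply: cder_Dx; rewrite /Nfun.
have h1 := sh_Dx (G1_holo hQ hg h_rho).1 Ep.
have h2 : cder (fun x => Defs.Pfun A B (x, p.2)) p.1 (B^`().[p.2] / B.[p.2]).
  rewrite /Defs.Pfun /=.
  have := cderD (cder_cst (A.[p.2] / B.[p.2]) p.1) (cderZ (B^`().[p.2] / B.[p.2]) (cder_id p.1)).
  by rewrite add0r mulr1.
exact: (cderB h1 h2).
Qed.

Section FixedSlit.
Variable tau : C.
Hypotheses (t1 : cabs tau = 1) (tw : ~ ray tau omega).
Variables (d : nat) (mu : nat -> C -> C).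
Hypothesis hmu : forall k, (1 <= k <= d)%N -> holo D (mu k).

Definition Tsum (k : nat) (p : C * C) : C :=
  \sum_(0 <= j < (d - k).+1) iter j (Eop tau) (tensor (mu (k + j)%N) (fun=> 1)) p.

Lemma U_slit_open : popen (U tau).
Proof. exact: U_open. Qed.

Lemma tensor_holo k : (1 <= k <= d)%N -> sep_holo (U tau) (tensor (mu k) (fun=> 1)).
Proof.
move=> hk; have hm : sep_holo (U tau) (fun p => mu k p.1).
  apply: (@sh_fst _ _ D (mu k)).
  - exact: U_slit_open.
  - exact: D_omega_open.
  - by move=> p [[]].
  exact: hmu.
by apply: sh_ext hm => p _; rewrite /tensor mulr1.
Qed.

Lemma iter_holo k j : (1 <= k <= d)%N -> sep_holo (U tau) (iter j (Eop tau) (tensor (mu k) (fun=> 1))).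
Proof.
move=> hk; elim: j => [|j IH] /=; first exact: tensor_holo.
by have [h _ _] := Eop_spec hQ hg h_rho t1 tw IH.
Qed.

Lemma Tsum_top p : Tsum d p = mu d p.1.
Proof. by rewrite /Tsum subnn big_nat1 /= addn0 /tensor mulr1. Qed.

(** Apart from [mu k], the sum for [k] arises from the sum for [k.+1] by one more [Eop] on each
    term. Working term by term avoids the additivity of [Eop]. *)
Lemma Tsum_rec k p : (k < d)%N -> Tsum k p = mu k p.1 +
  \sum_(0 <= j < (d - k.+1).+1) iter j.+1 (Eop tau) (tensor (mu (k.+1 + j)%N) (fun=> 1)) p.
Proof.
move=> kd; rewrite /Tsum -(subnSK kd) big_nat_recl // addn0 {1}/tensor /= mulr1.
congr (_ + _); apply: eq_bigr => j _.
by rewrite addnS addSn.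
Qed.

Lemma in_range k j : (0 < k <= d)%N -> (0 <= j < (d - k).+1)%N -> (0 < k + j <= d)%N.
Proof. by move=> /andP[k0 kd] /=; rewrite ltnS => jd; rewrite addn_gt0 k0 /= -leq_subRL. Qed.

Lemma Tsum_dy k p : (1 <= k)%N -> (k < d)%N -> U tau p ->
  cder (fun y => Tsum k (p.1, y)) p.2 (Dop tau (Tsum k.+1) p).
Proof.
move=> k1 kd Up.
have hk1 : (1 <= k.+1 <= d)%N by rewrite kd.
have dT : Dx (Tsum k.+1) p = \sum_(0 <= j < (d - k.+1).+1)
    Dx (iter j (Eop tau) (tensor (mu (k.+1 + j)%N) (fun=> 1))) p.
  apply: cder_Dx; rewrite /Tsum.
  by apply: cder_sum_nat => j jd; apply: sh_Dx Up; exact: iter_holo (in_range hk1 jd).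
have hs := @cder_sum_nat _ 0 (d - k.+1).+1
  (fun j y => iter j.+1 (Eop tau) (tensor (mu (k.+1 + j)%N) (fun=> 1)) (p.1, y))
  (fun j => Dop tau (iter j (Eop tau) (tensor (mu (k.+1 + j)%N) (fun=> 1))) p) p.2.
rewrite /Dop dT {2}/Tsum mulr_sumr -big_split /= -[X in cder _ _ X]add0r.
apply: cder_ext (cderD (cder_cst (mu k p.1) p.2) (hs _)).
  by near=> y; rewrite Tsum_rec.
move=> j jd.
by have [_ h _] := Eop_spec hQ hg h_rho t1 tw (iter_holo j (in_range hk1 jd)); exact: h.
Unshelve. all: by end_near. Qed.

Lemma Tsum_omega k x : (1 <= k <= d)%N -> D x -> Tsum k (x, omega) = mu k x.
Proof.
move=> /andP[k1]; rewrite leq_eqVlt => /orP[/eqP -> Dx|kd Dx]; first by rewrite Tsum_top.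
have hk1 : (1 <= k.+1 <= d)%N by rewrite kd.
rewrite Tsum_rec // big_nat big1 ?addr0 // => j jd.
by have [_ _ h] := Eop_spec hQ hg h_rho t1 tw (iter_holo j (in_range hk1 jd)); exact: h.
Qed.

Lemma cexpNH_x p : U tau p -> cder (fun x => cexp (- H tau (x, p.2))) p.1 (- Dx (H tau) p * cexp (- H tau p)).
Proof.
move=> Up; have h := cderN (sh_Dx (H_holo hQ hg h_rho t1 tw) Up).
have := cder_comp (g := fun x => - H tau (x, p.2)) (cder_cexp _) h.
by rewrite mulrC; case: p {Up h}.
Qed.
Lemma cexpNH_y p : U tau p -> cder (fun y => cexp (- H tau (p.1, y))) p.2 (- Dx (G1 Q) p * cexp (- H tau p)).
Proof.
move=> Up; have h := cderN (Dy_H hQ hg h_rho t1 tw Up).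
have := cder_comp (g := fun y => - H tau (p.1, y)) (cder_cexp _) h.
by rewrite mulrC; case: p {Up h}.
Qed.

Variable s : nat -> C * C -> C.
Hypothesis sx : forall k p, (1 <= k <= d)%N -> E p -> cder (fun x => s k (x, p.2)) p.1 (Dx (s k) p).
Hypothesis sy : forall k p, (1 <= k <= d)%N -> E p -> cder (fun y => s k (p.1, y)) p.2 (Dy (s k) p).

(** The [sigma_k] of the overview; [B * exp (- H)] is an integrating factor in [y] of the operator
    [f |-> - f * dN/dx + df/dy]. *)
Definition gauged k p : C := B.[p.2] * s k p * cexp (- H tau p).

Lemma gauged_x k p : (1 <= k <= d)%N -> U tau p ->
  cder (fun x => gauged k (x, p.2)) p.1
    (B.[p.2] * cexp (- H tau p) * Dx (s k) p - Dx (H tau) p * gauged k p).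
Proof.
move=> hk Up; have Ep := UE Up.
have := cderM (cderZ B.[p.2] (sx hk Ep)) (cexpNH_x Up).
congr cder; rewrite /gauged; case: p {Up Ep} => x y /=.
move: (Dx (s k) (x, y)) (Dx (H tau) (x, y)) (s k (x, y)) (cexp _) (B.[y]) => a b c e f.
by ring.
Qed.

(** Differentiating [B] supplies the part [B' / B] of [dN/dx], and differentiating [exp (- H)]
    supplies the part [dG1/dx]. *)
Lemma gauged_y k p : (1 <= k <= d)%N -> U tau p ->
  cder (fun y => gauged k (p.1, y)) p.2
    (B.[p.2] * cexp (- H tau p) * (- s k p * Dx (Nfun Q A B) p + Dy (s k) p)).
Proof.
move=> hk Up; have Ep := UE Up; have b0 := B_neq0 Ep.
have := cderM (cderM (cder_horner B p.2) (sy hk Ep)) (cexpNH_y Up).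
congr cder; rewrite Dx_N // /gauged; case: p {Up Ep} b0 => x y /= b0.
move: (Dx (G1 Q) (x, y)) (Dy (s k) (x, y)) (s k (x, y)) (cexp _) (B^`().[y]) => a b c e f.
by field.
Qed.

Lemma system_solved :
  (forall p, E p -> - s d p * Dx (Nfun Q A B) p + Dy (s d) p = 0 /\
     forall k, (1 <= k <= d.-1)%N -> - s k p * Dx (Nfun Q A B) p + Dy (s k) p = Dx (s k.+1) p) ->
  (forall k x, (1 <= k <= d)%N -> D x -> gauged k (x, omega) = mu k x) ->
  forall k p, (1 <= k <= d)%N -> U tau p -> gauged k p = Tsum k p.
Proof.
move=> sys init.
have Ow := omega_Omega h_rho tw.
(* On the slit domain a function of [y] is determined by its derivative and its value at [omega]. *)
have conclude k : (1 <= k <= d)%N -> (forall p, U tau p ->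
    exists L, cder (fun y => gauged k (p.1, y)) p.2 L /\ cder (fun y => Tsum k (p.1, y)) p.2 L) ->
    forall p, U tau p -> gauged k p = Tsum k p.
  move=> hk hd p Up; have := Up; rewrite ZtauE => -[Dp Op].
  have := @slit_constant _ rho_w tau (ltW (rho_w_gt0 h_rho)) t1 (fun y => gauged k (p.1, y) - Tsum k (p.1, y)) p.2 omega _ Op Ow.
  rewrite init // Tsum_omega // subrr => h; apply/eqP; rewrite -subr_eq0; apply/eqP.
  move: h; case: p Up Dp Op => x y /= Up Dp Op; apply => z Oz.
  have Uz : U tau (x, z) by rewrite ZtauE.
  by have [L [h1 h2]] := hd _ Uz; have := cderB h1 h2; rewrite subrr.
(* Induction on [i = d - k], since the equation of index [k] involves the solution of index
   [k + 1]. *)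
have key i : (i < d)%N -> forall p, U tau p -> gauged (d - i)%N p = Tsum (d - i)%N p.
  elim: i => [|i IH] id.
    rewrite subn0; apply: conclude; first by rewrite id /=.
    move=> p Up; exists 0; split.
      have := gauged_y (k := d) (introT andP (conj id (leqnn d))) Up.
      by rewrite (sys _ (UE Up)).1 mulr0.
    by under eq_fun do rewrite Tsum_top /=; exact: cder_cst.
  have ki : (0 < d - i.+1)%N by rewrite subn_gt0.
  have hk : (1 <= d - i.+1 <= d)%N by rewrite ki leq_subr.
  have kd : (d - i.+1 < d)%N by rewrite ltn_subrL (leq_trans _ id).
  have kS : (d - i.+1).+1 = (d - i)%N by rewrite subnSK // ltnW.
  have hk1 : (1 <= (d - i.+1).+1 <= d)%N by rewrite kd.
  apply: conclude => // p Up; exists (Dop tau (Tsum (d - i.+1).+1) p); split; last exact: Tsum_dy.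
  have := gauged_y hk Up.
  have hk2 : (1 <= d - i.+1 <= d.-1)%N.
    by rewrite ki -ltnS prednK // (leq_trans _ id).
  rewrite ((sys _ (UE Up)).2 _ hk2); congr cder.
  have eqg q : U tau q -> gauged (d - i.+1).+1 q = Tsum (d - i.+1).+1 q.
    by rewrite kS; apply: IH; exact: ltnW.
  (* By induction the two functions of index [k + 1] agree on an open set, hence so do their images
     under [Dop]; the term [Dx H * gauged] of [gauged_x] then cancels. *)
  rewrite /Dop -(Dx_ext U_slit_open eqg Up) -(eqg _ Up).
  by rewrite (cder_Dx (gauged_x hk1 Up)) subrK.
move=> k p /andP[k1 kd] Up; rewrite -[k](subKn kd); apply: key => //.
by rewrite ltn_subrL k1 (leq_trans k1 kd).
Qed.

(** The computation of [system_solved] read backwards: [B * exp (- H)] has no zero on the domain and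
    can be cancelled. *)
Lemma solved_system :
  (forall k p, (1 <= k <= d)%N -> U tau p -> B.[p.2] * s k p = Tsum k p * cexp (H tau p)) ->
  forall p, U tau p -> (0 < d)%N ->
   - s d p * Dx (Nfun Q A B) p + Dy (s d) p = 0 /\
     forall k, (1 <= k <= d.-1)%N -> - s k p * Dx (Nfun Q A B) p + Dy (s k) p = Dx (s k.+1) p.
Proof.
move=> sol p Up d0; have Ep := UE Up.
have eqg k q : (1 <= k <= d)%N -> U tau q -> gauged k q = Tsum k q.
  move=> hk Uq; rewrite /gauged (sol _ _ hk Uq) -mulrA [cexp _ * _]mulrC cexpN mulr1 //.
have u0 : B.[p.2] * cexp (- H tau p) != 0 by rewrite mulf_neq0 ?B_neq0 ?cexp_neq0.
have Uy : [set y | U tau (p.1, y)] p.2 by move: Up; rewrite /=; case: (p).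
have dy k L : (1 <= k <= d)%N -> cder (fun y => Tsum k (p.1, y)) p.2 L ->
    B.[p.2] * cexp (- H tau p) * (- s k p * Dx (Nfun Q A B) p + Dy (s k) p) = L.
  move=> hk hL; apply: cder_unique (gauged_y hk Up) _; apply: cder_ext hL.
  by apply: filterS (copen_near (popenY U_slit_open Up) Uy) => y Uxy; rewrite eqg.
split.
  apply: (mulfI u0); rewrite mulr0; apply: dy; first by rewrite d0 leqnn.
  by under eq_fun do rewrite Tsum_top /=; exact: cder_cst.
move=> k /andP[k1 kd]; have kd' : (k < d)%N by rewrite -(prednK d0) ltnS.
apply: (mulfI u0).
rewrite (dy k _ _ (Tsum_dy k1 kd' Up)); last by rewrite k1 ltnW.
have hk1 : (1 <= k.+1 <= d)%N by rewrite kd'.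
have eqk q : U tau q -> gauged k.+1 q = Tsum k.+1 q by exact: eqg.
rewrite /Dop -(Dx_ext U_slit_open eqk Up) -(eqk _ Up).
by rewrite (cder_Dx (gauged_x hk1 Up)) subrK.
Qed.

End FixedSlit.

End Triangular.

Local Close Scope complex_scope.
Unset Implicit Arguments.

Theorem proposition28 (R : realType) (Q : nodal_domain R)
  (hQ : general_position Q)
  (g : nat -> {poly cplx R}) (hg : G1_coefficients Q g)
  (omega : cplx R) (rho_w : R)
  (h_rho_w : admissible_radius Q omega rho_w)
  (A B : {poly cplx R}) (hAB : (size A < size B)%N) (hB0 : B.[0] = 1)
  (hBroots : forall z, root B z -> cabs z <= rho Q)
  (d : nat) (hd : (0 < d)%N) (s : nat -> cplx R * cplx R -> cplx R)
  (hs : forall k, (1 <= k <= d)%N ->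
     holomorphic_on (Z_omega Q omega rho_w) (s k)) :
  (forall p, Z_omega Q omega rho_w p ->
     - s d p * Dx (Nfun Q A B) p + Dy (s d) p = 0 /\
     forall k, (1 <= k <= d.-1)%N ->
       - s k p * Dx (Nfun Q A B) p + Dy (s k) p = Dx (s k.+1) p)
  <->
  (exists mu : nat -> cplx R -> cplx R,
     (forall k, (1 <= k <= d)%N -> holomorphic_on (D_omega Q omega) (mu k)) /\
     forall tau : cplx R, cabs tau = 1 -> Omega (rho Q) tau omega ->
     forall k, (1 <= k <= d)%N ->
     forall p, Z_omega_tau Q omega rho_w tau p ->
       tensor (fun=> 1) (horner B) p * s k p =
       (\sum_(0 <= j < (d - k).+1)
          iter j (Eop Q g omega rho_w tau) (tensor (mu (k + j)%N) (fun=> 1)) p)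
       * cexp (H Q g omega tau p)).
Proof.
have sx k p : (1 <= k <= d)%N -> Z_omega Q omega rho_w p ->
    cder (fun x => s k (x, p.2)) p.1 (Dx (s k) p).
  by move=> hk Ep; apply: derivable_x; apply: diff_derivable; exact: hs.
have sy k p : (1 <= k <= d)%N -> Z_omega Q omega rho_w p ->
    cder (fun y => s k (p.1, y)) p.2 (Dy (s k) p).
  by move=> hk Ep; apply: derivable_y; apply: diff_derivable; exact: hs.
have romega : rho_w < cabs omega by case: h_rho_w.
have rhow : rho Q < rho_w by case: h_rho_w.
have rw0 := rho_w_gt0 h_rho_w.
split=> [sys|[mu [hmu sol]]]; last first.
  move=> p Ep.
  have om0 : omega != 0 by rewrite -cabs_gt0 (lt_trans rw0).
  have [tau [t1 tw tp]] := slit_choice om0 (E_neq0 h_rho_w Ep).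
  have Up : Z_omega_tau Q omega rho_w tau p by split.
  have hmu' k : (1 <= k <= d)%N -> holo (D_omega Q omega) (mu k).
    by move=> hk; apply/holomorphic_onP; exact: hmu.
  apply: (solved_system hQ hg h_rho_w A hBroots t1 tw hmu' sx sy _ Up hd) => k q hk Uq.
  have := sol tau t1 _ k hk q Uq.
  by rewrite /tensor mul1r; apply; split=> //; exact: lt_trans romega.
(* [kser] replaces [- H]: the two agree at [y = omega] by [H_omega], and [kser] is defined without a
   slit. *)
pose mu k x := B.[omega] * s k (x, omega) * cexp (kser g (x, omega)).
have Eomega x : D_omega Q omega x -> Z_omega Q omega rho_w (x, omega) by [].
have hmu k : (1 <= k <= d)%N -> holo (D_omega Q omega) (mu k).
  move=> hk x Dx; have Ex := Eomega _ Dx; eexists; apply: cderM.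
    exact: cderZ (sx _ _ hk Ex).
  apply: (cder_comp (g := fun x => kser g (x, omega))); first exact: cder_cexp.
  exact: sh_Dx (kser_holo hQ hg h_rho_w).1 Ex.
exists mu; split; first by move=> k hk; apply/holomorphic_onP; exact: hmu.
move=> tau t1 [_ tw] k hk p Up.
have := system_solved hQ hg h_rho_w hBroots t1 tw hmu sx sy sys _ hk Up.
rewrite /gauged /Tsum => <-.
  by rewrite /tensor mul1r -[RHS]mulrA cexpN mulr1.
by move=> j x _ Dx; rewrite /gauged /= (H_omega g h_rho_w t1 tw) opprK.
Qed.
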